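(* Let $E$ be a space of functions on the interval $[0,1]$, either $E=C[0,1]$ or $E=L^p[0,1]$ with $1\leq p<\infty$. Let $\{J_{\alpha}\}_{\alpha>0}$ be a family of bounded linear operators on $E$ satisfying the following three axioms: (i) $(J_1f)(x)=\int_0^xf(t)\,\mathrm{d}t$ for every $f\in E$ and a.e. $x\in[0,1]$. (ii) Semigroup property: $J_{\alpha}J_{\beta}=J_{\alpha+\beta}$ for all $\alpha,\beta>0$. (iii) Continuity: the map $\alpha\mapsto J_{\alpha}$ is continuous from $(0,\infty)$ into the space $\mathcal{L}(E)$ under some metric weaker than the operator norm metric on this space. Then there exists a fixed $n\in\mathbb{Z}$ such that, for every $\alpha>0$ and every $f\in E$, \[ J_{\alpha}f=e^{2n\pi i\alpha}\cdot I^{\alpha}_{0}f . \]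
   Context: Functions are complex-valued. $C[0,1]$ carries the supremum norm and $L^p[0,1]$ the usual $L^p$ norm. $\mathcal{L}(E)$ is the space of bounded linear operators from $E$ to itself. A metric on $\mathcal{L}(E)$ is weaker than the operator norm metric if the topology it induces is coarser than (contained in) the operator norm topology. The Riemann--Liouville fractional integral of order $\alpha>0$ with constant of integration $0$ is \[ (I^{\alpha}_{0}f)(x)=\frac{1}{\Gamma(\alpha)}\int_{0}^{x}(x-t)^{\alpha-1}f(t)\,\mathrm{d}t . \] *)

(* Defs.v *)
From HB Require Import structures.
From mathcomp Require Import all_boot all_order all_algebra generic_quotient.
From mathcomp Require Import ring_quotient complex.
From mathcomp Require Import all_classical all_reals all_analysis measurable_realfun.

Set Implicit Arguments.
Unset Strict Implicit.
Unset Printing Implicit Defensive.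

Import Order.TTheory GRing.Theory Num.Theory.
Import numFieldNormedType.Exports Normc.

Local Open Scope classical_set_scope.
Local Open Scope ring_scope.
Local Open Scope complex_scope.
Local Open Scope quotient_scope.

Definition I01 {R : realType} : set R := `[0, 1]%classic.

(* An element of either space is a class of functions R -> R[i], of which only
   the values on [0, 1] matter: two representatives are identified when they
   agree on [0, 1] (for C[0, 1]), resp. almost everywhere on [0, 1] (for
   L^p[0, 1]).  [fspace_sort E] below is the resulting normed module; [fspace]
   only names the space. *)
Inductive fspace (R : realType) :=
| C01
| L01 (p : R) of 1 <= p.
Arguments C01 {R}.
Arguments L01 {R p} _.

Section representatives.
Context {R : realType}.
Local Notation C := (R[i]^o).
Local Notation mu := (@lebesgue_measure R).

(* |f|, extended by 0 outside [0, 1] *)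
Definition cmod_fun (f : R -> C) : R -> R := (fun x => normc (f x)) \_ I01.

(* Measurability is Borel measurability; every Lebesgue measurable function is
   a.e. equal to a Borel one, so the L^p classes are the usual ones. *)
Definition carrier_def (E : fspace R) (f : R -> C) : Prop :=
  match E with
  | C01 => {within I01, continuous f}
  | @L01 _ p _ =>
      [/\ measurable_fun I01 (fun x => complex.Re (f x)),
          measurable_fun I01 (fun x => complex.Im (f x)) &
          finite_norm mu p%:E (cmod_fun f)]
  end.

Definition same (E : fspace R) (f g : R -> C) : Prop :=
  match E with
  | C01 => {in I01, f =1 g}
  | L01 _ _ => ae_eq mu I01 f g
  end.

Definition seminorm (E : fspace R) (f : R -> C) : R :=
  match E with
  | C01 => sup [set normc (f x) | x in I01]
  | @L01 _ p _ => fine ('N[mu]_p%:E[EFin \o cmod_fun f])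
  end.

Definition carrier (E : fspace R) : {pred (R -> C)} :=
  fun f => `[< carrier_def E f >].

Lemma same_refl E f : same E f f.
Proof. by case: E => [|p p1] //=; apply: ae_eq_refl. Qed.

Lemma same_sym E f g : same E f g -> same E g f.
Proof.
case: E => [|p p1] /=; last exact: ae_eq_sym.
by move=> fg x xI; rewrite fg.
Qed.

Lemma same_trans E f g h : same E f g -> same E g h -> same E f h.
Proof.
case: E => [|p p1] /=; last exact: ae_eq_trans.
by move=> fg gh x xI; rewrite fg// gh.
Qed.

Lemma sameD E f g f' g' :
  same E f f' -> same E g g' -> same E (f + g) (f' + g').
Proof.
case: E => [|p p1] /=.
  by move=> ff gg x xI; rewrite !fctE ff// gg.
by apply: filterS2 => x ff gg xI; rewrite !fctE ff// gg.
Qed.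

Lemma sameZ E a f f' : same E f f' -> same E (a *: f) (a *: f').
Proof.
case: E => [|p p1] /=.
  by move=> ff x xI; rewrite !fctE ff.
by apply: filterS => x ff xI; rewrite !fctE ff.
Qed.

Lemma cmod_funE f x : cmod_fun f x = if x \in I01 then normc (f x) else 0.
Proof. by rewrite /cmod_fun patchE. Qed.

Lemma cmod_fun_ge0 f x : 0 <= cmod_fun f x.
Proof.
by rewrite cmod_funE; case: ifP => // _; case: (f x) => u v; exact: sqrtr_ge0.
Qed.

Lemma measurable_cmod_fun (f : R -> C) :
  measurable_fun I01 (fun x => complex.Re (f x)) ->
  measurable_fun I01 (fun x => complex.Im (f x)) ->
  measurable_fun [set: R] (cmod_fun f).
Proof.
move=> mr mi.
have mI : measurable (I01 : set R) by exact: measurable_itv.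
apply/(measurable_restrictT _ _).1 => //.
rewrite (_ : (fun x => _) = (fun x => Num.sqrt
    ((complex.Re (f x)) ^+ 2 + (complex.Im (f x)) ^+ 2))); last first.
  by apply/funext => x; case: (f x).
apply: (@measurableT_comp _ _ _ _ _ _ (@Num.sqrt R)).
  exact: (continuous_measurable_fun (@sqrt_continuous R)).
by apply: measurable_funD; exact: measurable_funX.
Qed.

Lemma cmod_fun_Lfun p (p1 : 1 <= p) f :
  carrier_def (L01 p1) f -> cmod_fun f \in Lfun mu p%:E.
Proof.
move=> [mr mi fn]; apply/andP; split; rewrite !inE/=.
  exact: measurable_cmod_fun.
exact: fn.
Qed.

Lemma normcE (z : C) : `|z| = (normc z)%:C.
Proof. by []. Qed.

Lemma continuous_normc : continuous (@normc R : C -> R).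
Proof.
move=> z; apply/(@cvgrPdist_lt _ _ _ (nbhs z) (nbhs_filter z)) => e e0.
have e0' : 0 < e%:C by rewrite ltcR.
apply/(@nbhs_ballP R[i] C); exists e%:C => // w.
rewrite -ball_normE /= => h.
rewrite normcE ltcR in h; apply: le_lt_trans h.
rewrite ler_norml; apply/andP; split.
  rewrite lerNl opprB lerBlDr -[normc (z - w)]normcN opprB.
  by have := le_normcD (w - z) z; rewrite subrK.
by rewrite lerBlDr; have := le_normcD (z - w) w; rewrite subrK.
Qed.

Lemma C01_bounded f : carrier_def C01 f -> has_ubound [set normc (f x) | x in I01].
Proof.
move=> cf.
have cnf : {within I01, continuous (fun x => normc (f x))}.
  by move=> x; apply: continuous_comp; [exact: cf|exact: continuous_normc].
have := continuous_compact cnf (@segment_compact R 0 1).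
move=> /compact_bounded[M [Mr]] /(_ (M + 1)).
rewrite ltrDl ltr01 => /(_ isT) H; exists (M + 1) => _ [x xI <-].
by apply: le_trans (ler_norm _) _; apply: H; exists x.
Qed.

Lemma le_Lnorm (p : R) (f g : R -> R) : 1 <= p ->
  measurable_fun [set: R] f -> measurable_fun [set: R] g ->
  (forall x, 0 <= f x <= g x) ->
  ('N[mu]_p%:E[EFin \o f] <= 'N[mu]_p%:E[EFin \o g])%E.
Proof.
move=> p1 mf mg fg; have p0 : 0 < p by apply: lt_le_trans p1.
rewrite unlock; apply: gt0_ler_poweR.
- by rewrite invr_ge0 ltW.
- by rewrite in_itv/= leey andbT; apply: integral_ge0 => x _; rewrite lee_fin powR_ge0.
- by rewrite in_itv/= leey andbT; apply: integral_ge0 => x _; rewrite lee_fin powR_ge0.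
have mX (h : R -> R) : measurable_fun [set: R] h ->
    measurable_fun [set: R] (fun x => (`|(EFin \o h) x| `^ p)%E).
  move=> mh; apply: (measurableT_comp (measurable_poweR _)) => //.
  by apply: measurableT_comp => //; exact/measurable_EFinP.
apply: ge0_le_integral => //; [|exact: mX|exact: mX|].
  by move=> x _; exact: poweR_ge0.
move=> x _; rewrite lee_fin; case/andP: (fg x) => f0 fgx.
have g0 := le_trans f0 fgx.
by apply: ge0_ler_powR; rewrite ?nnegrE ?normr_ge0 ?ger0_norm// ltW.
Qed.

Lemma Lnorm_cmodD p (p1 : 1 <= p) f g :
  carrier_def (L01 p1) f -> carrier_def (L01 p1) g ->
  measurable_fun [set: R] (cmod_fun (f + g)) ->
  ('N[mu]_p%:E[EFin \o cmod_fun (f + g)%R] <=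
   'N[mu]_p%:E[EFin \o cmod_fun f] + 'N[mu]_p%:E[EFin \o cmod_fun g])%E.
Proof.
move=> [fr fi _] [gr gi _] mfg.
have mf := measurable_cmod_fun fr fi; have mg := measurable_cmod_fun gr gi.
apply: (@le_trans _ _
    'N[mu]_p%:E[EFin \o (cmod_fun f \+ cmod_fun g)%R]%E); last first.
  exact: minkowski_EFin.
apply: le_Lnorm => //; first exact: measurable_funD.
move=> x; rewrite cmod_fun_ge0/= !cmod_funE; case: ifPn => _.
  exact: le_normcD.
by rewrite addr0.
Qed.

Lemma Lnorm_cmodZ p (p1 : 1 <= p) (a : R[i]) f : carrier_def (L01 p1) f ->
  ('N[mu]_p%:E[EFin \o cmod_fun (a *: f)%R] =
  (normc a)%:E * 'N[mu]_p%:E[EFin \o cmod_fun f])%E.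
Proof.
move=> /cmod_fun_Lfun Lf.
have p1' : (1 <= p%:E)%E by rewrite lee_fin.
have := LnormZ (Lfun_Sub p1' Lf) (normc a).
rewrite ger0_norm; last by case: (a) => u v; exact: sqrtr_ge0.
rewrite Lfun_valP => <-; congr Lnorm; apply/funext => x /=.
rewrite !cmod_funE; congr EFin; rewrite fctE /GRing.scale/=.
by case: ifP => _; rewrite ?mulr0// normcM.
Qed.

Lemma I01_0 : I01 (0 : R).
Proof. by rewrite /I01/= in_itv/= lexx ler01. Qed.

Lemma carrier_def0 E : carrier_def E 0.
Proof.
case: E => [|p p1] /=.
  by move=> x; exact: cst_continuous.
split; [exact: measurable_cst|exact: measurable_cst|].
rewrite /finite_norm (_ : _ \o _ = cst 0%E); last first.
  by apply/funext => x /=; rewrite cmod_funE normc0 if_same.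
by rewrite Lnorm0// eqe gt_eqF// (lt_le_trans _ p1).
Qed.

Lemma carrier_defD E f g :
  carrier_def E f -> carrier_def E g -> carrier_def E (f + g).
Proof.
case: E => [|p p1] cf cg.
  by move=> x; apply: continuousD; [exact: cf|exact: cg].
have [fr fi ff] := cf; have [gr gi gf] := cg.
have mr : measurable_fun I01 (fun x => complex.Re ((f + g) x)).
  rewrite (_ : (fun x => _) =
      (fun x => complex.Re (f x) + complex.Re (g x))); last first.
    by apply/funext => x; rewrite !fctE/=; case: (f x) (g x) => ? ? [? ?].
  exact: measurable_funD.
have mi : measurable_fun I01 (fun x => complex.Im ((f + g) x)).
  rewrite (_ : (fun x => _) =
      (fun x => complex.Im (f x) + complex.Im (g x))); last first.
    by apply/funext => x; rewrite !fctE/=; case: (f x) (g x) => ? ? [? ?].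
  exact: measurable_funD.
split=> //; apply: le_lt_trans (Lnorm_cmodD cf cg (measurable_cmod_fun mr mi)) _.
by rewrite lte_add_pinfty.
Qed.

Lemma carrier_defZ E (a : R[i]) f : carrier_def E f -> carrier_def E (a *: f).
Proof.
case: E => [|p p1] cf.
  by move=> x; apply: continuousZr; exact: cf.
have [fr fi ff] := cf.
split.
- rewrite (_ : (fun x => _) = (fun x => complex.Re a * complex.Re (f x)
     - complex.Im a * complex.Im (f x))); last first.
    by apply/funext => x; rewrite !fctE/=; case: (a) (f x) => ? ? [? ?].
  by apply: measurable_funB; exact: measurable_funM.
- rewrite (_ : (fun x => _) = (fun x => complex.Re a * complex.Im (f x)
     + complex.Im a * complex.Re (f x))); last first.
    by apply/funext => x; rewrite !fctE/=; case: (a) (f x) => ? ? [? ?].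
  by apply: measurable_funD; exact: measurable_funM.
rewrite /finite_norm (Lnorm_cmodZ a cf) lte_mul_pinfty// lee_fin.
by case: (a) => u v; exact: sqrtr_ge0.
Qed.

Lemma carrier_submod_closed E : submod_closed (carrier E).
Proof.
split=> [|a f g /asboolP cf /asboolP cg]; apply/asboolP.
  exact: carrier_def0.
by apply: carrier_defD => //; exact: carrier_defZ.
Qed.

Lemma normc_ge0 (z : R[i]) : 0 <= normc z.
Proof. by case: z => u v; exact: sqrtr_ge0. Qed.

Lemma same_seminorm E f g : carrier_def E f -> carrier_def E g ->
  same E f g -> seminorm E f = seminorm E g.
Proof.
case: E => [|p p1] /= cf cg fg.
  congr sup; apply/seteqP; split=> _ [x xI <-]; exists x => //; rewrite fg//;
    exact/mem_set.
case: cf cg => fr fi _ [gr gi _].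
have mX h : measurable_fun [set: R] (cmod_fun h) ->
    measurable_fun [set: R] (fun x => (`|(EFin \o cmod_fun h) x| `^ p)%E).
  move=> mh; apply: (measurableT_comp (measurable_poweR _)) => //.
  by apply: measurableT_comp => //; exact/measurable_EFinP.
congr fine; rewrite unlock; congr poweR; apply: ae_eq_integral => //.
- by apply: mX; exact: measurable_cmod_fun.
- by apply: mX; exact: measurable_cmod_fun.
apply: filterS fg => x fgx _ /=; rewrite !cmod_funE.
by case: ifPn => // /set_mem/fgx ->.
Qed.

Lemma seminormD E f g : carrier_def E f -> carrier_def E g ->
  seminorm E (f + g) <= seminorm E f + seminorm E g.
Proof.
case: E => [|p p1] cf cg /=.
  apply: ge_sup; first by exists (normc ((f + g) 0)), 0 => //; exact: I01_0.
  move=> _ [x xI <-]; apply: le_trans (le_normcD _ _) _.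
  by apply: lerD; apply: ub_le_sup; [exact: C01_bounded|exists x|
    exact: C01_bounded|exists x].
have [mr mi ffg] := carrier_defD cf cg.
have := Lnorm_cmodD cf cg (measurable_cmod_fun mr mi).
case: cf cg => _ _ ff [_ _ gf].
rewrite -fineD ?ge0_fin_numE ?Lnorm_ge0// => h; apply: fine_le => //.
- by rewrite ge0_fin_numE ?Lnorm_ge0.
- by rewrite ge0_fin_numE ?adde_ge0 ?Lnorm_ge0// lte_add_pinfty.
Qed.

Lemma seminormZ E (a : R[i]) f : carrier_def E f ->
  seminorm E (a *: f) = normc a * seminorm E f.
Proof.
case: E => [|p p1] cf /=; last first.
  rewrite (Lnorm_cmodZ a cf) fineM//.
  by have [_ _ ff] := cf; rewrite ge0_fin_numE ?Lnorm_ge0.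
have cZ := carrier_defZ a cf.
have ne (h : R -> C) : [set normc (h x) | x in I01] !=set0.
  by exists (normc (h 0)), 0 => //; exact: I01_0.
have [->|a0] := eqVneq a 0.
  rewrite (_ : _ *: f = 0); last by apply/funext => x; rewrite fctE scale0r.
  rewrite [in RHS]normc0 mul0r; apply/eqP; rewrite eq_le; apply/andP; split.
    by apply: ge_sup => // _ [x xI <-]; rewrite normc0.
  apply: ub_le_sup; first exact: (C01_bounded (carrier_def0 C01)).
  by exists 0; [exact: I01_0|rewrite normc0].
have na : 0 < normc a.
  rewrite lt_neqAle normc_ge0 andbT eq_sym; apply: contra a0 => /eqP.
  by move=> /eq0_normc ->.
apply/eqP; rewrite eq_le; apply/andP; split.
  apply: ge_sup => // _ [x xI <-]; rewrite fctE normcM ler_pM2l//.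
  by apply: ub_le_sup; [exact: C01_bounded|exists x].
rewrite -ler_pdivlMl//; apply: ge_sup => // _ [x xI <-].
rewrite ler_pdivlMl// -normcM.
by apply: ub_le_sup; [exact: C01_bounded|exists x].
Qed.

Lemma seminorm_eq0 E f : carrier_def E f -> seminorm E f = 0 -> same E f 0.
Proof.
case: E => [|p p1] cf /= f0.
  move=> x xI; apply: eq0_normc; apply/eqP; rewrite eq_le normc_ge0 andbT.
  rewrite -f0; apply: ub_le_sup; first exact: C01_bounded.
  by exists x => //; exact: set_mem.
have [mr mi ff] := cf.
have mf := measurable_cmod_fun mr mi.
have : ('N[mu]_p%:E[EFin \o cmod_fun f] = 0)%E.
  by rewrite -[LHS]fineK ?ge0_fin_numE ?Lnorm_ge0// f0.
move=> /Lnorm_eq0_eq0 -/(_ ((measurable_EFinP _ _).2 mf) (lt_le_trans ltr01 p1)).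
apply: filterS => x /(_ I) /=; rewrite cmod_funE => + xI.
by rewrite mem_set// => -[/eq0_normc].
Qed.

End representatives.

Section quotient.
Context {R : realType}.
Variable E : fspace R.
Local Notation C := (R[i]^o).

HB.instance Definition _ := GRing.isSubmodClosed.Build R[i] (R -> C) (carrier E)
  (carrier_submod_closed E).

Record rep := Rep { rep_fun :> R -> C; rep_carrier : rep_fun \in carrier E }.

HB.instance Definition _ := [isSub for rep_fun].
HB.instance Definition _ := [Choice of rep by <:].
HB.instance Definition _ := [SubChoice_isSubLmodule of rep by <:].

Lemma rep_def (f : rep) : carrier_def E f.
Proof. by case: f => f fE; apply/asboolP. Qed.

Definition null : {pred rep} := fun f => `[< same E f 0 >].

Lemma null_zmod_closed : zmod_closed null.
Proof.
split=> [|f g /asboolP f0 /asboolP g0]; apply/asboolP; first exact: same_refl.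
have /= := sameD f0 (sameZ (-1) g0).
by rewrite scaleN1r scaler0 addr0.
Qed.

HB.instance Definition _ := GRing.isZmodClosed.Build rep null null_zmod_closed.

Definition fspace_sort : Type := {ideal_quot null}.
HB.instance Definition _ := GRing.Zmodule.on fspace_sort.

Implicit Types f g : fspace_sort.

(* a chosen representative *)
Definition fun_of f : R -> C := repr (f : {ideal_quot null}).

Definition class_of (f : rep) : fspace_sort := \pi_({ideal_quot null}) f.

Lemma class_of_eqP (f g : rep) : class_of f = class_of g <-> same E f g.
Proof.
have -> : (class_of f = class_of g) <-> (f - g \in null).
  by rewrite Quotient.idealrBE; split=> [/eqP|/eqP].
split=> [/asboolP h|h].
  have := sameD h (same_refl E (g : R -> C)).
  by rewrite /= subrK add0r.
apply/asboolP; have /= := sameD h (sameZ (-1) (same_refl E (g : R -> C))).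
by rewrite scaleN1r subrr.
Qed.

Lemma class_of_repr f : class_of (repr (f : {ideal_quot null})) = f.
Proof. exact: reprK. Qed.

Lemma fun_of_class_of (f : rep) : same E (fun_of (class_of f)) f.
Proof. by apply/class_of_eqP; rewrite class_of_repr. Qed.

Lemma carrier_fun_of f : carrier_def E (fun_of f).
Proof. exact: rep_def. Qed.

Lemma fspace_eqP f g : f = g <-> same E (fun_of f) (fun_of g).
Proof.
rewrite -class_of_eqP; rewrite /fun_of /= !class_of_repr; exact: iff_refl.
Qed.

Lemma ex_fspace (h : R -> C) : carrier_def E h ->
  exists f, same E (fun_of f) h.
Proof.
move=> /asboolP hE; exists (class_of (Rep hE)); exact: fun_of_class_of.
Qed.

Lemma fun_ofD f g : same E (fun_of (f + g)) (fun_of f + fun_of g).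
Proof.
have := fun_of_class_of (repr (f : {ideal_quot null})
  + repr (g : {ideal_quot null}) : rep).
have -> : class_of (repr (f : {ideal_quot null}) + repr (g : {ideal_quot null}))
    = class_of (repr (f : {ideal_quot null}))
    + class_of (repr (g : {ideal_quot null})) by exact: raddfD.
by rewrite !class_of_repr.
Qed.

Definition scale (a : R[i]) f : fspace_sort :=
  class_of (a *: (repr (f : {ideal_quot null}) : rep)).

Lemma fun_of_scale a f : same E (fun_of (scale a f)) (a *: fun_of f).
Proof. exact: fun_of_class_of. Qed.

Lemma scale_scale a b f : scale a (scale b f) = scale (a * b) f.
Proof.
apply/fspace_eqP; apply: same_trans (fun_of_scale _ _) _.
apply: same_trans (sameZ _ (fun_of_scale _ _)) _.
by rewrite scalerA; apply/same_sym; exact: fun_of_scale.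
Qed.

Lemma scale_1 : left_id 1 scale.
Proof.
move=> f; apply/fspace_eqP; apply: same_trans (fun_of_scale _ _) _.
by rewrite scale1r; exact: same_refl.
Qed.

Lemma scale_Dr : right_distributive scale +%R.
Proof.
move=> a f g; apply/fspace_eqP; apply: same_trans (fun_of_scale _ _) _.
apply: same_trans (sameZ _ (fun_ofD _ _)) _.
rewrite scalerDr; apply/same_sym; apply: same_trans (fun_ofD _ _) _.
by apply: sameD; exact: fun_of_scale.
Qed.

Lemma scale_Dl f : {morph scale^~ f : a b / a + b}.
Proof.
move=> a b; apply/fspace_eqP; apply: same_trans (fun_of_scale _ _) _.
rewrite scalerDl; apply/same_sym; apply: same_trans (fun_ofD _ _) _.
by apply: sameD; exact: fun_of_scale.
Qed.

HB.instance Definition _ := GRing.Zmodule_isLmodule.Build R[i] fspace_sort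
  scale_scale scale_1 scale_Dr scale_Dl.

Lemma fun_ofZ (a : R[i]) f : same E (fun_of (a *: f)) (a *: fun_of f).
Proof. exact: fun_of_scale. Qed.

Lemma fun_of0 : same E (fun_of 0) 0.
Proof.
rewrite -(scale0r (0 : fspace_sort)) -(scale0r (fun_of 0)); exact: fun_ofZ.
Qed.

Definition fnorm f : R[i] := (seminorm E (fun_of f))%:C.

Lemma fnormD f g : fnorm (f + g) <= fnorm f + fnorm g.
Proof.
rewrite /fnorm -rmorphD lecR.
have [cf cg] := (carrier_fun_of f, carrier_fun_of g).
rewrite (same_seminorm (carrier_fun_of _) (carrier_defD cf cg) (fun_ofD f g)).
exact: seminormD.
Qed.

Lemma fnormZ (a : R[i]) f : fnorm (a *: f) = `|a| * fnorm f.
Proof.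
have cf := carrier_fun_of f.
rewrite /fnorm.
rewrite (same_seminorm (carrier_fun_of _) (carrier_defZ a cf) (fun_ofZ a f)).
by rewrite seminormZ// rmorphM.
Qed.

Lemma fnorm_eq0 f : fnorm f = 0 -> f = 0.
Proof.
move=> [f0]; apply/fspace_eqP.
apply: same_trans (same_sym fun_of0).
exact: (seminorm_eq0 (carrier_fun_of f) f0).
Qed.

HB.instance Definition _ :=
  Lmodule_isNormed.Build R[i] fspace_sort fnormD fnormZ fnorm_eq0.

(* Norms of R[i]-modules take their values in R[i]. *)
Lemma normE f : `|f| = (seminorm E (fun_of f))%:C.
Proof. by []. Qed.

End quotient.

Coercion fspace_sort : fspace >-> Sortclass.

Section operators.
Context {R : realType}.
Variable V : normedModType R[i].

Record bounded_op := BoundedOp {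
  bop :> V -> V;
  bop_linear : linear bop;
  bop_bounded : exists M : R, forall f : V, `|bop f| <= M%:C * `|f|
}.

HB.instance Definition _ (T : bounded_op) :=
  GRing.isLinear.Build R[i] V V _ (bop T) (bop_linear T).

Lemma bounded_op_eqP (S T : bounded_op) : S = T <-> S =1 T.
Proof.
split=> [->//|]; case: S T => [S lS bS] [T lT bT] /= /funext ST.
rewrite -{}ST in lT bT *; congr BoundedOp; exact: Prop_irrelevance.
Qed.

Definition opnorm (T : V -> V) : R :=
  sup [set complex.Re `|T f| | f in [set f : V | `|f| <= 1]].

Definition opdist (S T : bounded_op) : R := opnorm (fun f => S f - T f).

End operators.

Section metrics.
Context {R : realType} {T : Type}.

Record is_metric (d : T -> T -> R) : Prop := IsMetric {
  metric_ge0 : forall x y, 0 <= d x y;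
  metric_eq0 : forall x y, d x y = 0 <-> x = y;
  metric_sym : forall x y, d x y = d y x;
  metric_triangle : forall x y z, d x z <= d x y + d y z
}.

Definition metric_open (d : T -> T -> R) (U : set T) : Prop :=
  forall x, U x -> exists2 e, 0 < e & forall y, d x y < e -> U y.

(* the topology of d is contained in the topology of d' *)
Definition weaker_metric (d d' : T -> T -> R) : Prop :=
  metric_open d `<=` metric_open d'.

End metrics.

Section fractional_integral.
Context {R : realType}.
Local Notation mu := (@lebesgue_measure R).

Definition cintegral (D : set R) (f : R -> R[i]) : R[i] :=
  (\int[mu]_(x in D) complex.Re (f x)) +i* (\int[mu]_(x in D) complex.Im (f x)).

Definition Gamma (a : R) : R :=
  \int[mu]_(t in `]0, +oo[) (t `^ (a - 1) * expR (- t)).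

(* Riemann-Liouville integral of order a with constant of integration 0.  Where
   the integrand is not integrable (a null set of x, if f is in L^p and a < 1)
   the value is unspecified. *)
Definition RLint (a : R) (f : R -> R[i]) (x : R) : R[i] :=
  ((Gamma a)^-1)%:C *
  cintegral `[0, x]%classic (fun t => ((x - t) `^ (a - 1))%:C * f t).

Definition cexp (z : R[i]) : R[i] :=
  (expR (complex.Re z))%:C * (cos (complex.Im z) +i* sin (complex.Im z)).

End fractional_integral.

(* Main.v *)
Require Import Defs.
From HB Require Import structures.
From mathcomp Require Import all_boot all_order all_algebra complex.
From mathcomp Require Import all_classical all_reals all_analysis measurable_realfun.
From mathcomp Require Import ring lra.
Set Implicit Arguments.
Unset Strict Implicit.
Unset Printing Implicit Defensive.
Import Order.TTheory GRing.Theory Num.Theory.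
Import numFieldNormedType.Exports.
Import Normc.
Local Open Scope classical_set_scope.
Local Open Scope ring_scope.
Local Open Scope complex_scope.

(* Write V = J 1, M for multiplication by x, and N_a for the Riemann-Liouville
   operator.  Let q = m/n and A = J q, so that A^n = V^m and A commutes with V.
   From [M, V] = V^2 the operator A' = [M, A] commutes with V as well.  The
   commutant of V is commutative, because an operator S in it satisfies
   S V^2 = convolution by the continuous function V S 1.  So A' commutes with A,
   and taking the commutator of A^n = V^m with M gives n A^(n-1) A' = m V^(m+1).
   As V is injective, A' = q A V.  Applied to V 1 this is Euler's equation
   x F = (2 + q) V F for F = A V 1, whence F is a multiple of x^(1+q), i.e. of
   N_q V 1; since an operator commuting with V and killing some V^k 1 is zero,
   A = w(q) N_q, with w(q)^n = 1.
   For real a > 0, let rationals q_k tend to a with w(q_k) convergent.  N is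
   continuous for the operator norm, so w(q_k) N_{q_k} converges in norm, hence
   for the metric of axiom (iii), which gives J a = w(a) N_a with |w(a)| = 1.  The
   same argument shows that w is continuous; it is a character of (0, oo) with
   w(1) = 1, so w(a) = exp(2 n pi i a). *)

(** * Powers, Gamma and Beta integrals *)

(** The derivation [[M, .]] linearises A^n = V^m: once A' is known to commute with A, the equation
    is linear in A' and fixes A up to a scalar. The tests are made on V 1 rather than on 1 because
    an element of L^p is only a class: A V 1 = V A 1 has a continuous representative, for which
    Euler's equation can be solved pointwise. For the same reason the kernel is V S 1 and not S 1:
    being continuous it is bounded, and convolutions with bounded kernels compose by Fubini without
    exception at any point. Axiom (iii) is weak: it gives no convergence of J a f for a single f.
    What can be drawn from it is that norm convergence implies convergence for the metric, where
    limits are unique. So convergence has to be produced in norm, on the explicit side w(q_k)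
    N_{q_k}. There the scalars stay on the unit circle, since A and N_q are both n-th roots of V^m,
    and compactness of the circle supplies the convergent subsequence. *)

Section change_of_variable.
Context {R : realType}.
Local Notation mu := (@lebesgue_measure R).

(** Lebesgue measure is determined by its values on the intervals []a, b]]; the preimage of such an
    interval is [[c - b, c - a[], of the same length. *)
Lemma lebesgue_measure_reflect (c : R) (A : set R) : measurable A ->
  pushforward mu ((fun x => c - x) : _ -> measurableTypeR R) A = mu A.
Proof.
move=> mA.
have mr : measurable_fun [set: R] ((fun x => c - x) : R -> measurableTypeR R).
  exact: measurable_funB.
pose phi : {mfun R >-> measurableTypeR R} := HB.pack ((fun x => c - x) : R -> measurableTypeR R) (isMeasurableFun.Build _ _ _ _ _ mr).
rewrite -[X in pushforward _ X]/(phi : _ -> _).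
apply/esym/lebesgue_measure_unique => //= _ [[a b]] _ <-.
rewrite /pushforward.
rewrite (_ : _ @^-1` _ = `[c - b, c - a[%classic); last first.
  apply/seteqP; split => x /=; rewrite !in_itv/=; lra.
rewrite !lebesgue_measure_itv/= !lte_fin ltrD2l ltrN2 -!EFinD.
by case: ifP => // _; congr EFin; lra.
Qed.

Lemma ge0_integral_reflect (c : R) (f : R -> \bar R) :
  measurable_fun [set: R] f -> (forall x, 0 <= f x)%E ->
  (\int[mu]_x f (c - x)%R = \int[mu]_x f x)%E.
Proof.
move=> mf f0.
have mr : measurable_fun [set: R] ((fun x => c - x) : R -> measurableTypeR R).
  exact: measurable_funB.
pose phi : {mfun R >-> measurableTypeR R} := HB.pack ((fun x => c - x) : R -> measurableTypeR R) (isMeasurableFun.Build _ _ _ _ _ mr).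
transitivity (\int[pushforward mu phi]_x f x)%E; last first.
  by apply: eq_measure_integral => //= A mA AS; rewrite lebesgue_measure_reflect.
by rewrite ge0_integral_pushforward// preimage_setT.
Qed.

(** The pushforward of Lebesgue measure by [x -> c x], multiplied by [c], has the value [b - a] on
    []a, b]], so it is Lebesgue measure again. *)
Lemma ge0_integral_scale (c : R) (f : R -> \bar R) : 0 < c ->
  measurable_fun [set: R] f -> (forall x, 0 <= f x)%E ->
  (c%:E * \int[mu]_x f (c * x)%R = \int[mu]_x f x)%E.
Proof.
move=> c0 mf f0.
have mr : measurable_fun [set: R] ((fun x => c * x) : R -> measurableTypeR R).
  exact: measurable_funM.
have c0' : 0 <= c by exact: ltW.
pose nu : {measure set (measurableTypeR R) -> \bar R} :=
  @measure_function_pushforward__canonical__measure_function_Measure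
    _ _ _ _ _ mu _ mr.
have -> : (\int[mu]_x f (c * x)%R = \int[nu]_x f x)%E.
  by rewrite ge0_integral_pushforward// preimage_setT.
transitivity (\int[mscale (NngNum c0') nu]_x f x)%E.
  by rewrite ge0_integral_mscale.
apply: eq_measure_integral => //= A mA _.
apply/esym/lebesgue_measure_unique => //= _ [[a b]] _ <-.
rewrite /mscale/= /pushforward.
rewrite (_ : _ @^-1` _ = `]a / c, b / c]%classic); last first.
  apply/seteqP; split => x /=; rewrite !in_itv/= ltr_pdivrMr// ler_pdivlMr//;
    by rewrite ![_ * c]mulrC.
rewrite !lebesgue_measure_itv/= !lte_fin ltr_pM2r ?invr_gt0// -!EFinD.
by case: ifP => _; rewrite ?mule0// -EFinM -mulrBl mulrCA divff ?mulr1 ?gt_eqF.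
Qed.

End change_of_variable.

(** * Integrals of powers *)

Section powR_integrals.
Context {R : realType}.
Local Notation mu := (@lebesgue_measure R).
Implicit Types a x y t : R.

Lemma continuous_powR_gt0 a x : 0 < x -> {for x, continuous (fun u : R => u `^ a)}.
Proof.
move=> x0; apply/differentiable_continuous/derivable1_diffP.
exact: (@ex_derive _ _ _ _ _ _ _ (is_derive1_powR a x0)).
Qed.

(** For [a < 1] the integrand is unbounded at 0. The fundamental theorem of calculus is therefore
    applied on [[y / (n + 1), y]], and monotone convergence gives the integral over the union of
    these intervals. *)
Lemma integral_powR a y : 0 < a -> 0 <= y ->
  (\int[mu]_(x in `[0%R, y]) (x `^ (a - 1))%:E = (y `^ a / a)%:E)%E.
Proof.
move=> a0; rewrite le_eqVlt => /predU1P[<-|y0].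
  by rewrite set_itv1 integral_set1 powR0 ?gt_eqF// mul0r.
have mp (D : set R) : measurable_fun D (fun x : R => (x `^ (a - 1))%:E).
  by apply/measurable_EFinP; apply: measurable_funTS; exact: measurable_powR.
rewrite -integral_itv_obnd_cbnd//.
pose F n : set R := `[y / n.+1%:R, y]%classic.
have FE n : (\int[mu]_(x in F n) (x `^ (a - 1))%:E =
    (y `^ a / a - (y / n.+1%:R) `^ a / a)%:E)%E.
  have [->|n0] := eqVneq n 0%N.
    by rewrite /F divr1 set_itv1 integral_set1 subrr.
  have yn0 : 0 < y / n.+1%:R by rewrite divr_gt0.
  rewrite /F (@continuous_FTC2 _ _ (fun x => x `^ a / a)) ?EFinB//.
  - by rewrite ltr_pdivrMr// ltr_pMr// ltr1n ltnS lt0n.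
  - apply: continuous_in_subspaceT => x /set_mem/=; rewrite in_itv/= => /andP[yx _].
    by apply: continuous_powR_gt0; apply: lt_le_trans yx.
  - have cF x : 0 < x -> {for x, continuous (fun u : R => u `^ a / a)}.
      by move=> x0; apply: cvgMl; exact: continuous_powR_gt0.
    split.
    + move=> x; rewrite in_itv/= => /andP[yx _].
      have x0 := lt_trans yn0 yx.
      apply: derivableM; last exact: derivable_cst.
      exact: (@ex_derive _ _ _ _ _ _ _ (is_derive1_powR a x0)).
    + by apply: cvg_at_right_filter; exact: cF.
    + by apply: cvg_at_left_filter; exact: cF.
  - move=> x; rewrite in_itv/= => /andP[yx _].
    have x0 := lt_trans yn0 yx.
    have D := is_derive1_powR a x0.
    rewrite derive1E derive_val.
    rewrite scaler0 add0r /GRing.scale/= mulrC mulrAC divff ?gt_eqF//.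
    by rewrite mul1r.
have -> : `]0%R, y]%classic = \bigcup_n F n.
  apply/seteqP; split => x /=; last first.
    move=> [n _]; rewrite /F /= !in_itv/= => /andP[yx ->]; rewrite andbT.
    by apply: lt_le_trans yx; rewrite divr_gt0.
  rewrite in_itv/= => /andP[x0 xy].
  exists (Num.truncn (y / x)) => //; rewrite /F/= in_itv/= xy andbT.
  rewrite ler_pdivrMr// -ler_pdivrMl// mulrC ltW//.
  by rewrite truncnS_gt.
have cvF : (\int[mu]_(x in F n) (x `^ (a - 1))%:E @[n --> \oo] --> (y `^ a / a)%:E)%E.
  under eq_fun do rewrite FE.
  apply: cvg_EFin; first by near=> n.
  rewrite -[X in _ --> X]subr0; apply: cvgB; first exact: cvg_cst.
  rewrite -[X in _ --> X](mul0r a^-1); apply: cvgMl.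
  have -> : (fun n => (y / n.+1%:R) `^ a) = (fun n => y `^ a * (n.+1%:R^-1) `^ a).
    by apply/funext => n; rewrite powRM// ltW.
  rewrite -[X in _ --> X](mulr0 (y `^ a)); apply: cvgMr.
  apply: (@cvg_comp _ _ _ (fun n : nat => n.+1%:R^-1 : R) (fun u : R => u `^ a) _ (0^'+)); last exact: powR_cvg0.
  move=> /= P; rewrite /at_right => -[e /= e0 H].
  have := @cvg_harmonic R.
  move=> /cvgrPdist_lt/(_ e e0); apply: filterS => n; rewrite /harmonic/= => h.
  by apply: H => //=.
apply: (cvg_unique _ _ cvF) => //.
apply: ge0_nondecreasing_set_cvg_integral => //.
- move=> n m nm; apply/subsetPset => x; rewrite /F/= !in_itv/= => /andP[yx ->].
  by rewrite andbT (le_trans _ yx)// ler_pM2l// lef_pV2 ?posrE// ler_nat.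
- by move=> n; exact: measurable_itv.
- by move=> n; exact: mp.
- by move=> n x _; rewrite lee_fin powR_ge0.
Unshelve. all: by end_near. Qed.

Lemma integral_powRBr a t y : 0 < a -> t <= y ->
  (\int[mu]_(x in `[t, y]) ((y - x) `^ (a - 1))%:E = ((y - t) `^ a / a)%:E)%E.
Proof.
move=> a0 ty; have yt : 0 <= y - t by rewrite subr_ge0.
rewrite -(integral_powR a0 yt) [RHS]integral_mkcond.
rewrite -(ge0_integral_reflect y).
- rewrite integral_mkcond; apply: eq_integral => x _; rewrite !patchE !mem_setE.
  by rewrite !in_itv/= subr_ge0 lerD2l lerN2 andbC.
- apply/(measurable_restrictT _ _).1 => //; apply/measurable_EFinP.
  by apply: measurable_funTS; exact: measurable_powR.
- by move=> x; apply: erestrict_ge0 => u _; rewrite lee_fin powR_ge0.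
Qed.

Lemma integral_powRBl a t y : 0 < a -> t <= y ->
  (\int[mu]_(x in `[t, y]) ((x - t) `^ (a - 1))%:E = ((y - t) `^ a / a)%:E)%E.
Proof.
move=> a0 ty; rewrite -(integral_powRBr a0 ty) integral_mkcond [RHS]integral_mkcond.
rewrite -(ge0_integral_reflect (y + t)).
- apply: eq_integral => x _; rewrite !patchE !mem_setE !in_itv/=.
  have -> : (t <= y + t - x <= y) = (t <= x <= y) by lra.
  by have -> : y + t - x - t = y - x by ring.
- apply/(measurable_restrictT _ _).1 => //; apply/measurable_EFinP.
  apply: measurable_funTS; apply: (measurableT_comp (measurable_powR _)).
  exact: measurable_funB.
- by move=> x; apply: erestrict_ge0 => u _; rewrite lee_fin powR_ge0.
Qed.

End powR_integrals.

(** * The Gamma function *)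

Section gamma.
Context {R : realType}.
Local Notation mu := (@lebesgue_measure R).
Implicit Types a b x y t : R.

(** A translation is the product of two reflections. *)
Lemma ge0_integral_shift (c : R) (f : R -> \bar R) :
  measurable_fun [set: R] f -> (forall x, 0 <= f x)%E ->
  (\int[mu]_x f (x + c)%R = \int[mu]_x f x)%E.
Proof.
move=> mf f0.
rewrite -(ge0_integral_reflect c mf f0) -[RHS](ge0_integral_reflect 0)//.
- by apply: eq_integral => x _; rewrite sub0r opprK addrC.
- by apply: (measurableT_comp mf); exact: measurable_funB.
Qed.

Lemma integral_expRN (k : R) : 0 < k ->
  (\int[mu]_(x in `[0%R, +oo[) (expR (- (k * x)))%:E = (k^-1)%:E)%E.
Proof.
move=> k0.
have cE : continuous (fun x : R => expR (- (k * x))).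
  move=> x; apply: continuous_comp; last exact: continuous_expR.
  apply: continuousN; apply: continuousM; [exact: cst_continuous|exact: id].
rewrite (@ge0_continuous_FTC2y _ _ (fun x => - k^-1 * expR (- (k * x))) 0 0).
- by rewrite mulr0 oppr0 expR0 mulr1 -EFinB sub0r opprK.
- by move=> x _; exact: expR_ge0.
- by apply: continuous_subspaceT.
- rewrite -[X in _ --> X](mulr0 (- k^-1)); apply: cvgMr.
  apply: (@cvg_comp _ _ _ (fun x => k * x) (fun x => expR (- x)) _ (+oo%R)); last exact: cvgr_expR.
  by apply: gt0_cvgMry => //; exact: cvg_id.
- move=> x _; apply: derivableM; first exact: derivable_cst.
  apply: diff_derivable; apply: differentiable_comp => //.
  by apply/derivable1_diffP; exact: derivable_expR.
- by apply: cvg_at_right_filter; apply: cvgMr; exact: cE.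
- move=> x _; rewrite derive1E.
  have D : is_derive x 1 (fun x => - k^-1 * expR (- (k * x))) (expR (- (k * x))).
    apply: is_derive_eq; rewrite /GRing.scale/=; field; exact: lt0r_neq0.
  exact: derive_val.
Qed.

(** A single term of the exponential series at [t / 2], of degree above [|a|], already dominates the
    power. The other half of the exponential in the Gamma integrand is left over for convergence at
    infinity. *)
Lemma powR_le_expR a t : 1 <= t ->
  t `^ a <= (2 ^+ (Num.truncn `|a|).+1 * ((Num.truncn `|a|).+1)`!%:R) * expR (t / 2).
Proof.
move=> t1; set n := Num.truncn _.
apply: (@le_trans _ _ (t `^ n.+1%:R)).
  apply: ler_powR => //; apply: le_trans (ler_norm a) _; apply: ltW.
  exact: truncnS_gt.
rewrite powR_mulrn; last by lra.
have := @expR_ge1Dxn R (t / 2) n ltac:(lra).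
move=> h; have {}h : (t / 2) ^+ n.+1 / n.+1`!%:R <= expR (t / 2) by lra.
rewrite ler_pdivrMr ?ltr0n ?fact_gt0// in h.
rewrite exprMn exprVn ler_pdivrMr ?exprn_gt0// in h.
by apply: le_trans h _; rewrite [leRHS]mulrC mulrA [leRHS]mulrAC -mulrA.
Qed.

Lemma continuous_powR_exponent t : 0 < t -> continuous (powR t).
Proof.
move=> t0; rewrite (_ : powR t = fun x => expR (x * ln t)); last first.
  by apply/funext => x; rewrite /powR gt_eqF.
move=> x; apply: (@continuous_comp _ _ _ (fun x => x * ln t) expR).
  by apply: cvgMl; exact: cvg_id.
exact: continuous_expR.
Qed.

Definition gamma_int a t : R := t `^ (a - 1) * expR (- t).

Lemma gamma_int_ge0 a t : 0 <= gamma_int a t.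
Proof. by rewrite mulr_ge0 ?powR_ge0 ?expR_ge0. Qed.

Lemma measurable_gamma_int a D : measurable_fun D (gamma_int a).
Proof.
apply: measurable_funTS; apply: measurable_funM; first exact: measurable_powR.
by apply: measurableT_comp => //; exact: measurable_funN.
Qed.

(** On []0, 1]] the integrand is at most [t ^ (a - 1)]; beyond 1 the power is absorbed by
    [powR_le_expR], which leaves a multiple of [exp (- t / 2)]. *)
Lemma integral_gamma_int_lty a : 0 < a ->
  (\int[mu]_(t in `]0%R, +oo[) (gamma_int a t)%:E < +oo)%E.
Proof.
move=> a0; set n := Num.truncn `|a - 1|.
set C : R := 2 ^+ n.+1 * n.+1`!%:R.
have C0 : 0 <= C by rewrite mulr_ge0// exprn_ge0.
have mI : measurable (`]0, 1] : set R) by exact: measurable_itv.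
have mJ : measurable (`]1, +oo[ : set R) by exact: measurable_itv.
rewrite (_ : `]0, +oo[%classic = `]0, 1]%classic `|` `]1, +oo[%classic); last first.
  apply/seteqP; split => x /=; rewrite !in_itv/= !andbT; last by case; lra.
  by move=> x0; have [|] := lerP x 1; [left; apply/andP|right].
have mg D : measurable_fun D (fun t => (gamma_int a t)%:E).
  by apply/measurable_EFinP; exact: measurable_gamma_int.
have g0 t : (0 <= (gamma_int a t)%:E)%E by rewrite lee_fin gamma_int_ge0.
have mg' D : measurable_fun D (fun t => (t `^ (a - 1))%:E : \bar R).
  by apply/measurable_EFinP/measurable_funTS; exact: measurable_powR.
have me D : measurable_fun D (fun t : R => (expR (- (2^-1 * t)))%:E : \bar R).
  apply/measurable_EFinP/measurable_funTS; apply: measurableT_comp => //.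
  by apply: measurable_funN; exact: measurable_funM.
apply: (@le_lt_trans _ _ ((1 `^ a / a)%:E + C%:E * (2^-1^-1)%:E)%E); last first.
  by rewrite -EFinM -EFinD ltry.
apply: (@le_trans _ _ (\int[mu]_(t in `]0%R, 1%R]) (gamma_int a t)%:E +
    \int[mu]_(t in `]1%R, +oo[) (gamma_int a t)%:E)%E).
  rewrite ge0_integral_setU//; first exact: mg.
  apply/disj_set2P/seteqP; split => // x /=; rewrite !in_itv/=; lra.
apply: leeD.
  rewrite -(integral_powR a0 ler01) -integral_itv_obnd_cbnd//.
  apply: ge0_le_integral => //; [exact: mg|exact: mg'|].
  move=> t; rewrite /= in_itv/= => /andP[t0 _].
  by rewrite lee_fin ler_piMr ?powR_ge0// expR_le1; lra.
have h2 : (0 : R) < 2^-1 by lra.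
rewrite -(integral_expRN h2) -ge0_integralZl//; last exact: me.
have mC D : measurable_fun D (fun t : R => C%:E * (expR (- (2^-1 * t)))%:E)%E.
  by apply: measurable_funeM; exact: me.
apply: (@le_trans _ _ (\int[mu]_(t in `]1%R, +oo[) (C%:E * (expR (- (2^-1 * t)))%:E))%E).
  apply: ge0_le_integral => //; [exact: mg|exact: mC|].
  move=> t; rewrite /= in_itv/= andbT => t1.
  rewrite -EFinM lee_fin; apply: (@le_trans _ _ (C * expR (t / 2) * expR (- t))).
    by apply: ler_wpM2r; [exact: expR_ge0|exact/powR_le_expR/ltW].
  by rewrite -mulrA -expRD; have -> : t / 2 + - t = - (2^-1 * t) by field.
apply: ge0_subset_integral => //.
- exact: mC.
- by move=> x _; rewrite -EFinM lee_fin mulr_ge0// expR_ge0.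
- by move=> x /=; rewrite !in_itv/= !andbT; lra.
Qed.

Lemma integrable_gamma_int a : 0 < a ->
  mu.-integrable `]0, +oo[ (EFin \o gamma_int a).
Proof.
move=> a0; apply/integrableP; split.
  by apply/measurable_EFinP; exact: measurable_gamma_int.
apply: le_lt_trans (integral_gamma_int_lty a0).
rewrite le_eqVlt; apply/orP; left; apply/eqP; apply: eq_integral => t _ /=.
by rewrite ger0_norm ?gamma_int_ge0.
Qed.

Lemma EFin_Gamma a : 0 < a ->
  ((Gamma a)%:E = \int[mu]_(t in `[0%R, +oo[) (gamma_int a t)%:E)%E.
Proof.
move=> a0; rewrite -integral_itv_obnd_cbnd; last first.
  by apply/measurable_EFinP; exact: measurable_gamma_int.
rewrite /Gamma /Rintegral fineK//.
exact: integrable_fin_num (integrable_gamma_int a0).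
Qed.

Lemma Gamma_gt0 a : 0 < a -> 0 < Gamma a.
Proof.
move=> a0; rewrite -lte_fin EFin_Gamma//.
have mg D : measurable_fun D (fun t => (gamma_int a t)%:E).
  by apply/measurable_EFinP; exact: measurable_gamma_int.
(* On [[1, 2]] the power [t ^ (a - 1)] is at least its value at 1 or its value at 2, according to
   the sign of [a - 1]; the minimum covers both cases. *)
apply: (@lt_le_trans _ _ (\int[mu]_(t in `[1%R, 2%R])
   (Num.min 1 (2 `^ (a - 1)) * expR (- 2))%:E)%E).
  rewrite integral_cst//= lebesgue_measure_itv/= lte_fin ltr1n -EFinB -EFinM lte_fin.
  by rewrite mulr_gt0 ?mulr_gt0 ?expR_gt0 ?lt_min ?powR_gt0//=; lra.
apply: (@le_trans _ _ (\int[mu]_(t in `[1%R, 2%R]) (gamma_int a t)%:E)%E).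
  apply: ge0_le_integral => //; first exact: mg.
  move=> t; rewrite /= in_itv/= => /andP[t1 t2]; rewrite lee_fin.
  apply: ler_pM; rewrite ?le_min ?powR_ge0 ?ler01 ?expR_ge0//; last first.
    by rewrite ler_expR lerN2.
  rewrite ge_min; have [a1|a1] := lerP 1 a.
    apply/orP; left; rewrite -[X in X <= _](powRr0 t); apply: ler_powR => //; lra.
  apply/orP; right; rewrite -[a - 1]opprK (powRN 2) (powRN t) lef_pV2 ?posrE ?powR_gt0//; [|lra..].
  by apply: ge0_ler_powR => //; rewrite ?nnegrE; lra.
apply: ge0_subset_integral => //; first exact: mg.
- by move=> x _; rewrite lee_fin gamma_int_ge0.
- by move=> x /=; rewrite !in_itv/=; lra.
Qed.

Lemma Gamma1 : Gamma (1 : R) = 1.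
Proof.
apply: EFin_inj; rewrite EFin_Gamma// -[1 in RHS]invr1 -(integral_expRN ltr01).
apply: eq_integral => t _; congr EFin.
by rewrite /gamma_int subrr powRr0 !mul1r.
Qed.

(** Continuity under the integral sign. For [b] between [u = a / 2] and [v = a + 1] the integrand is
    dominated by the one for [v] when [t >= 1] and by the one for [u] when [t < 1], hence always by
    their sum. *)
Lemma continuous_Gamma a : 0 < a -> {for a, continuous (@Gamma R)}.
Proof.
move=> a0.
pose u := a / 2; pose v := a + 1.
have u0 : 0 < u by rewrite /u; lra.
have v0 : 0 < v by rewrite /v; lra.
apply: (@continuity_under_integral _ _ _ mu (fun b t => t `^ (b - 1) * expR (- t))
  `]0, +oo[%classic _ u v _ _ (fun t => gamma_int u t + gamma_int v t)).
- exact: measurable_itv.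
- move=> x; rewrite /= in_itv/= => /andP[ux _].
  by apply: integrable_gamma_int; lra.
- apply: aeW => t; rewrite /= in_itv/= andbT => t0 b _.
  apply: cvgMl; apply: (@cvg_comp _ _ _ (fun b => b - 1) (powR t)).
    by apply: cvgB; [exact: cvg_id|exact: cvg_cst].
  exact: continuous_powR_exponent.
- rewrite (_ : EFin \o _ = (EFin \o gamma_int u) \+ (EFin \o gamma_int v))//.
  by apply: integrableD; [|exact: integrable_gamma_int..].
- move=> b; rewrite /= in_itv/= => /andP[ub bv]; apply: aeW => t.
  rewrite /= in_itv/= andbT => t0.
  rewrite ger0_norm; last exact: gamma_int_ge0.
  rewrite /gamma_int -mulrDl ler_wpM2r ?expR_ge0//.
  have [t1|t1] := lerP 1 t.
    by rewrite ler_wpDl ?powR_ge0//; apply: ler_powR => //; lra.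
  by rewrite ler_wpDr ?powR_ge0//; apply: ger_powR; lra.
- by rewrite inE /= in_itv/= /u /v; lra.
Qed.

End gamma.

(** * The Beta integral *)

Section beta.
Context {R : realType}.
Local Notation mu := (@lebesgue_measure R).
Implicit Types a b x y t : R.

Lemma measurable_triangle :
  measurable [set z : measurableTypeR R * measurableTypeR R | 0 <= z.2 <= z.1].
Proof.
pose h (z : measurableTypeR R * measurableTypeR R) : measurableTypeR R := z.1 - z.2.
have mh : measurable_fun setT h by apply: measurable_funB.
rewrite (_ : [set _ | _] = setT `&` snd @^-1` `[0, +oo[%classic `&`
   (setT `&` h @^-1` `[0, +oo[%classic)).
  apply: measurableI.
    by apply: (measurable_snd measurableT); exact: measurable_itv.
  by apply: (mh measurableT); exact: measurable_itv.
apply/seteqP; split => [[x t]|[x t]] /=; rewrite !in_itv/= /h/=.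
  by move=> /andP[-> tx]; rewrite subr_ge0 tx.
by move=> [[_ /andP[-> _]] [_]]; rewrite andbT subr_ge0.
Qed.

Definition beta_int a b x : \bar R :=
  (\int[mu]_(t in `[0%R, x]) ((x - t) `^ (a - 1) * t `^ b)%:E)%E.

Lemma measurable_beta_int a b x (D : set R) :
  measurable_fun D (fun t => (x - t) `^ (a - 1) * t `^ b).
Proof.
apply: measurable_funTS; apply: measurable_funM; last exact: measurable_powR.
apply: (measurableT_comp (measurable_powR _)); exact: measurable_funB.
Qed.

Lemma beta_intE a b x : beta_int a b x =
  (\int[mu]_t ((fun t => ((x - t) `^ (a - 1) * t `^ b)%:E) \_ `[0%R, x]) t)%E.
Proof. by rewrite /beta_int integral_mkcond. Qed.

(** Homogeneity: the substitution [t = x s] brings out [x], [x ^ (a - 1)] and [x ^ b]. *)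
Lemma beta_int_scale a b x : 0 < x ->
  (beta_int a b x = (x `^ (a + b))%:E * beta_int a b 1)%E.
Proof.
move=> x0; rewrite !beta_intE.
have mb y : measurable_fun [set: R] ((fun t => ((y - t) `^ (a - 1) * t `^ b)%:E) \_ `[0, y]).
  apply/(measurable_restrictT _ _).1 => //; apply/measurable_EFinP.
  exact: measurable_beta_int.
have b0 y t : (0 <= ((fun t => ((y - t) `^ (a - 1) * t `^ b)%:E) \_ `[0%R, y]) t)%E.
  by apply: erestrict_ge0 => u _; rewrite lee_fin mulr_ge0 ?powR_ge0.
rewrite -(ge0_integral_scale x0 (mb x) (b0 x)).
have mbx : measurable_fun [set: R] (fun t => ((fun t => ((x - t) `^ (a - 1) * t `^ b)%:E) \_ `[0, x]) (x * t)).
  apply: (measurableT_comp (mb x)); exact: measurable_funM.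
rewrite -(ge0_integralZl_EFin mu measurableT (fun t _ => b0 x (x * t)) mbx (ltW x0)).
rewrite -(ge0_integralZl_EFin mu measurableT (fun t _ => b0 1 t) (mb 1) (powR_ge0 _ _)).
apply: eq_integral => t _; rewrite !patchE !mem_setE !in_itv/=.
have -> : (0 <= x * t <= x) = (0 <= t <= 1).
  by rewrite pmulr_rge0// -{2}[x]mulr1 ler_pM2l.
case: ifP => [/andP[t0 t1]|_]; last by rewrite !mule0.
rewrite -!EFinM; congr EFin.
have -> : x - x * t = x * (1 - t) by ring.
rewrite (powRM _ (ltW x0)) ?subr_ge0// (powRM _ (ltW x0))//.
have -> : x `^ (a + b) = x * x `^ (a - 1) * x `^ b.
  have -> : a + b = 1 + (a - 1) + b by ring.
  by rewrite !powRD ?(gt_eqF x0) ?implybT// powRr1// ltW.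
ring.
Qed.

Lemma beta_int1_lty a b : 0 < a -> 0 <= b -> (0 <= beta_int a b 1 < +oo)%E.
Proof.
move=> a0 b0; apply/andP; split.
  by apply: integral_ge0 => t _; rewrite lee_fin mulr_ge0 ?powR_ge0.
apply: (@le_lt_trans _ _ ((1 - 0) `^ a / a)%:E); last exact: ltry.
rewrite -(integral_powRBr a0 ler01).
apply: ge0_le_integral => //.
- by move=> t _; rewrite lee_fin mulr_ge0 ?powR_ge0.
- by apply/measurable_EFinP; exact: measurable_beta_int.
- apply/measurable_EFinP/measurable_funTS/(measurableT_comp (measurable_powR _)).
  exact: measurable_funB.
move=> t; rewrite /= in_itv/= => /andP[t0 t1]; rewrite lee_fin.
have : t `^ b <= 1 `^ b by apply: ge0_ler_powR; rewrite ?nnegrE.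
by rewrite powR1 => tb; rewrite ler_piMr ?powR_ge0.
Qed.

Lemma integral_gamma_shift a t : 0 < a ->
  (\int[mu]_(x in `[t, +oo[) ((x - t) `^ (a - 1) * expR (- x))%:E =
   (expR (- t) * Gamma a)%:E)%E.
Proof.
move=> a0.
have mg D : measurable_fun D (fun t => (gamma_int a t)%:E).
  by apply/measurable_EFinP; exact: measurable_gamma_int.
rewrite EFinM EFin_Gamma// -ge0_integralZl_EFin//; last 2 first.
- by move=> x _; rewrite lee_fin gamma_int_ge0.
- exact: mg.
rewrite [LHS]integral_mkcond [RHS]integral_mkcond.
rewrite -[RHS](ge0_integral_shift (- t)).
- apply: eq_integral => x _; rewrite !patchE !mem_setE !in_itv/= !andbT subr_ge0.
  case: ifP => // _; rewrite -EFinM; congr EFin.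
  rewrite /gamma_int mulrCA -expRD; congr (_ * expR _); ring.
- by apply/(measurable_restrictT _ _).1 => //; apply: measurable_funeM; exact: mg.
- move=> x; apply: erestrict_ge0 => u _.
  by rewrite -EFinM lee_fin mulr_ge0 ?expR_ge0 ?gamma_int_ge0.
Qed.

(** Euler's argument: the function [(x - t) ^ (a - 1) t ^ b exp (- x)] is integrated over the
    triangle [0 <= t <= x] in both orders. Integrating in [t] first gives, by homogeneity,
    [Gamma (a + b + 1)] times the integral for [x = 1]; integrating in [x] first gives
    [Gamma a * Gamma (b + 1)]. *)
Lemma integral_beta a b x : 0 < a -> 0 <= b -> 0 <= x ->
  (\int[mu]_(t in `[0%R, x]) ((x - t) `^ (a - 1) * t `^ b)%:E =
   (Gamma a * Gamma (b + 1) / Gamma (a + b + 1) * x `^ (a + b))%:E)%E.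
Proof.
move=> a0 b0; rewrite le_eqVlt => /predU1P[<-|x0].
  by rewrite set_itv1 integral_set1 powR0 ?mulr0 ?lt0r_neq0// ltr_wpDr.
rewrite -/(beta_int a b x) beta_int_scale// [RHS]EFinM muleC; congr (_ * _)%E.
have b1 : 0 < b + 1 by rewrite ltr_wpDl.
have ab1 : 0 < a + b + 1 by rewrite addr_gt0// ltr_wpDr.
have /andP[B0 Boo] := beta_int1_lty a0 b0.
have Bfin : beta_int a b 1 \is a fin_num by rewrite ge0_fin_numE.
suff : ((Gamma (a + b + 1))%:E * beta_int a b 1 = (Gamma a * Gamma (b + 1))%:E)%E.
  rewrite -(fineK Bfin) -EFinM => -[<-].
  by rewrite mulrAC divff ?mul1r// lt0r_neq0// Gamma_gt0.
pose f (z : measurableTypeR R * measurableTypeR R) : R :=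
  (z.1 - z.2) `^ (a - 1) * z.2 `^ b * expR (- z.1).
pose D := [set z : measurableTypeR R * measurableTypeR R | 0 <= z.2 <= z.1].
pose F := (EFin \o f) \_ D.
have f0 z : 0 <= f z by rewrite !mulr_ge0 ?powR_ge0 ?expR_ge0.
have F0 z : (0 <= F z)%E by apply: erestrict_ge0 => u _; rewrite lee_fin.
have mF : measurable_fun setT F.
  apply/(measurable_restrictT _ _).1; first exact: measurable_triangle.
  apply/measurable_EFinP/measurable_funTS.
  apply: measurable_funM; first apply: measurable_funM.
  - by apply: (measurableT_comp (measurable_powR _)); exact: measurable_funB.
  - exact: (measurableT_comp (measurable_powR _)).
  - by apply: measurableT_comp => //; exact: measurable_funN.
have FE y t : F (y, t) = if 0 <= t <= y then (f (y, t))%:E else 0%E.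
  rewrite /F patchE; case: ifPn => [/set_mem/= ->//|h].
  by case: ifPn => // ty; move/negP: h; case; apply/mem_set.
transitivity (\int[mu]_x \int[mu]_t F (x, t))%E.
  rewrite EFin_Gamma// muleC -ge0_integralZl//; last 2 first.
  - by apply/measurable_EFinP; exact: measurable_gamma_int.
  - by move=> t _; rewrite lee_fin gamma_int_ge0.
  rewrite [LHS]integral_mkcond; apply: eq_integral => y _.
  rewrite patchE mem_setE in_itv/= andbT; case: ifPn => y0; last first.
    rewrite integral0_eq// => t _; rewrite FE; case: ifPn => //.
    by move=> /andP[t0 ty]; rewrite (le_trans t0 ty) in y0.
  transitivity ((expR (- y))%:E * beta_int a b y)%E.
    have [->|yn0] := eqVneq y 0.
      rewrite /beta_int set_itv1 integral_set1 mule0 /gamma_int powR0 ?mul0r ?mule0//.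
      by rewrite addrK lt0r_neq0// ltr_wpDr.
    have ygt0 : 0 < y by rewrite lt_neqAle eq_sym yn0.
    rewrite (beta_int_scale _ _ ygt0).
    by rewrite muleC muleA -EFinM /gamma_int addrK mulrC.
  rewrite -ge0_integralZl_EFin//; last 2 first.
  - by move=> t _; rewrite lee_fin mulr_ge0 ?powR_ge0.
  - by apply/measurable_EFinP; exact: measurable_beta_int.
  rewrite [LHS]integral_mkcond; apply: eq_integral => t _.
  rewrite FE patchE mem_setE in_itv/=; case: ifPn => // ty.
  by rewrite -EFinM mulrC.
rewrite (fubini_tonelli F mF F0).
rewrite mulrC EFinM [X in (X * _)%E]EFin_Gamma// muleC -ge0_integralZl//; last 3 first.
- by apply/measurable_EFinP; exact: measurable_gamma_int.
- by move=> t _; rewrite lee_fin gamma_int_ge0.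
- by rewrite lee_fin ltW// Gamma_gt0.
rewrite [RHS]integral_mkcond; apply: eq_integral => t _.
rewrite patchE mem_setE in_itv/= andbT; case: ifPn => t0; last first.
  rewrite integral0_eq// => x' _; rewrite FE; case: ifPn => //.
  by move=> /andP[t0' _]; rewrite t0' in t0.
transitivity ((t `^ b)%:E * (expR (- t) * Gamma a)%:E)%E; last first.
  by rewrite -!EFinM; congr EFin; rewrite /gamma_int addrK; ring.
rewrite -integral_gamma_shift// -ge0_integralZl_EFin ?powR_ge0//; last 2 first.
- by move=> x' _; rewrite lee_fin mulr_ge0 ?powR_ge0 ?expR_ge0.
- apply/measurable_EFinP/measurable_funTS; apply: measurable_funM.
    by apply: (measurableT_comp (measurable_powR _)); exact: measurable_funB.
  by apply: measurableT_comp => //; exact: measurable_funN.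
rewrite [RHS]integral_mkcond; apply: eq_integral => y _.
rewrite FE patchE mem_setE in_itv/= andbT t0/=; case: ifPn => // ty.
by rewrite -EFinM /f/=; congr EFin; ring.
Qed.

End beta.

(** * Weierstrass approximation *)

Section uniform.
Context {R : realType}.

Lemma within_continuousP (A : set R) (f : R -> R) :
  {within A, continuous f} <-> forall x e : R, A x -> 0 < e ->
    exists2 d : R, 0 < d & forall y : R, A y -> `|x - y| < d -> `|f x - f y| < e.
Proof.
split=> [/subspace_continuousP cf x e Ax e0|H].
  have /cvgrPdist_lt/(_ e e0) := cf _ Ax.
  move=> [d /= d0 H]; exists d => // y Ay xy; exact: H.
apply/subspace_continuousP => x Ax; apply/cvgrPdist_lt => e e0.
have [d d0 Hd] := H x e Ax e0.
by exists d => //= y xy Ay; exact: Hd.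
Qed.

Lemma segment_uniformly_continuous (a b : R) (f : R -> R) (e : R) :
  {within `[a, b], continuous f} -> 0 < e ->
  exists2 d : R, 0 < d & forall x y : R, x \in `[a, b] -> y \in `[a, b] ->
    `|x - y| < d -> `|f x - f y| <= e.
Proof.
move=> /within_continuousP cf e0.
(* Compactness in its near-covering form: a radius that works locally near each point works for all
   points at once, for all small enough positive [d]. *)
have /compact_near_coveringP/(_ R (0^'+) (fun d x => forall y, x \in `[a, b] ->
  y \in `[a, b] -> `|x - y| < d -> `|f x - f y| <= e)) := @segment_compact R a b.
case=> [x xI|d /= d0 H].
  have [d d0 Hd] := cf x (e / 2) xI ltac:(lra).
  exists (ball x (d / 2), [set r | 0 < r < d / 2]).
    split; first by apply: nbhsx_ballx; lra.
    exists (d / 2) => /=; first by lra.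
    by move=> r /=; rewrite sub0r normrN => rd r0; rewrite r0 (le_lt_trans (ler_norm r)).
  move=> [u r] /= [xu /andP[r0 rd]] y uI yI uy.
  rewrite /ball/= in xu.
  have h1 : `|f x - f u| < e / 2 by apply: Hd => //; lra.
  have h2 : `|f x - f y| < e / 2.
    by apply: Hd => //; have := ler_distD u x y; lra.
  by have := ler_distD (f x) (f u) (f y); rewrite (distrC (f u) (f x)); lra.
exists (d / 2); first by lra.
move=> x y xI yI xy; apply: (H (d / 2)) => //=.
- by rewrite sub0r normrN gtr0_norm; lra.
- by lra.
Qed.

End uniform.

Section weierstrass.
Context {R : realType}.

(* The expectation of [g] at the number of heads in [n] tosses of a coin of
   bias ['X]: the Bernstein polynomial of [g]. *)
Fixpoint bernstein (n : nat) (g : nat -> R) : {poly R} :=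
  if n is m.+1 then 'X * bernstein m (g \o S) + (1 - 'X) * bernstein m g
  else (g 0%N)%:P.

Lemma bernsteinS n g x : (bernstein n.+1 g).[x] =
  x * (bernstein n (g \o S)).[x] + (1 - x) * (bernstein n g).[x].
Proof. by rewrite /= !hornerE. Qed.

Lemma bernstein_cst n c x : (bernstein n (fun=> c)).[x] = c.
Proof.
elim: n => [|n IH]; first by rewrite hornerC.
by rewrite bernsteinS (_ : _ \o S = fun=> c)// IH; ring.
Qed.

Lemma bernsteinB n g h x : (bernstein n (fun k => g k - h k)).[x] =
  (bernstein n g).[x] - (bernstein n h).[x].
Proof.
elim: n g h => [|n IH] g h; first by rewrite !hornerC.
rewrite !bernsteinS (_ : _ \o S = fun k => (g \o S) k - (h \o S) k)// !IH; ring.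
Qed.

(** The variance [n x (1 - x)] of the binomial distribution. *)
Lemma bernstein_sqr n a b x : (bernstein n (fun k => a + b * (k%:R - x * n%:R) ^+ 2)).[x] =
  a + b * (n%:R * (x * (1 - x))).
Proof.
(* The centre is freed for the induction, since shifting the index by [S] turns [c] into [c - 1]. *)
suff H c : (bernstein n (fun k => a + b * (k%:R - c) ^+ 2)).[x] =
    a + b * (n%:R * (x * (1 - x)) + (n%:R * x - c) ^+ 2).
  by rewrite H; ring.
elim: n c => [|n IH] c; first by rewrite hornerC; ring.
rewrite bernsteinS IH.
rewrite (_ : _ \o S = fun k : nat => a + b * (k%:R - (c - 1)) ^+ 2) ?IH.
  by rewrite -natr1; ring.
by apply/funext => k /=; rewrite -natr1; ring.
Qed.

Lemma ler_bernstein n g h x : 0 <= x <= 1 ->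
  (forall k, (k <= n)%N -> g k <= h k) ->
  (bernstein n g).[x] <= (bernstein n h).[x].
Proof.
move=> /andP[x0 x1]; elim: n g h => [|n IH] g h gh; first by rewrite !hornerC gh.
rewrite !bernsteinS lerD// ler_wpM2l ?subr_ge0// IH// => k kn; apply: gh => //.
exact: leqW.
Qed.

(** Bernstein's proof. If [k / N] is within [d] of [x], then [f] varies by at most [e / 2];
    otherwise the trivial bound [2 M] is at most [2 M (x - k / N) ^ 2 / d ^ 2]. The sum of both
    bounds is the quadratic [h], whose expectation is given by the variance; [N] makes the second
    part of it at most [e / 2]. *)
Lemma weierstrass (f : R -> R) (e : R) : {within `[0, 1], continuous f} -> 0 < e ->
  exists p : {poly R}, forall x, x \in `[0, 1] -> `|f x - p.[x]| <= e.
Proof.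
move=> cf e0.
have [M M0 fM] : exists2 M : R, 0 < M & forall x : R, x \in `[0, 1] -> `|f x| <= M.
  have /compact_bounded[M [Mr]] := continuous_compact cf (@segment_compact R 0 1).
  move=> /(_ (`|M| + 1)) H; exists (`|M| + 1); first by rewrite ltr_wpDl.
  move=> x xI; apply: H => /=; last by exists x.
  by rewrite (le_lt_trans (ler_norm M))// ltrDl.
have [d d0 fd] := segment_uniformly_continuous cf (ltac:(lra) : 0 < e / 2).
pose N := (Num.truncn (4 * M / (d ^+ 2 * e))).+1.
exists (bernstein N (fun k => f (k%:R / N%:R))) => x xI.
have N0 : (0 : R) < N%:R by rewrite ltr0n.
have d2 : 0 < d ^+ 2 by rewrite exprn_gt0.
have xI' : 0 <= x <= 1 by move: xI; rewrite in_itv.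
pose h (k : nat) := e / 2 + 2 * M / (d ^+ 2 * N%:R ^+ 2) * (k%:R - x * N%:R) ^+ 2.
have fh k : (k <= N)%N -> `|f x - f (k%:R / N%:R)| <= h k.
  move=> kN.
  have kI : k%:R / N%:R \in `[(0 : R), 1].
    by rewrite in_itv/= divr_ge0 ?ler0n// ler_pdivrMr// mul1r ler_nat.
  have E : (k%:R - x * N%:R) ^+ 2 = N%:R ^+ 2 * (x - k%:R / N%:R) ^+ 2.
    by field; exact: lt0r_neq0.
  have hE : h k = e / 2 + 2 * M * ((x - k%:R / N%:R) ^+ 2 / d ^+ 2).
    by rewrite /h E; field; rewrite !lt0r_neq0.
  have [xk|xk] := ltP `|x - k%:R / N%:R| d.
    apply: le_trans (fd _ _ xI kI xk) _.
    by rewrite hE lerDl; apply: mulr_ge0; [lra|exact: divr_ge0 (sqr_ge0 _) (ltW d2)].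
  apply: (@le_trans _ _ (2 * M)).
    by apply: le_trans (ler_normB _ _) _; have := fM _ xI; have := fM _ kI; lra.
  rewrite hE; apply: (@le_trans _ _ (2 * M * 1)); first by rewrite mulr1.
  apply: ler_wpDl; first lra.
  apply: ler_wpM2l; first lra.
  by rewrite lter_pdivlMr// mul1r -[leRHS]real_normK ?num_real// ler_sqr ?nnegrE ?(ltW d0).
have hle : (bernstein N h).[x] <= e.
  rewrite /h bernstein_sqr.
  have x14 : x * (1 - x) <= 1 by nra.
  have -> : 2 * M / (d ^+ 2 * N%:R ^+ 2) * (N%:R * (x * (1 - x))) =
     (2 * M / d ^+ 2) / N%:R * (x * (1 - x)).
    by field; rewrite !lt0r_neq0.
  apply: (@le_trans _ _ (e / 2 + e / 2 * 1)); last by lra.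
  rewrite lerD2l; apply: ler_pM => //.
  - by apply: divr_ge0; [apply: divr_ge0; lra|exact: ltW].
  - by case/andP: xI' => *; apply: mulr_ge0; lra.
  rewrite ler_pdivrMr// ler_pdivrMr//.
  have := truncnS_gt (4 * M / (d ^+ 2 * e)); rewrite -/N ltr_pdivrMr ?mulr_gt0// => H.
  by lra.
rewrite ler_norml; apply/andP; split.
  rewrite lerNl opprB -[X in _ - X](bernstein_cst N (f x) x) -bernsteinB.
  apply: le_trans hle; apply: ler_bernstein => // k kN.
  by apply: le_trans (fh k kN); rewrite distrC ler_norm.
rewrite -[X in X - _](bernstein_cst N (f x) x) -bernsteinB.
apply: le_trans hle; apply: ler_bernstein => // k kN.
by apply: le_trans (fh k kN); rewrite ler_norm.
Qed.

End weierstrass.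

(** * Convolution operators on an interval *)

Section schur.
Context {R : realType}.
Local Notation mu := (@lebesgue_measure R).
Local Notation T := (measurableTypeR R).

(** Hölder's inequality for the splitting [k g = k ^ (1 / q) * (k ^ (1 / p) g)]. For [p = 1] the
    conjugate exponent is infinite, but both sides are then equal. *)
Lemma jensen_kernel (p : R) (k g : T -> R) : 1 <= p ->
  measurable_fun setT k -> measurable_fun setT g ->
  (forall t, 0 <= k t) -> (forall t, 0 <= g t) ->
  ((\int[mu]_t (k t * g t)%:E) `^ p <=
   (\int[mu]_t (k t)%:E) `^ (p - 1) * \int[mu]_t (k t * g t `^ p)%:E)%E.
Proof.
move=> p1 mk mg k0 g0; have p0 : 0 < p by lra.
have ik0 : (0 <= \int[mu]_t (k t)%:E)%E by apply: integral_ge0 => t _; rewrite lee_fin.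
have [->|pn1] := eqVneq p 1.
  rewrite subrr poweRe0 mul1e poweRe1; last first.
    by apply: integral_ge0 => t _; rewrite lee_fin mulr_ge0.
  by rewrite le_eqVlt; apply/orP; left; apply/eqP; apply: eq_integral => t _; rewrite powRr1.
have p1' : 1 < p by rewrite lt_neqAle eq_sym pn1.
pose q := p / (p - 1).
have q0 : 0 < q by rewrite /q divr_gt0//; lra.
have pq : q^-1 + p^-1 = 1 by rewrite /q; field; rewrite !lt0r_neq0//; lra.
have mkp r : measurable_fun setT (fun t => k t `^ r).
  exact: (measurableT_comp (measurable_powR _)).
have := @hoelder _ _ _ mu (fun t => k t `^ q^-1) (fun t => k t `^ p^-1 * g t) q p
  (mkp _) (measurable_funM (mkp _) mg) q0 p0 pq.
rewrite Lnorm1.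
have -> : (\int[mu]_x `|(EFin \o ((fun t => k t `^ q^-1) \* (fun t => k t `^ p^-1 * g t))%R) x| =
   \int[mu]_t (k t * g t)%:E)%E.
  apply: eq_integral => t _ /=.
  rewrite ger0_norm ?mulr_ge0 ?powR_ge0// mulrA -powRD ?pq ?powRr1//.
  by rewrite oner_eq0.
move=> /(gt0_ler_poweR (ltW p0)) H.
apply: le_trans (H _ _) _; rewrite ?in_itv/= ?leey ?andbT//.
- by apply: integral_ge0 => t _; rewrite lee_fin mulr_ge0.
- by apply: mule_ge0; exact: Lnorm_ge0.
rewrite poweRM ?Lnorm_ge0// (poweR_Lnorm _ _ (lt0r_neq0 p0)).
have -> : ('N[mu]_q%:E[EFin \o (fun t => (k t `^ q^-1)%R)] `^ p =
   (\int[mu]_t (k t)%:E) `^ (p - 1))%E.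
  have -> : p = q * (p - 1) by rewrite /q; field; rewrite lt0r_neq0//; lra.
  rewrite [in LHS]poweRrM (poweR_Lnorm _ _ (lt0r_neq0 q0)).
  congr poweR; last by rewrite /q; field; rewrite lt0r_neq0//; lra.
  apply: eq_integral => t _ /=.
  by rewrite ger0_norm ?powR_ge0// -powRrM mulVf ?lt0r_neq0// powRr1.
rewrite le_eqVlt; apply/orP; left; apply/eqP; congr (_ * _)%E.
apply: eq_integral => t _ /=.
rewrite ger0_norm ?mulr_ge0 ?powR_ge0// powRM ?powR_ge0// -powRrM mulVf ?lt0r_neq0//.
by rewrite powRr1.
Qed.

(** Schur's test. [jensen_kernel] on each row costs [c ^ (p - 1)]; exchanging the integrals by
    Tonelli then makes the column integrals appear, which contribute the last factor [c]. *)
Lemma schur_test (p c : R) (k : T * T -> R) (g F : T -> R) : 1 <= p -> 0 <= c ->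
  measurable_fun setT k -> measurable_fun setT g -> measurable_fun setT F ->
  (forall z, 0 <= k z) -> (forall t, 0 <= g t) ->
  (forall x, \int[mu]_t (k (x, t))%:E <= c%:E)%E ->
  (forall t, \int[mu]_x (k (x, t))%:E <= c%:E)%E ->
  (forall x, (`|F x|)%:E <= \int[mu]_t (k (x, t) * g t)%:E)%E ->
  ('N[mu]_p%:E[EFin \o F] <= c%:E * 'N[mu]_p%:E[EFin \o g])%E.
Proof.
move=> p1 c0 mk mg mF k0 g0 kt kx Fk; have p0 : 0 < p by lra.
have pn0 : p != 0 by rewrite lt0r_neq0.
have mk2 x : measurable_fun setT (fun t => k (x, t)) by apply: measurableT_comp.
have mk1 t : measurable_fun setT (fun x => k (x, t)) by apply: measurableT_comp.
have mgp : measurable_fun setT (fun t => g t `^ p).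
  exact: (measurableT_comp (measurable_powR _)).
have mkg : measurable_fun setT (fun z : T * T => (k z * g z.2 `^ p)%:E).
  apply/measurable_EFinP; apply: measurable_funM => //.
  exact: (measurableT_comp mgp).
have kg0 z : (0 <= (k z * g z.2 `^ p)%:E)%E by rewrite lee_fin mulr_ge0 ?powR_ge0.
have Np0 (f : T -> \bar R) : (0 <= 'N[mu]_p%:E[f])%E by exact: Lnorm_ge0.
have mX (h : T -> R) : measurable_fun [set: T] h ->
    measurable_fun [set: T] (fun x => (`|(EFin \o h) x| `^ p)%E).
  move=> mh; apply: (measurableT_comp (measurable_poweR _)) => //.
  by apply: measurableT_comp => //; exact/measurable_EFinP.
suff H : ('N[mu]_p%:E[EFin \o F] `^ p <= (c%:E * 'N[mu]_p%:E[EFin \o g]) `^ p)%E.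
  rewrite -[leLHS]poweRe1// -[leRHS]poweRe1; last by rewrite mule_ge0// ?lee_fin ?Np0.
  rewrite -(mulfV pn0) !(poweRrM _ p p^-1).
  apply: (gt0_ler_poweR _ _ _ H); rewrite ?invr_ge0 ?(ltW p0)//;
    by rewrite in_itv/= poweR_ge0 leey.
rewrite poweRM ?lee_fin ?Np0// !(poweR_Lnorm _ _ pn0) poweR_EFin.
apply: (@le_trans _ _ (\int[mu]_x ((c `^ (p - 1))%:E * \int[mu]_t (k (x, t) * g t `^ p)%:E))%E).
  apply: ge0_le_integral => //.
  - by move=> x _; exact: poweR_ge0.
  - exact: mX.
  - apply: measurable_funeM.
    exact: (measurable_fun_fubini_tonelli_F (fun z => (k z * g z.2 `^ p)%:E)).
  move=> x _.
  apply: (@le_trans _ _ ((\int[mu]_t (k (x, t) * g t)%:E) `^ p)%E).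
    apply: (gt0_ler_poweR (ltW p0)); rewrite ?in_itv/= ?leey ?andbT//.
    by apply: integral_ge0 => t _; rewrite lee_fin mulr_ge0.
  apply: le_trans (jensen_kernel p1 (mk2 x) mg (fun t => k0 (x, t)) g0) _.
  apply: lee_wpmul2r; first by apply: integral_ge0 => t _; exact: kg0.
  rewrite -poweR_EFin; apply: gt0_ler_poweR; rewrite ?in_itv/= ?leey ?andbT//; first lra.
  by apply: integral_ge0 => t _; rewrite lee_fin.
rewrite ge0_integralZl_EFin ?powR_ge0//; last 2 first.
- by move=> x _; apply: integral_ge0 => t _; exact: kg0.
- exact: (measurable_fun_fubini_tonelli_F (fun z => (k z * g z.2 `^ p)%:E)).
rewrite (fubini_tonelli (fun z => (k z * g z.2 `^ p)%:E) mkg kg0)/=.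
have -> : c `^ p = c `^ (p - 1) * c.
  by rewrite mulrC mulr_powRB1.
rewrite EFinM -muleA; apply: lee_wpmul2l; first by rewrite lee_fin powR_ge0.
rewrite -ge0_integralZl_EFin//; last exact: (mX _ mg).
apply: ge0_le_integral => //.
- by move=> t _; apply: integral_ge0 => x _; exact: kg0.
- exact: (measurable_fun_fubini_tonelli_G (fun z => (k z * g z.2 `^ p)%:E)).
- by apply: measurable_funeM; exact: (mX _ mg).
move=> t _ /=.
under eq_integral do rewrite mulrC EFinM.
rewrite ge0_integralZl_EFin ?powR_ge0//; last 2 first.
- by move=> x _; rewrite lee_fin.
- exact/measurable_EFinP.
by rewrite ger0_norm// muleC; apply: lee_wpmul2r; rewrite ?lee_fin ?powR_ge0.
Qed.

End schur.

Lemma abse_fine_le (R : realType) (z : \bar R) : (`|fine z|%:E <= `|z|)%E.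
Proof. by case: z => [r| |] //=; rewrite normr0 leey. Qed.

(** * Truncated convolution on [0, 1] *)

Section convolution_kernel.
Context {R : realType}.
Local Notation mu := (@lebesgue_measure R).
Local Notation T := (measurableTypeR R).
Implicit Types (phi psi f : R -> R) (x y t a b : R).

(* Cut off so that the convolution only sees the values of a function on [0, 1] and
   vanishes outside [0, 1]. *)
Definition ker phi (z : T * T) : R :=
  if (0 <= z.2 < z.1) && (z.1 <= 1) then phi (z.1 - z.2) else 0.

Definition conv phi f x : R := \int[mu]_t (ker phi (x, t) * f t).

Lemma measurable_ker phi : measurable_fun setT phi -> measurable_fun setT (ker phi).
Proof.
move=> mphi; apply: measurable_fun_ifT; last exact: measurable_cst.
- apply: measurable_and; first apply: measurable_and.
  + by apply: measurable_fun_ler => //; exact: measurable_snd.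
  + by apply: measurable_fun_ltr; [exact: measurable_snd|exact: measurable_fst].
  + by apply: measurable_fun_ler => //; exact: measurable_fst.
- by apply: (measurableT_comp mphi); exact: measurable_funB.
Qed.

Lemma ker_ge0 phi z : (forall u, 0 < u <= 1 -> 0 <= phi u) -> 0 <= ker phi z.
Proof.
move=> phi0; rewrite /ker; case: ifPn => // /andP[/andP[z0 zz] z1].
by apply: phi0; rewrite subr_gt0 zz/=; lra.
Qed.

Section bounds.
Variables (phi : R -> R) (c : R).
Hypothesis mphi : measurable_fun setT phi.
Hypothesis phi0 : forall u, 0 < u <= 1 -> 0 <= phi u.
Hypothesis phic : (\int[mu]_(u in `]0%R, 1%R]) (phi u)%:E <= c%:E)%E.

Let Phi := (EFin \o phi) \_ `]0, 1].

Let mPhi : measurable_fun setT Phi.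
Proof.
apply/(measurable_restrictT _ _).1; first exact: measurable_itv.
exact/measurable_EFinP/measurable_funTS.
Qed.

Let Phi0 u : (0 <= Phi u)%E.
Proof.
by apply: erestrict_ge0 => v; rewrite /= in_itv/= => v01; rewrite lee_fin phi0.
Qed.

Let ker_le z : ((ker phi z)%:E <= Phi (z.1 - z.2)%R)%E.
Proof.
rewrite /ker; case: ifPn => [/andP[/andP[z0 zz] z1]|_]; last exact: Phi0.
by rewrite /Phi patchE mem_set//= in_itv/= subr_gt0 zz/=; lra.
Qed.

Lemma integral_ker_le2 x : (\int[mu]_t (ker phi (x, t))%:E <= c%:E)%E.
Proof.
apply: le_trans phic; rewrite [leRHS]integral_mkcond -(ge0_integral_reflect x mPhi Phi0).
apply: ge0_le_integral => //.
- by move=> t _; rewrite lee_fin ker_ge0.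
- by apply/measurable_EFinP; apply: measurableT_comp => //; exact: measurable_ker.
- by apply: (measurableT_comp mPhi); exact: measurable_funB.
Qed.

Lemma integral_ker_le1 t : (\int[mu]_x (ker phi (x, t))%:E <= c%:E)%E.
Proof.
apply: le_trans phic; rewrite [leRHS]integral_mkcond -(ge0_integral_shift (- t) mPhi Phi0).
apply: ge0_le_integral => //.
- by move=> x _; rewrite lee_fin ker_ge0.
- by apply/measurable_EFinP; apply: measurableT_comp => //; exact: measurable_ker.
- by apply: (measurableT_comp mPhi); exact: measurable_funD.
Qed.

Lemma ker_bound_ge0 : 0 <= c.
Proof.
rewrite -lee_fin; apply: le_trans (integral_ker_le2 0).
by apply: integral_ge0 => t _; rewrite lee_fin ker_ge0.
Qed.

Lemma measurable_ker_mul x f : measurable_fun setT f ->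
  measurable_fun setT (fun t => ker phi (x, t) * f t).
Proof.
move=> mf; apply: measurable_funM => //.
by apply: measurableT_comp => //; exact: measurable_ker.
Qed.

Lemma conv_abs_le x f : measurable_fun setT f ->
  (`|conv phi f x|%:E <= \int[mu]_t (ker phi (x, t) * `|f t|)%:E)%E.
Proof.
move=> mf; rewrite /conv /Rintegral.
have -> : (\int[mu]_t (ker phi (x, t) * `|f t|)%:E =
           \int[mu]_t `|(ker phi (x, t) * f t)%:E|)%E.
  by apply: eq_integral => t _ /=; rewrite normrM ger0_norm ?ker_ge0.
apply: le_trans (le_abse_integral _ _ _) => //.
  exact: abse_fine_le.
by apply/measurable_EFinP; exact: measurable_ker_mul.
Qed.

Lemma conv_bounded x f (M : R) : 0 <= M -> measurable_fun setT f ->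
  (forall t, `|f t| <= M) -> `|conv phi f x| <= c * M.
Proof.
move=> M0 mf fM; rewrite -lee_fin; apply: le_trans (conv_abs_le x mf) _.
have mk : measurable_fun [set: R] (fun t => (ker phi (x, t))%:E).
  by apply/measurable_EFinP; apply: measurableT_comp => //; exact: measurable_ker.
apply: (@le_trans _ _ (\int[mu]_t (M%:E * (ker phi (x, t))%:E))%E).
  apply: ge0_le_integral => //.
  - by move=> t _; rewrite lee_fin mulr_ge0// ker_ge0.
  - have mabs : measurable_fun [set: R] (fun t => `|f t|) by exact: measurableT_comp.
    by apply/measurable_EFinP; exact: (measurable_ker_mul x mabs).
  - exact: measurable_funeM.
  by move=> t _; rewrite -EFinM lee_fin mulrC ler_wpM2r// ker_ge0.
rewrite ge0_integralZl_EFin//; last by move=> t _; rewrite lee_fin ker_ge0.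
by rewrite [c * M]mulrC EFinM lee_wpmul2l ?lee_fin// integral_ker_le2.
Qed.

(** The columns of the kernel integrate to at most [c], so the total is at most [c] times the L^1
    norm of [f]. By Fubini this makes the convolution measurable, and its integrand integrable for
    almost every [x]. *)
Lemma integrable_ker_prod f : mu.-integrable setT (EFin \o f) ->
  (mu \x mu)%E.-integrable [set: T * T] (fun z => (ker phi z * f z.2)%:E).
Proof.
move=> /integrableP[/measurable_EFinP mf fi]; apply/integrable21ltyP.
  apply/measurable_EFinP/measurable_funM; first exact: measurable_ker.
  exact: (measurableT_comp mf).
apply: (@le_lt_trans _ _ (c%:E * \int[mu]_t `|(EFin \o f) t|)%E); last first.
  by apply: lte_mul_pinfty; rewrite ?lee_fin ?ker_bound_ge0.
have ma : measurable_fun [set: R] (fun t => `|(EFin \o f) t|%E).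
  by apply: measurableT_comp => //; exact/measurable_EFinP.
rewrite -ge0_integralZl_EFin ?ker_bound_ge0//.
apply: ge0_le_integral => //.
- by move=> t _; apply: integral_ge0.
- apply: (measurable_fun_fubini_tonelli_G (fun z : T * T => `|(ker phi z * f z.2)%:E|%E)) => //.
  apply: measurableT_comp => //; apply/measurable_EFinP/measurable_funM; first exact: measurable_ker.
  exact: (measurableT_comp mf).
- exact: measurable_funeM.
move=> t _ /=.
under eq_integral do rewrite normrM (ger0_norm (ker_ge0 _ phi0)) mulrC EFinM.
rewrite ge0_integralZl_EFin//; last 2 first.
- by move=> x _; rewrite lee_fin ker_ge0.
- by apply/measurable_EFinP; apply: measurableT_comp => //; exact: measurable_ker.
by rewrite muleC lee_wpmul2r// integral_ker_le1.
Qed.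

Lemma measurable_conv f : mu.-integrable setT (EFin \o f) ->
  measurable_fun setT (conv phi f).
Proof.
move=> /integrable_ker_prod/measurable_fubini_F mF.
by apply: (measurableT_comp _ mF).
Qed.

Lemma ae_integrable_ker f : mu.-integrable setT (EFin \o f) ->
  {ae mu, forall x, mu.-integrable setT (fun t => (ker phi (x, t) * f t)%:E)}.
Proof. by move=> /integrable_ker_prod/ae_integrable1. Qed.

End bounds.
End convolution_kernel.

(** * Continuity of convolutions *)

Section convolution_continuous.
Context {R : realType}.
Local Notation mu := (@lebesgue_measure R).
Local Notation T := (measurableTypeR R).

Lemma integral_reflect (c : R) (f : T -> \bar R) : measurable_fun [set: T] f ->
  (\int[mu]_x f (c - x)%R = \int[mu]_x f x)%E.
Proof.
move=> mf; rewrite integralE [RHS]integralE.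
congr (_ - _)%E.
  have mp : measurable_fun [set: T] (f^\+)%E by exact: measurable_funepos.
  by rewrite -(ge0_integral_reflect c mp (funepos_ge0 f)); apply: eq_integral => x _; rewrite !funeposE.
have mn : measurable_fun [set: T] (f^\-)%E by exact: measurable_funeneg.
by rewrite -(ge0_integral_reflect c mn (funeneg_ge0 f)); apply: eq_integral => x _; rewrite !funenegE.
Qed.

Variables (phi f : R -> R).
Hypothesis mphi : measurable_fun setT phi.
Hypothesis iphi : mu.-integrable `]0, 1] (EFin \o phi).
Hypothesis cf : {within `[0, 1], continuous f}.
Hypothesis f0 : forall x, x \notin `[0, 1] -> f x = 0.

Let Phi := phi \_ `]0, 1].

Let mPhi : measurable_fun setT Phi.
Proof.
by apply/(measurable_restrictT _ _).1; [exact: measurable_itv|exact: measurable_funTS].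
Qed.

Let fE : f = f \_ `[0, 1].
Proof.
by apply/funext => x; rewrite patchE mem_setE; case: ifPn => // /f0.
Qed.

Let mf : measurable_fun setT f.
Proof.
rewrite fE; apply/(measurable_restrictT _ _).1; first exact: measurable_itv.
by apply: subspace_continuous_measurable_fun => //; exact: measurable_itv.
Qed.

Lemma conv_reflectE x : x \in `[0, 1] ->
  conv phi f x = \int[mu]_u (Phi u * f (x - u)).
Proof.
rewrite in_itv/= => /andP[x0 x1]; rewrite /conv /Rintegral; congr fine.
rewrite -(integral_reflect x); last first.
  by apply/measurable_EFinP; exact: measurable_ker_mul.
apply: eq_integral => u _; congr EFin.
rewrite /ker/= x1 andbT /Phi patchE mem_setE in_itv/= subr_ge0.
have -> : (x - u < x) = (0 < u) by rewrite ltrBlDr ltrDl.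
have [u0|u0] := ltP 0 u; last by rewrite andbF !mul0r.
rewrite andbT/=; have [ux|xu] := leP u x.
  by rewrite (le_trans ux x1) opprB addrC subrK.
by rewrite f0 ?mulr0// in_itv/= subr_ge0 leNgt xu.
Qed.

Lemma continuous_conv : {within `[0, 1], continuous (conv phi f)}.
Proof.
have [M fM] : exists M, forall x, `|f x| <= M.
  have /compact_bounded[M [Mr]] := continuous_compact cf (@segment_compact R 0 1).
  move=> /(_ (`|M| + 1)) H; exists (`|M| + 1) => x.
  have [xI|/f0 ->] := boolP (x \in `[0, 1]); last by rewrite normr0 addr_ge0.
  apply: H => /=; last by exists x.
  by rewrite (le_lt_trans (ler_norm M))// ltrDl.
apply/within_continuousP => x e xI e0; apply: contrapT => H.
have /choice[y yP] : forall n : nat, exists y : R, [/\ y \in `[0, 1],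
    `|x - y| < n.+1%:R^-1 & e <= `|conv phi f x - conv phi f y| ].
  move=> n; apply: contrapT => Hn; apply: H; exists n.+1%:R^-1; first by rewrite invr_gt0.
  move=> y yI xy; rewrite ltNge; apply/negP => he; apply: Hn.
  by exists y; split.
have cy : (y n @[n --> \oo] --> x).
  apply/cvgrPdist_lt => d d0.
  have := @cvg_harmonic R; move=> /cvgrPdist_lt/(_ d d0); apply: filterS => n.
  rewrite /harmonic/= sub0r normrN ger0_norm ?invr_ge0// => /(lt_trans _); apply.
  by have [] := yP n.
pose g n u := (Phi u * f (y n - u))%:E.
have mg z : measurable_fun [set: T] (fun u => (Phi u * f (z - u))%:E).
  apply/measurable_EFinP/measurable_funM => //.
  by apply: (measurableT_comp mf); exact: measurable_funB.
have iPhi : mu.-integrable setT (fun u => (M * `|Phi u|)%:E).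
  rewrite (_ : (fun u => _) = (fun u => M%:E * `|(Phi u)%:E|)%E)//.
  apply: integrableZl => //; apply: integrable_abse.
  have mI1 : measurable (`]0, 1] : set T) by exact: measurable_itv.
  have /(integrable_mkcond _ mI1) := iphi.
  by apply: eq_integrable => // u _; rewrite /Phi !patchE; case: ifP.
(* The point [u = x] is left out: there the argument [y n - u] tends to 0, where [f], extended by
   zero, may jump. *)
have cvg_g : {ae mu, forall u, [set: T] u -> g n u @[n --> \oo] --> (Phi u * f (x - u))%:E}.
  exists [set x]; split; [exact: measurable_set1|exact: lebesgue_measure_set1|].
  move=> u /= Hu; apply: contrapT => ux; apply: Hu => _.
  apply: cvg_EFin; first by near=> n.
  rewrite (_ : fine \o _ = fun n => Phi u * f (y n - u))//.
  have yI n : y n \in `[0, 1] by case: (yP n).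
  have yu : y n - u @[n --> \oo] --> x - u by apply: cvgB => //; exact: cvg_cst.
  have [uI|uI] := boolP (u \in `]0, 1]); last first.
    have Pu : Phi u = 0 by rewrite /Phi patchE mem_setE (negbTE uI).
    by under eq_fun do rewrite Pu mul0r; rewrite Pu mul0r; exact: cvg_cst.
  move: (uI); rewrite in_itv/= => /andP[u0 u1].
  move: (xI); rewrite /= in_itv/= => /andP[x0 x1].
  apply: cvgMr; apply/cvgrPdist_lt => d d0.
  have [xu|xu|/esym//] := ltgtP x u.
    move/cvgrPdist_lt : yu => /(_ (u - x)); rewrite subr_gt0 => /(_ xu).
    apply: filterS => n; rewrite ltr_norml => /andP[h1 _].
    rewrite !f0 ?subrr ?normr0// in_itv/=; apply/negP => /andP[]; lra.
  have /within_continuousP/(_ (x - u) d) := cf.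
  case=> //; first by rewrite /= in_itv/=; apply/andP; split; lra.
  move=> r r0 Hr.
  move/cvgrPdist_lt : yu => /(_ (Num.min r (x - u))).
  rewrite lt_min r0 subr_gt0 xu => /(_ isT); apply: filterS => n.
  rewrite lt_min => /andP[h1 h2]; apply: Hr => //.
  have := yI n; rewrite /= !in_itv/= => /andP[? ?].
  move: h2; rewrite ltr_norml => /andP[h3 h4]; apply/andP; split; lra.
have g_le : {ae mu, forall u n, [set: T] u -> (`|g n u| <= (M * `|Phi u|)%:E)%E}.
  by apply: aeW => u n _; rewrite /g/= lee_fin normrM mulrC ler_wpM2r.
have [ig _ +] := dominated_convergence measurableT (fun n => mg (y n)) (mg x) cvg_g iPhi g_le.
rewrite -(fineK (integrable_fin_num measurableT ig)) => /fine_cvgP[_ cv].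
have {}cv : conv phi f (y n) @[n --> \oo] --> conv phi f x.
  rewrite conv_reflectE//; apply: cvg_trans cv; apply: near_eq_cvg; near=> n.
  by rewrite conv_reflectE//; case: (yP n).
move/cvgrPdist_lt : cv => /(_ e e0)[N _ /(_ N (leqnn N))].
by case: (yP N) => _ _; rewrite leNgt => /negP.
Unshelve. all: by end_near. Qed.
End convolution_continuous.

(** * Composition of convolutions *)

Section convolution_composition.
Context {R : realType}.
Local Notation mu := (@lebesgue_measure R).
Local Notation T := (measurableTypeR R).

Section composition.
Variables (phi psi : R -> R) (c d C : R) (f chi : R -> R) (y : R).
Hypothesis mphi : measurable_fun setT phi.
Hypothesis phi0 : forall u, 0 < u <= 1 -> 0 <= phi u.
Hypothesis mpsi : measurable_fun setT psi.
Hypothesis psi0 : forall u, 0 < u <= 1 -> 0 <= psi u.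
Hypothesis psid : (\int[mu]_(u in `]0%R, 1%R]) (psi u)%:E <= d%:E)%E.
Hypothesis fi : mu.-integrable setT (EFin \o f).
Hypothesis chiE : forall t,
  (\int[mu]_s (ker phi (y, s) * ker psi (s, t))%:E = (chi t)%:E)%E.
Hypothesis chiC : forall t, chi t <= C.

(** [chi] is the row at [y] of the composed kernel. Its bound [C] makes the double integral
    absolutely convergent for integrable [f], so Fubini applies at the given point [y] and not
    merely at almost every point. *)
Lemma conv_conv : conv phi (conv psi f) y = \int[mu]_t (chi t * f t).
Proof.
have /integrableP[/measurable_EFinP mf foo] := fi.
pose F (z : T * T) := (ker phi (y, z.1) * ker psi z * f z.2)%:E.
have k10 s : 0 <= ker phi (y, s) by exact: ker_ge0.
have k20 z : 0 <= ker psi z by exact: ker_ge0.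
have mk1 : measurable_fun [set: T] (fun s => ker phi (y, s)).
  by apply: measurableT_comp => //; exact: measurable_ker.
have mk2 t : measurable_fun [set: T] (fun s => ker psi (s, t)).
  by apply: measurableT_comp => //; exact: measurable_ker.
have mF : measurable_fun [set: T * T] F.
  apply/measurable_EFinP/measurable_funM; last exact: (measurableT_comp mf).
  apply: measurable_funM; last exact: measurable_ker.
  exact: (measurableT_comp mk1).
have chi0 t : 0 <= chi t.
  by rewrite -lee_fin -chiE; apply: integral_ge0 => s _; rewrite lee_fin mulr_ge0.
have mkk t : measurable_fun [set: T] (fun s => (ker phi (y, s) * ker psi (s, t))%:E).
  by apply/measurable_EFinP/measurable_funM.
have ikk t : mu.-integrable setT (fun s => (ker phi (y, s) * ker psi (s, t))%:E).
  apply/integrableP; split => //.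
  rewrite (eq_integral (fun s => (ker phi (y, s) * ker psi (s, t))%:E)) ?chiE ?ltry//.
  by move=> s _ /=; rewrite ger0_norm// mulr_ge0.
have iF : (mu \x mu)%E.-integrable setT F.
  apply/integrable21ltyP => //.
  apply: (@le_lt_trans _ _ (C%:E * \int[mu]_t `|(EFin \o f) t|)%E); last first.
    by apply: lte_mul_pinfty; rewrite // lee_fin (le_trans (chi0 0)).
  have ma : measurable_fun [set: R] (fun t => `|(EFin \o f) t|%E).
    by apply: measurableT_comp => //; exact/measurable_EFinP.
  rewrite -ge0_integralZl_EFin ?(le_trans (chi0 0))//.
  apply: ge0_le_integral => //.
  - by move=> t _; apply: integral_ge0.
  - apply: (measurable_fun_fubini_tonelli_G (fun z : T * T => `|F z|%E)) => //.
    exact: measurableT_comp.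
  - exact: measurable_funeM.
  move=> t _ /=.
  under eq_integral do rewrite normrM ger0_norm ?mulr_ge0// mulrC EFinM.
  rewrite ge0_integralZl_EFin//; last by move=> s _; rewrite lee_fin mulr_ge0.
  by rewrite chiE -!EFinM lee_fin mulrC ler_wpM2r.
rewrite /conv /Rintegral; congr fine.
transitivity (\int[mu]_t \int[mu]_s F (s, t))%E; last first.
  apply: eq_integral => t _; rewrite /F/=.
  under eq_integral do rewrite mulrC EFinM.
  by rewrite integralZl// chiE -EFinM mulrC.
rewrite -(Fubini iF).
(* The inner convolution is a convergent integral for almost every [s] only, which is enough under
   the outer integral. *)
have iconv := ae_integrable_ker mpsi psi0 psid fi.
apply: ae_eq_integral => //.
- apply/measurable_EFinP/measurable_funM => //.
  exact: (measurable_conv mpsi psi0 psid).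
- exact: measurable_fubini_F iF.
have FF := @ae_filter_ringOfSetsType _ (measurableTypeR R) R mu.
move: iconv; apply: (@filterS _ _ FF) => s is_ _; rewrite /F/=.
under [RHS]eq_integral do rewrite -mulrA EFinM.
rewrite integralZl// EFinM; congr (_ * _)%E.
by rewrite /conv /Rintegral fineK//; exact: integrable_fin_num.
Qed.

End composition.

Definition pw (a u : R) : R := u `^ (a - 1).

Lemma measurable_pw a : measurable_fun setT (pw a).
Proof. exact: measurable_powR. Qed.

Lemma pw_ge0 a u : 0 <= pw a u.
Proof. exact: powR_ge0. Qed.

Lemma integral_pw a : 0 < a ->
  (\int[mu]_(u in `]0%R, 1%R]) (pw a u)%:E = (a^-1)%:E)%E.
Proof.
move=> a0; rewrite integral_itv_obnd_cbnd; last first.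
  by apply/measurable_EFinP/measurable_funTS; exact: measurable_pw.
by rewrite integral_powR// powR1 mul1r.
Qed.

Lemma integrable_pw a : 0 < a -> mu.-integrable `]0, 1] (EFin \o pw a).
Proof.
move=> a0; apply/integrableP; split.
  by apply/measurable_EFinP/measurable_funTS; exact: measurable_pw.
apply: (@le_lt_trans _ _ (a^-1)%:E); last exact: ltry.
rewrite -integral_pw// le_eqVlt; apply/orP; left; apply/eqP.
by apply: eq_integral => u _ /=; rewrite ger0_norm ?pw_ge0.
Qed.

Lemma integral_ker_mul (phi psi : R -> R) (a t y : R) : 0 < a ->
  measurable_fun setT phi -> measurable_fun setT psi ->
  (0 <= t < y -> y <= 1 -> (\int[mu]_(s in `[t, y]) (phi (y - s) * psi (s - t))%:E =
     ((y - t) `^ a / a)%:E)%E) ->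
  (\int[mu]_s (ker phi (y, s) * ker psi (s, t))%:E =
   (a^-1 * ker (pw (a + 1)) (y, t))%:E)%E.
Proof.
move=> a0 mphi mpsi H; rewrite [in RHS]/ker/=; case: ifPn => [/andP[ty y1]|nty].
  rewrite /pw addrK mulrC -H//.
  rewrite [RHS]integral_itv_bndoo; last first.
    apply/measurable_EFinP/measurable_funTS/measurable_funM.
      by apply: (measurableT_comp mphi); exact: measurable_funB.
    by apply: (measurableT_comp mpsi); exact: measurable_funB.
  rewrite [RHS]integral_mkcond; apply: eq_integral => s _.
  rewrite patchE mem_setE in_itv/= /ker/= y1 andbT.
  case/andP: ty => t0 ty; rewrite t0/=.
  have [ts|st] := ltP t s; last by rewrite mulr0.
  have [sy|ys] := ltP s y; last by rewrite andbF mul0r.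
  by rewrite (le_trans t0 (ltW ts)) (le_trans (ltW sy) y1).
rewrite mulr0 integral0_eq// => s _; rewrite /ker/=.
case: ifPn => [/andP[/andP[s0 sy] y1]|_]; last by rewrite mul0r.
case: ifPn => [/andP[/andP[t0 ts] s1]|_]; last by rewrite mulr0.
by move: nty; rewrite t0 y1 (lt_trans ts sy).
Qed.

Lemma ker_pw_le1 (a : R) z : 0 < a -> 0 <= ker (pw (a + 1)) z <= 1.
Proof.
move=> a0; rewrite ker_ge0 /=; last by move=> u _; exact: pw_ge0.
rewrite /ker; case: ifPn => [/andP[/andP[t0 ty] y1]|//]; rewrite /pw addrK.
have : (z.1 - z.2) `^ a <= 1 `^ a.
  by apply: ge0_ler_powR; rewrite ?nnegrE ?(ltW a0)//; lra.
by rewrite powR1.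
Qed.

(** Covers the composition of [pw a] with [pw 1] in either order. The composed kernel has exponent
    [a > 0], so it is bounded even where [pw a] is not, as [conv_conv] requires. *)
Lemma conv_pw_pw1 (phi psi f : R -> R) (a d y : R) : 0 < a ->
  measurable_fun setT phi -> (forall u, 0 <= phi u) ->
  measurable_fun setT psi -> (forall u, 0 <= psi u) ->
  (\int[mu]_(u in `]0%R, 1%R]) (psi u)%:E <= d%:E)%E ->
  (forall t, 0 <= t < y -> y <= 1 ->
    (\int[mu]_(s in `[t, y]) (phi (y - s) * psi (s - t))%:E =
     ((y - t) `^ a / a)%:E)%E) ->
  mu.-integrable setT (EFin \o f) ->
  conv phi (conv psi f) y = a^-1 * conv (pw (a + 1)) f y.
Proof.
move=> a0 mphi phi0 mpsi psi0 psid H fi.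
rewrite (@conv_conv _ _ d a^-1 _ (fun t => a^-1 * ker (pw (a + 1)) (y, t)))//; last first.
- by move=> t; case/andP: (ker_pw_le1 (y, t) a0) => *; rewrite ler_piMr// invr_ge0 ltW.
- by move=> t; apply: integral_ker_mul => //; exact: H.
rewrite /conv /Rintegral; under eq_integral do rewrite -mulrA EFinM.
have [ki|nki] := pselect (mu.-integrable setT (fun t => (ker (pw (a + 1)) (y, t) * f t)%:E)).
  rewrite integralZl// fineM//; exact: integrable_fin_num.
exfalso; apply: nki.
have /integrableP[/measurable_EFinP mf _] := fi.
apply: (le_integrable measurableT _ _ fi).
  by apply/measurable_EFinP; apply: measurable_ker_mul => //; exact: measurable_pw.
move=> t _ /=; rewrite lee_fin normrM ler_piMl//.
by case/andP: (ker_pw_le1 (y, t) a0) => k0 k1; rewrite ger0_norm.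
Qed.

End convolution_composition.

(** * Fractional integrals of real functions, without the Gamma factor *)

Section fractional_real.
Context {R : realType}.
Local Notation mu := (@lebesgue_measure R).
Local Notation T := (measurableTypeR R).
Implicit Types (f : R -> R) (a b x y : R).

Lemma integral_pw_le a : 0 < a ->
  (\int[mu]_(u in `]0%R, 1%R]) (pw a u)%:E <= (a^-1)%:E)%E.
Proof. by move=> a0; rewrite integral_pw. Qed.

Lemma in_I01 x : (x \in (I01 : set R)) = (0 <= x <= 1).
Proof. by rewrite mem_setE in_itv. Qed.

Lemma conv_restrictE a f x : 0 <= x <= 1 -> measurable_fun (I01 : set R) f ->
  conv (pw a) (f \_ I01) x = \int[mu]_(t in `[0, x]) ((x - t) `^ (a - 1) * f t).
Proof.
move=> /andP[x0 x1] mf; rewrite /conv /Rintegral; congr fine.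
rewrite -integral_itv_bndo_bndc; last first.
  apply/measurable_EFinP; apply: measurable_funM.
    apply: measurable_funTS; apply: (measurableT_comp (measurable_powR _)).
    exact: measurable_funB.
  apply: (measurable_funS _ _ mf) => //; first exact: measurable_itv.
  move=> t; rewrite /= !in_itv/= => /andP[t0 tx].
  by rewrite /I01/= in_itv/= t0 (le_trans (ltW tx)).
rewrite [RHS]integral_mkcond; apply: eq_integral => t _.
rewrite !patchE in_I01 mem_setE in_itv/= /ker/= x1 andbT.
case: ifPn => [/andP[t0 tx]|_]; last by rewrite mul0r.
by rewrite t0 (le_trans (ltW tx) x1).
Qed.

Lemma conv_pw1_comp a f y : 0 < a -> mu.-integrable setT (EFin \o f) ->
  conv (pw 1) (conv (pw a) f) y = a^-1 * conv (pw (a + 1)) f y.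
Proof.
move=> a0 fi; apply: (@conv_pw_pw1 _ _ _ _ _ a^-1) => //; try exact: measurable_pw;
  try exact: pw_ge0.
- by rewrite integral_pw.
move=> t /andP[t0 ty] y1.
rewrite -integral_powRBl ?(ltW ty)//; apply: eq_integral => s _.
by rewrite /pw subrr powRr0 mul1r.
Qed.

Lemma conv_comp_pw1 a f y : 0 < a -> mu.-integrable setT (EFin \o f) ->
  conv (pw a) (conv (pw 1) f) y = a^-1 * conv (pw (a + 1)) f y.
Proof.
move=> a0 fi; apply: (@conv_pw_pw1 _ _ _ _ _ 1^-1) => //; try exact: measurable_pw;
  try exact: pw_ge0.
- by rewrite integral_pw.
move=> t /andP[t0 ty] y1.
rewrite -integral_powRBr ?(ltW ty)//; apply: eq_integral => s _.
by rewrite /pw subrr powRr0 mulr1.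
Qed.

Lemma conv_powR a b x : 0 < a -> 0 <= b -> 0 <= x <= 1 ->
  conv (pw a) ((fun t => t `^ b) \_ I01) x =
  Gamma a * Gamma (b + 1) / Gamma (a + b + 1) * x `^ (a + b).
Proof.
move=> a0 b0 xI; rewrite conv_restrictE//; last first.
  by apply: measurable_funTS; exact: measurable_powR.
rewrite /Rintegral integral_beta//.
by case/andP: xI.
Qed.

(* For [a <= b] this is nonnegative on ]0, 1], with integral [1/a - 1/b] there:
   Schur's test then bounds the norm of the difference of the two convolutions. *)
Definition pwB a b (u : R) : R := if u <= 1 then pw a u - pw b u else 0.

Lemma pwB_ge0 a b u : a <= b -> 0 < u <= 1 -> 0 <= pwB a b u.
Proof.
move=> ab u01; rewrite /pwB; case: ifPn => // _; rewrite subr_ge0 /pw.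
by apply: ger_powR => //; rewrite lerD2r.
Qed.

Lemma measurable_pwB a b : measurable_fun setT (pwB a b).
Proof.
apply: measurable_fun_ifT; last exact: measurable_cst.
- exact: measurable_fun_ler.
- by apply: measurable_funB; exact: measurable_pw.
Qed.

Lemma integral_pwB_le a b : 0 < a -> 0 < b ->
  (\int[mu]_(u in `]0%R, 1%R]) (pwB a b u)%:E <= (a^-1 - b^-1)%:E)%E.
Proof.
move=> a0 b0; rewrite EFinB -(integral_pw a0) -(integral_pw b0).
rewrite -integralB//; [|exact: integrable_pw..].
rewrite le_eqVlt; apply/orP; left; apply/eqP; apply: eq_integral => u.
by rewrite inE/= in_itv/= /pwB => /andP[_ ->].
Qed.

Lemma conv_pwB a b f x :
  mu.-integrable setT (fun t => (ker (pw a) (x, t) * f t)%:E) ->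
  mu.-integrable setT (fun t => (ker (pw b) (x, t) * f t)%:E) ->
  conv (pwB a b) f x = conv (pw a) f x - conv (pw b) f x.
Proof.
move=> ia ib; rewrite /conv -RintegralB//; apply: eq_Rintegral => t _.
rewrite -mulrBl; congr (_ * _); rewrite /ker/=.
case: ifPn => [/andP[/andP[t0 tx] x1]|_]; last by rewrite subrr.
by rewrite /pwB ifT//; lra.
Qed.

Lemma conv_lin phi c f g x :
  mu.-integrable setT (fun t => (ker phi (x, t) * f t)%:E) ->
  mu.-integrable setT (fun t => (ker phi (x, t) * g t)%:E) ->
  conv phi (fun t => c * f t + g t) x = c * conv phi f x + conv phi g x.
Proof.
move=> fi gi; rewrite /conv -RintegralZl// -RintegralD//; last first.
  rewrite (_ : _ \o _ = (fun t => c%:E * (ker phi (x, t) * f t)%:E)%E)//.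
  exact: integrableZl.
by apply: eq_Rintegral => t _; ring.
Qed.

Lemma eq_conv phi f g x : measurable_fun setT phi ->
  measurable_fun setT f -> measurable_fun setT g ->
  ae_eq mu setT f g -> conv phi f x = conv phi g x.
Proof.
move=> mphi mf mg fg; rewrite /conv /Rintegral; congr fine.
apply: ae_eq_integral => //.
- by apply/measurable_EFinP; exact: measurable_ker_mul.
- by apply/measurable_EFinP; exact: measurable_ker_mul.
have FF := @ae_filter_ringOfSetsType _ (measurableTypeR R) R mu.
by move: fg; apply: (@filterS _ _ FF) => t + _ => /(_ I) ->.
Qed.

End fractional_real.

(** * Complex-valued functions and the spaces [E] *)

Section complex_parts.
Context {R : realType}.
Local Notation mu := (@lebesgue_measure R).
Local Notation T := (measurableTypeR R).
Local Notation C := (R[i]^o).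

Lemma normc_ge_ReN (z : R[i]) : `|complex.Re z| <= normc z.
Proof.
by case: z => u v /=; rewrite -sqrtr_sqr ler_wsqrtr// lerDl sqr_ge0.
Qed.

Lemma normc_ge_ImN (z : R[i]) : `|complex.Im z| <= normc z.
Proof.
by case: z => u v /=; rewrite -sqrtr_sqr ler_wsqrtr// lerDr sqr_ge0.
Qed.

Lemma normc_le_parts (z : R[i]) : normc z <= `|complex.Re z| + `|complex.Im z|.
Proof.
case: z => u v /=; rewrite -[leRHS]ger0_norm ?addr_ge0// -sqrtr_sqr ler_wsqrtr//.
have := mulr_ge0 (normr_ge0 u) (normr_ge0 v).
by rewrite sqrrD !real_normK ?num_real// mulr2n => h; lra.
Qed.

Lemma within_continuousC (A : set R) (f : R -> C) :
  {within A, continuous f} <-> forall x e : R, A x -> 0 < e ->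
    exists2 d : R, 0 < d & forall y : R, A y -> `|x - y| < d -> normc (f x - f y) < e.
Proof.
split=> [/subspace_continuousP cf x e Ax e0|H].
  have eC : 0 < e%:C by rewrite ltcR.
  have /cvgrPdist_lt/(_ _ eC) := cf _ Ax.
  move=> [d /= d0 Hd]; exists d => // y Ay xy.
  by rewrite -ltcR -Defs.normcE; exact: Hd.
apply/subspace_continuousP => x Ax; apply/cvgrPdist_lt => e e0.
have [er e0'] : e = (complex.Re e)%:C /\ 0 < complex.Re e.
  by move: e0; case: e => u v; rewrite ltcE/= => /andP[/eqP v0 u0]; subst v.
have [d d0 Hd] := H x _ Ax e0'.
exists d => //= y xy Ay; rewrite er Defs.normcE ltcR; exact: Hd.
Qed.

Lemma within_continuous_parts (A : set R) (f : R -> C) :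
  {within A, continuous f} <-> {within A, continuous (fun x => complex.Re (f x))} /\
    {within A, continuous (fun x => complex.Im (f x))}.
Proof.
split=> [/within_continuousC cf|[/within_continuousP cr /within_continuousP ci]].
  split; apply/within_continuousP => x e Ax e0; have [d d0 Hd] := cf x e Ax e0;
    exists d => // y Ay /(Hd y Ay); apply: le_lt_trans.
    by rewrite -raddfB normc_ge_ReN.
  by rewrite -raddfB normc_ge_ImN.
apply/within_continuousC => x e Ax e0.
have e2 : 0 < e / 2 by rewrite divr_gt0.
have [d d0 Hd] := cr x _ Ax e2; have [d' d0' Hd'] := ci x _ Ax e2.
exists (Num.min d d'); first by rewrite lt_min d0.
move=> y Ay; rewrite lt_min => /andP[/(Hd y Ay) h1 /(Hd' y Ay) h2].
apply: le_lt_trans (normc_le_parts _) _; rewrite !raddfB/=.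
by rewrite (splitr e) ltrD.
Qed.

Definition rpart (f : R -> C) : R -> R := (fun x => complex.Re (f x)) \_ I01.
Definition ipart (f : R -> C) : R -> R := (fun x => complex.Im (f x)) \_ I01.

Lemma rpart_le f x : `|rpart f x| <= cmod_fun f x.
Proof. by rewrite /rpart patchE cmod_funE; case: ifP; rewrite ?normr0// normc_ge_ReN. Qed.

Lemma ipart_le f x : `|ipart f x| <= cmod_fun f x.
Proof. by rewrite /ipart patchE cmod_funE; case: ifP; rewrite ?normr0// normc_ge_ImN. Qed.

Lemma cmod_le_parts f x : cmod_fun f x <= `|rpart f x| + `|ipart f x|.
Proof.
rewrite /rpart /ipart !patchE cmod_funE; case: ifP; rewrite ?normr0 ?addr0//.
by move=> _; exact: normc_le_parts.
Qed.

Let mI : measurable (I01 : set R). Proof. exact: measurable_itv. Qed.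

Lemma measurable_parts (E : fspace R) f : carrier_def E f ->
  measurable_fun (I01 : set R) (fun x => complex.Re (f x)) /\
  measurable_fun (I01 : set R) (fun x => complex.Im (f x)).
Proof.
case: E => [|p p1] /=; last by case.
move=> /within_continuous_parts[cr ci].
by split; apply: subspace_continuous_measurable_fun.
Qed.

Lemma measurable_rpart (E : fspace R) f : carrier_def E f -> measurable_fun [set: R] (rpart f).
Proof. by move=> /measurable_parts[mr _]; apply/(measurable_restrictT _ _).1. Qed.

Lemma measurable_ipart (E : fspace R) f : carrier_def E f -> measurable_fun [set: R] (ipart f).
Proof. by move=> /measurable_parts[_ mi]; apply/(measurable_restrictT _ _).1. Qed.

Lemma measurable_cmod (E : fspace R) f : carrier_def E f -> measurable_fun [set: R] (cmod_fun f).
Proof. by move=> /measurable_parts[mr mi]; exact: measurable_cmod_fun. Qed.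

Lemma C01_le (f : R -> C) : carrier_def (@C01 R) f -> exists2 M : R, 0 <= M & forall x, cmod_fun f x <= M.
Proof.
move=> /C01_bounded[M HM]; exists `|M|; first exact: normr_ge0.
move=> x; rewrite cmod_funE; case: ifPn => [/set_mem xI|_]; last exact: normr_ge0.
by apply: le_trans (ler_norm M); apply: HM; exists x.
Qed.

Lemma mu_I01 : (mu I01 = 1%:E)%E.
Proof. by rewrite /I01 lebesgue_measure_itv/= lte_fin ltr01 sube0. Qed.

Lemma Lnorm_bounded (p M : R) (g : R -> R) : 1 <= p -> 0 <= M ->
  measurable_fun [set: R] g -> (forall x, 0 <= g x <= M) ->
  (forall x, x \notin I01 -> g x = 0) ->
  ('N[mu]_p%:E[EFin \o g] <= M%:E)%E.
Proof.
move=> p1 M0 mg gM g0; have p0 : 0 < p by lra.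
have pn0 : p != 0 by rewrite lt0r_neq0.
rewrite unlock.
have -> : M%:E = ((M `^ p)%:E `^ p^-1)%E.
  by rewrite poweR_EFin -powRrM mulfV// powRr1.
apply: gt0_ler_poweR; rewrite ?invr_ge0 ?(ltW p0)// ?in_itv/= ?leey ?andbT ?lee_fin ?powR_ge0//.
  by apply: integral_ge0 => x _; rewrite lee_fin powR_ge0.
apply: (@le_trans _ _ (\int[mu]_(x in I01) (cst (M `^ p)%:E x))%E); last first.
  by rewrite integral_cst// [X in (_ * X)%E](mu_I01) mule1.
rewrite [leRHS]integral_mkcond.
apply: ge0_le_integral => //.
- have mabs : measurable_fun [set: R] (fun x => `|g x|) by exact: measurableT_comp.
  by apply/measurable_EFinP; exact: (measurableT_comp (measurable_powR _) mabs).
- by apply/(measurable_restrictT _ _).1.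
move=> x _; rewrite /= patchE; case: ifPn => [_|/g0 ->]; last by rewrite normr0 powR0.
case/andP: (gM x) => h1 h2; rewrite lee_fin ger0_norm//.
by apply: ge0_ler_powR => //; exact: ltW.
Qed.

Lemma C01_carrier (E : fspace R) f : carrier_def (@C01 R) f -> carrier_def E f.
Proof.
case: E => [//|p p1] cf; have [mr mi] := measurable_parts cf.
split => //; have [M M0 HM] := C01_le cf.
apply: le_lt_trans (ltry M); apply: Lnorm_bounded => //.
- exact: measurable_cmod cf.
- by move=> x; rewrite cmod_fun_ge0 HM.
- by move=> x xI; rewrite cmod_funE (negbTE xI).
Qed.

Lemma seminorm_le (E : fspace R) f (M : R) : carrier_def E f -> 0 <= M ->
  (forall x, x \in I01 -> normc (f x) <= M) -> seminorm E f <= M.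
Proof.
move=> cf M0 fM; case: E cf => [|p p1] cf /=.
  apply: ge_sup; first by exists (normc (f 0)), 0 => //; exact: I01_0.
  by move=> _ [x xI <-]; apply: fM; exact/mem_set.
have H : ('N[mu]_p%:E[EFin \o cmod_fun f] <= M%:E)%E.
  apply: Lnorm_bounded => //.
  - exact: measurable_cmod cf.
  - by move=> x; rewrite cmod_fun_ge0 cmod_funE; case: ifP => // /fM.
  - by move=> x xI; rewrite cmod_funE (negbTE xI).
rewrite -lee_fin fineK// ge0_fin_numE ?Lnorm_ge0//.
exact: le_lt_trans H (ltry _).
Qed.

(** On [0, 1], which has measure 1, [|g| <= 1 + |g| ^ p]; so every [E] lies in L^1, the generality
    in which convolutions are treated. *)
Lemma integrable_cmod (E : fspace R) f : carrier_def E f ->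
  mu.-integrable [set: T] (EFin \o cmod_fun f).
Proof.
suff H (p : R) (p1 : 1 <= p) g : carrier_def (L01 p1) g ->
    mu.-integrable [set: T] (EFin \o cmod_fun g).
  by case: E => [/(C01_carrier (L01 (lexx 1)))|p p1]; exact: H.
move=> cf; have mc := measurable_cmod cf.
have p0 : 0 < p by lra.
have [_ _ fin_f] := cf.
have mcp : measurable_fun [set: T] (fun x => (`|(EFin \o cmod_fun g) x| `^ p)%E).
  apply: (measurableT_comp (measurable_poweR _)) => //.
  by apply: measurableT_comp => //; exact/measurable_EFinP.
have m1 : measurable_fun [set: T] ((cst 1%:E : R -> \bar R) \_ I01).
  by apply/(measurable_restrictT _ _).1.
apply/integrableP; split; first exact/measurable_EFinP.
apply: (@le_lt_trans _ _ (\int[mu]_x (((cst 1%:E : R -> \bar R) \_ I01) x +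
    `|(EFin \o cmod_fun g) x| `^ p))%E).
  apply: ge0_le_integral => //.
  - by apply: measurableT_comp => //; exact/measurable_EFinP.
  - exact: emeasurable_funD.
  move=> x _ /=; rewrite patchE; case: ifPn => [_|xI]; last first.
    by rewrite cmod_funE (negbTE xI) normr0 add0e lee_fin powR_ge0.
  rewrite /cst -EFinD lee_fin ger0_norm ?cmod_fun_ge0//.
  have [h|h] := leP (cmod_fun g x) 1; first by rewrite ler_wpDr// powR_ge0.
  by rewrite ler_wpDl//; apply: le1r_powR => //; exact: ltW.
rewrite ge0_integralD//; last 2 first.
- by move=> x _; apply: erestrict_ge0 => y _; rewrite lee_fin.
- by move=> x _; exact: poweR_ge0.
rewrite -integral_mkcond integral_cst// [X in (_ * X)%E](mu_I01) mule1.
rewrite -(poweR_Lnorm mu _ (lt0r_neq0 p0)).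
by apply: lte_add_pinfty; [exact: ltry|exact: poweR_lty].
Qed.

Lemma integrable_rpart (E : fspace R) f : carrier_def E f ->
  mu.-integrable [set: T] (EFin \o rpart f).
Proof.
move=> cf; apply: (le_integrable measurableT _ _ (integrable_cmod cf)).
  by apply/measurable_EFinP; exact: measurable_rpart cf.
by move=> x _; rewrite /= lee_fin (ger0_norm (cmod_fun_ge0 _ _)) rpart_le.
Qed.

Lemma integrable_ipart (E : fspace R) f : carrier_def E f ->
  mu.-integrable [set: T] (EFin \o ipart f).
Proof.
move=> cf; apply: (le_integrable measurableT _ _ (integrable_cmod cf)).
  by apply/measurable_EFinP; exact: measurable_ipart cf.
by move=> x _; rewrite /= lee_fin (ger0_norm (cmod_fun_ge0 _ _)) ipart_le.
Qed.

(** If the values differ at [x], continuity makes the functions differ on an interval with endpoint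
    [x], of positive measure. It is placed on the right or on the left of [x] so as to stay inside
    [0, 1]. *)
Lemma continuous_ae_eq (f g : R -> C) :
  {within I01, continuous f} -> {within I01, continuous g} ->
  ae_eq mu I01 f g -> {in I01, f =1 g}.
Proof.
move=> /within_continuousC cf /within_continuousC cg [N [mN N0 HN]] x.
rewrite in_I01 => /andP[x0 x1].
apply/eqP; rewrite -subr_eq0; apply/negP => /negP fg.
pose e := normc (f x - g x) / 2.
have e0 : 0 < e.
  rewrite divr_gt0// lt_neqAle normc_ge0 andbT eq_sym.
  by apply: contra fg => /eqP/eq0_normc ->.
have xI : (I01 : set R) x by rewrite /I01/= in_itv/= x0.
have [d d0 Hd] := cf x e xI e0; have [d' d0' Hd'] := cg x e xI e0.
pose r := Num.min (Num.min d d') 1.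
have r0 : 0 < r by rewrite !lt_min d0 d0' ltr01.
have rd : r <= d by rewrite /r !ge_min lexx.
have rd' : r <= d' by rewrite /r !ge_min lexx orbT.
have r1 : r <= 1 by rewrite /r ge_min lexx orbT.
have sub (u v : R) : 0 <= u -> u < v -> v <= 1 -> (forall y, u < y < v -> `|x - y| < r) -> False.
  move=> u0 uv v1 Hy.
  have : (mu `]u, v[ = 0)%E.
    have mJ : measurable (`]u, v[ : set T) by exact: measurable_itv.
    apply: (subset_measure0 mJ mN _ N0).
    move=> y yuv; apply: HN => /= Hfg.
    move: (yuv); rewrite /= in_itv/= => uyv; case/andP: (uyv) => uy yv.
    have yI : (I01 : set R) y by rewrite /I01/= in_itv/=; apply/andP; split; lra.
    have h := Hy y uyv.
    have h1 := Hd y yI (lt_le_trans h rd); have h2 := Hd' y yI (lt_le_trans h rd').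
    have : normc (f x - g x) < e + e.
      have -> : f x - g x = (f x - f y) - (g x - g y) by rewrite (Hfg yI) opprB addrA subrK.
      apply: le_lt_trans (le_normcD _ _) _; rewrite normcN; exact: ltrD.
    by rewrite /e -splitr ltxx.
  by rewrite lebesgue_measure_itv/= lte_fin uv -EFinB => -[]; lra.
have [xh|hx] := leP x (1 / 2).
  apply: (@sub x (x + r / 2)) => //; [lra|lra|].
  by move=> y /andP[xy yx]; rewrite ltr_norml; apply/andP; split; lra.
apply: (@sub (x - r / 2) x) => //; [lra|lra|].
by move=> y /andP[xy yx]; rewrite ltr_norml; apply/andP; split; lra.
Qed.

(** Lets one almost-everywhere argument serve both kinds of space: in C[0, 1] the representatives
    are continuous. *)
Lemma same_ae (E : fspace R) f g : carrier_def E f -> carrier_def E g ->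
  ae_eq mu I01 f g -> same E f g.
Proof. by case: E => [|p p1] cf cg h; [exact: continuous_ae_eq|exact: h]. Qed.

Lemma ae_same (E : fspace R) f g : same E f g -> ae_eq mu I01 f g.
Proof.
by case: E => [|p p1] //= fg; apply: aeW => x xI; apply: fg; exact/mem_set.
Qed.

End complex_parts.

(** * Convolution of complex-valued functions *)

Section complex_convolution.
Context {R : realType}.
Local Notation mu := (@lebesgue_measure R).
Local Notation T := (measurableTypeR R).
Local Notation C := (R[i]^o).
Implicit Types (E : fspace R) (f g : R -> C).

Definition cconv (phi : R -> R) f : R -> C :=
  fun x => conv phi (rpart f) x +i* conv phi (ipart f) x.

Lemma conv_out phi (f : R -> R) x : x \notin I01 -> conv phi f x = 0.
Proof.
rewrite in_I01 => xI; rewrite /conv; under eq_Rintegral.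
  move=> t _; rewrite /ker/= ifF ?mul0r; first over.
  by apply/negP => /andP[/andP[t0 tx] x1]; move/negP: xI; apply; lra.
by rewrite Rintegral_cst// mul0r.
Qed.

Lemma rpart_cconv phi f : rpart (cconv phi f) = conv phi (rpart f).
Proof.
by apply/funext => x; rewrite {1}/rpart patchE; case: ifPn => // /conv_out ->.
Qed.

Lemma ipart_cconv phi f : ipart (cconv phi f) = conv phi (ipart f).
Proof.
by apply/funext => x; rewrite {1}/ipart patchE; case: ifPn => // /conv_out ->.
Qed.

Lemma RLintE E a f x : carrier_def E f -> x \in I01 ->
  RLint a f x = ((Gamma a)^-1)%:C * cconv (pw a) f x.
Proof.
move=> /measurable_parts[mr mi]; rewrite in_I01 => xI.
rewrite /RLint /cintegral /cconv !conv_restrictE//.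
congr (_ * (_ +i* _)); apply: eq_Rintegral => t _.
  by case: (f t) => u v /=; rewrite mul0r subr0.
by case: (f t) => u v /=; rewrite mul0r addr0.
Qed.

Lemma integrable_ker_lin phi (c : R) (f g : R -> R) x :
  mu.-integrable setT (fun t => (ker phi (x, t) * f t)%:E) ->
  mu.-integrable setT (fun t => (ker phi (x, t) * g t)%:E) ->
  mu.-integrable setT (fun t => (ker phi (x, t) * (c * f t + g t))%:E).
Proof.
move=> fi gi.
rewrite (_ : (fun t => _) = (fun t => c%:E * (ker phi (x, t) * f t)%:E +
    (ker phi (x, t) * g t)%:E)%E); last first.
  by apply/funext => t; rewrite -EFinM -EFinD; congr EFin; ring.
by apply: integrableD => //; exact: integrableZl.
Qed.

Lemma rpart_lin (a : C) f g : rpart (a *: f + g) = fun t =>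
  complex.Re a * rpart f t + (- complex.Im a * ipart f t + rpart g t).
Proof.
apply/funext => t; rewrite /rpart /ipart !patchE; case: ifPn => _; last by rewrite !mulr0 !addr0.
by rewrite !fctE; case: a (f t) (g t) => ar ai [u v] [u' v'] /=; ring.
Qed.

Lemma ipart_lin (a : C) f g : ipart (a *: f + g) = fun t =>
  complex.Re a * ipart f t + (complex.Im a * rpart f t + ipart g t).
Proof.
apply/funext => t; rewrite /rpart /ipart !patchE; case: ifPn => _; last by rewrite !mulr0 !addr0.
by rewrite !fctE; case: a (f t) (g t) => ar ai [u v] [u' v'] /=; ring.
Qed.

Lemma cconv_lin phi (a : C) f g x :
  mu.-integrable setT (fun t => (ker phi (x, t) * rpart f t)%:E) ->
  mu.-integrable setT (fun t => (ker phi (x, t) * ipart f t)%:E) ->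
  mu.-integrable setT (fun t => (ker phi (x, t) * rpart g t)%:E) ->
  mu.-integrable setT (fun t => (ker phi (x, t) * ipart g t)%:E) ->
  cconv phi (a *: f + g) x = a * cconv phi f x + cconv phi g x.
Proof.
move=> rf jf rg jg; rewrite /cconv rpart_lin ipart_lin.
rewrite !conv_lin//; try exact: integrable_ker_lin.
by case: a => ar ai; apply/eqP; rewrite eq_complex/=; apply/andP; split; apply/eqP; ring.
Qed.

Section profile.
Variables (phi : R -> R) (c : R).
Hypothesis mphi : measurable_fun setT phi.
Hypothesis phi0 : forall u, 0 < u <= 1 -> 0 <= phi u.
Hypothesis phic : (\int[mu]_(u in `]0%R, 1%R]) (phi u)%:E <= c%:E)%E.

Let c0 : 0 <= c. Proof. exact: ker_bound_ge0 mphi phi0 phic. Qed.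

Let iphi : mu.-integrable `]0, 1] (EFin \o phi).
Proof.
apply/integrableP; split; first exact/measurable_EFinP/measurable_funTS.
apply: le_lt_trans (ltry c); apply: le_trans phic.
rewrite le_eqVlt; apply/orP; left; apply/eqP; apply: eq_integral => u.
by rewrite inE/= in_itv/= => u01; rewrite ger0_norm// phi0.
Qed.

Lemma continuous_conv_parts f (h : R -> R) : {within I01, continuous h} ->
  {within I01, continuous (conv phi (h \_ I01))}.
Proof.
move=> ch; apply: continuous_conv => //.
  apply/within_continuousP => x e xI e0.
  have [d d0 Hd] := (within_continuousP _ _).1 ch x e xI e0.
  exists d => // y yI xy; rewrite !patchE (mem_set xI) (mem_set yI); exact: Hd.
by move=> x xI; rewrite patchE in_I01; case: ifPn => //; move: xI; rewrite in_itv/= => /negP.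
Qed.

(** The real and the imaginary part of the convolution are each bounded by the convolution of [|f|];
    hence the factor 2, and Schur's test for twice the kernel. *)
Lemma Lnorm_cconv (p : R) (p1 : 1 <= p) f : carrier_def (L01 p1) f ->
  ('N[mu]_p%:E[EFin \o cmod_fun (cconv phi f)] <=
   (2 * c)%:E * 'N[mu]_p%:E[EFin \o cmod_fun f])%E.
Proof.
move=> cf; have ir := integrable_rpart cf; have ii := integrable_ipart cf.
have mr := measurable_rpart cf; have mi := measurable_ipart cf.
have mker : measurable_fun setT (ker phi) by exact: measurable_ker.
have k0 z : 0 <= ker phi z by exact: ker_ge0.
have m2k (x : R) : measurable_fun [set: T] (fun t => (ker phi (x, t))%:E).
  by apply/measurable_EFinP; apply: measurableT_comp.
have m1k (t : R) : measurable_fun [set: T] (fun x => (ker phi (x, t))%:E).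
  by apply/measurable_EFinP; apply: measurableT_comp.
have mc := measurable_cmod cf.
apply: (schur_test (k := fun z => 2 * ker phi z)) => //.
- by rewrite mulr_ge0.
- exact: measurable_funM.
- apply: measurable_cmod_fun; apply: measurable_funTS => /=.
    exact: (measurable_conv mphi phi0 phic ir).
  exact: (measurable_conv mphi phi0 phic ii).
- by move=> z; rewrite mulr_ge0.
- by move=> t; exact: cmod_fun_ge0.
- move=> x; under eq_integral do rewrite EFinM.
  rewrite ge0_integralZl_EFin//; last by move=> t _; rewrite lee_fin.
  by rewrite EFinM lee_wpmul2l ?lee_fin//; exact: integral_ker_le2.
- move=> t; under eq_integral do rewrite EFinM.
  rewrite ge0_integralZl_EFin//; last by move=> x _; rewrite lee_fin.
  by rewrite EFinM lee_wpmul2l ?lee_fin//; exact: integral_ker_le1.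
move=> x; rewrite ger0_norm ?cmod_fun_ge0//.
have mkc : measurable_fun [set: T] (fun t => (ker phi (x, t) * cmod_fun f t)%:E).
  by apply/measurable_EFinP; exact: (measurable_ker_mul mphi x mc).
have H (h : R -> R) : measurable_fun [set: R] h -> (forall t, `|h t| <= cmod_fun f t) ->
    (`|conv phi h x|%:E <= \int[mu]_t (ker phi (x, t) * cmod_fun f t)%:E)%E.
  move=> mh hc; apply: le_trans (conv_abs_le mphi phi0 x mh) _.
  apply: ge0_le_integral => //.
  - by move=> t _; rewrite lee_fin mulr_ge0.
  - have mabs : measurable_fun [set: R] (fun t => `|h t|) by exact: measurableT_comp.
    by apply/measurable_EFinP; exact: (measurable_ker_mul mphi x mabs).
  by move=> t _; rewrite lee_fin ler_wpM2l.
apply: (@le_trans _ _ (`|conv phi (rpart f) x| + `|conv phi (ipart f) x|)%:E).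
  by rewrite lee_fin; have := cmod_le_parts (cconv phi f) x; rewrite rpart_cconv ipart_cconv.
under eq_integral do rewrite -mulrA EFinM.
rewrite ge0_integralZl_EFin//; last first.
  by move=> t _; rewrite lee_fin mulr_ge0// cmod_fun_ge0.
have -> : (2%:E = 1%:E + 1%:E :> \bar R)%E by rewrite -EFinD.
rewrite EFinD ge0_muleDl// !mul1e.
by apply: leeD; apply: H => // t; [exact: rpart_le|exact: ipart_le].
Qed.

Lemma carrier_cconv E f : carrier_def E f -> carrier_def E (cconv phi f).
Proof.
case: E => [|p p1] cf /=.
  have /within_continuous_parts[cr ci] := cf.
  by apply/within_continuous_parts; split; exact: continuous_conv_parts.
split.
- by apply: measurable_funTS; exact: (measurable_conv mphi phi0 phic (integrable_rpart cf)).
- by apply: measurable_funTS; exact: (measurable_conv mphi phi0 phic (integrable_ipart cf)).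
apply: le_lt_trans (Lnorm_cconv cf) _.
by have [_ _ h] := cf; rewrite lte_mul_pinfty// ?lee_fin ?mulr_ge0.
Qed.

Lemma seminorm_cconv E f : carrier_def E f ->
  seminorm E (cconv phi f) <= 2 * c * seminorm E f.
Proof.
case: E => [|p p1] cf; last first.
  have [_ _ h] := cf; have [_ _ h'] := carrier_cconv cf.
  rewrite /seminorm -lee_fin EFinM !fineK ?ge0_fin_numE ?Lnorm_ge0//.
  exact: Lnorm_cconv.
have Mf x : x \in I01 -> normc (f x) <= seminorm C01 f.
  by move=> /set_mem xI; apply: ub_le_sup; [exact: C01_bounded|exists x].
have M0 : 0 <= seminorm C01 f.
  by apply: le_trans (Mf 0 _); [exact: normc_ge0|rewrite in_I01 lexx ler01].
have fM x : cmod_fun f x <= seminorm C01 f.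
  by rewrite cmod_funE; case: ifP => // /Mf.
apply: seminorm_le.
- exact: carrier_cconv.
- by rewrite !mulr_ge0.
move=> x xI; apply: le_trans (normc_le_parts _) _ => /=.
rewrite -mulrA mulrDl mul1r; apply: lerD.
  apply: conv_bounded => //; first exact: measurable_rpart cf.
  by move=> t; exact: le_trans (rpart_le _ _) (fM t).
apply: conv_bounded => //; first exact: measurable_ipart cf.
by move=> t; exact: le_trans (ipart_le _ _) (fM t).
Qed.

Lemma eq_parts E f g : carrier_def E f -> carrier_def E g -> ae_eq mu I01 f g ->
  ae_eq mu [set: R] (rpart f) (rpart g) /\ ae_eq mu [set: R] (ipart f) (ipart g).
Proof.
move=> cf cg fg; have FF := @ae_filter_ringOfSetsType _ (measurableTypeR R) R mu.
split; move: fg; apply: (@filterS _ _ FF) => x fg _;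
  rewrite /rpart /ipart !patchE; case: ifPn => // /set_mem/fg -> //.
Qed.

Lemma eq_cconv E f g : carrier_def E f -> carrier_def E g -> ae_eq mu I01 f g ->
  cconv phi f = cconv phi g.
Proof.
move=> cf cg fg; have [er ei] := eq_parts cf cg fg; apply/funext => x.
congr (_ +i* _); apply: eq_conv => //.
- exact: measurable_rpart cf.
- exact: measurable_rpart cg.
- exact: measurable_ipart cf.
- exact: measurable_ipart cg.
Qed.

(** Additivity of the integral holds at those [x] where all integrands are integrable, that is
    almost everywhere; [same_ae] upgrades this when [E] is C[0, 1]. *)
Lemma cconv_linear E (a : C) f g : carrier_def E f -> carrier_def E g ->
  same E (cconv phi (a *: f + g)) (a *: cconv phi f + cconv phi g).
Proof.
move=> cf cg; have cafg := carrier_defD (carrier_defZ a cf) cg.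
apply: same_ae; first exact: carrier_cconv.
  by apply: carrier_defD; [apply: carrier_defZ|]; exact: carrier_cconv.
have FF := @ae_filter_ringOfSetsType _ (measurableTypeR R) R mu.
have := @filterI _ _ FF _ _ (@filterI _ _ FF _ _
   (ae_integrable_ker mphi phi0 phic (integrable_rpart cf))
   (ae_integrable_ker mphi phi0 phic (integrable_ipart cf)))
  (@filterI _ _ FF _ _
   (ae_integrable_ker mphi phi0 phic (integrable_rpart cg))
   (ae_integrable_ker mphi phi0 phic (integrable_ipart cg))).
apply: (@filterS _ _ FF) => x [[rf jf] [rg jg]] _.
exact: cconv_lin.
Qed.

End profile.

Lemma cconv_pw1_comp E a f : 0 < a -> carrier_def E f ->
  cconv (pw 1) (cconv (pw a) f) = (a^-1)%:C *: cconv (pw (a + 1)) f.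
Proof.
move=> a0 cf; apply/funext => x; rewrite fctE {1}/cconv rpart_cconv ipart_cconv.
rewrite !conv_pw1_comp//; [|exact: integrable_ipart cf|exact: integrable_rpart cf].
by apply/eqP; rewrite eq_complex/= !mul0r subr0 addr0 !eqxx.
Qed.

Lemma cconv_comp_pw1 E a f : 0 < a -> carrier_def E f ->
  cconv (pw a) (cconv (pw 1) f) = (a^-1)%:C *: cconv (pw (a + 1)) f.
Proof.
move=> a0 cf; apply/funext => x; rewrite fctE {1}/cconv rpart_cconv ipart_cconv.
rewrite !conv_comp_pw1//; [|exact: integrable_ipart cf|exact: integrable_rpart cf].
by apply/eqP; rewrite eq_complex/= !mul0r subr0 addr0 !eqxx.
Qed.

Lemma cconv_pwB E a b f : 0 < a -> 0 < b -> carrier_def E f ->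
  ae_eq mu I01 (cconv (pwB a b) f) (cconv (pw a) f - cconv (pw b) f).
Proof.
move=> a0 b0 cf; have FF := @ae_filter_ringOfSetsType _ (measurableTypeR R) R mu.
have ha c (c0 : 0 < c) h (ih : mu.-integrable [set: T] (EFin \o h)) :=
  ae_integrable_ker (measurable_pw c) (fun u _ => pw_ge0 c u) (integral_pw_le c0) ih.
have := @filterI _ _ FF _ _ (@filterI _ _ FF _ _
   (ha _ a0 _ (integrable_rpart cf)) (ha _ a0 _ (integrable_ipart cf)))
  (@filterI _ _ FF _ _
   (ha _ b0 _ (integrable_rpart cf)) (ha _ b0 _ (integrable_ipart cf))).
apply: (@filterS _ _ FF) => x [[ra ja] [rb jb]] _.
by rewrite /cconv !fctE !conv_pwB.
Qed.

(** The convolution with [pw 1] is the primitive of [f], which is differentiable with derivative [f]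
    almost everywhere by Lebesgue's theorem. *)
Lemma conv_pw1_eq0 (f : R -> R) : mu.-integrable [set: T] (EFin \o f) ->
  f = f \_ I01 -> (forall x, x \in I01 -> conv (pw 1) f x = 0) ->
  ae_eq mu I01 f (cst 0).
Proof.
move=> fi fE H; have FF := @ae_filter_ringOfSetsType _ (measurableTypeR R) R mu.
have /integrableP[/measurable_EFinP mf _] := fi.
have lf : locally_integrable [set: R] f.
  have := integrable_locally measurableT fi.
  by rewrite (_ : f \_ setT = f)//; apply/funext => x; rewrite patchE in_setT.
have fiy (y : R) : mu.-integrable `[0, y] (EFin \o f).
  by apply: (integrableS _ _ _ fi) => //; exact: measurable_itv.
have cE x : 0 <= x <= 1 -> \int[mu]_(t in `[0, x]) f t = 0.
  move=> xI; rewrite -[RHS](H x) ?in_I01// fE conv_restrictE//; last exact: measurable_funTS.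
  apply: eq_Rintegral => t; rewrite inE/= in_itv/= => /andP[t0 tx].
  rewrite subrr powRr0 mul1r patchE ifT// in_I01 t0 (le_trans tx)//.
  by case/andP: xI.
(* At an endpoint the primitive is not known to vanish on a whole neighbourhood. *)
have N01 : {ae mu, forall x, (x != 0) && (x != 1)}.
  exists [set 0; 1]; split.
  - by apply: measurableU; exact: measurable_set1.
  - by apply: countable_lebesgue_measure0; apply: finite_set_countable; exact: finite_set2.
  - by move=> x /= /negP; rewrite negb_and !negbK => /orP[]/eqP ->; [left|right].
have := @filterI _ _ FF _ _ N01 (FTC1 fiy lf).
apply: (@filterS _ _ FF) => x [/andP[x0 x1] h] /mem_set; rewrite in_I01 => /andP[x0' x1'].
have x0'' : 0 < x by rewrite lt_neqAle eq_sym x0.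
have x1'' : x < 1 by rewrite lt_neqAle x1.
have [|_ <-] := h; first by first [exact: x0' | exact: x0'' | done].
rewrite derive1E (@near_eq_derive _ _ _ _ (cst 0)) ?derive_cst//.
have xoo : x \in `]0, 1[ by rewrite in_itv/= x0''.
apply: filterS (near_in_itvoo xoo) => y; rewrite in_itv/= => /andP[y0 y1].
by rewrite cE//; apply/andP; split; exact: ltW.
Qed.

End complex_convolution.

(** * Fractional integrals and the Volterra operator on E *)

Section operators_on_fspace.
Context {R : realType}.
Local Notation mu := (@lebesgue_measure R).
Local Notation T := (measurableTypeR R).
Local Notation C := (R[i]^o).
Variable E : fspace R.
Implicit Types (f g : E) (h : R -> C).

(* The class of [h]; a junk value unless [carrier_def E h]. *)
Definition toE h : E := xget 0 [set f : E | same E (fun_of f) h].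

Lemma toEP h : carrier_def E h -> same E (fun_of (toE h)) h.
Proof. by move=> /ex_fspace[f fh]; rewrite /toE; case: xgetP => [g _ //|/(_ f)]. Qed.

Lemma toE_fun f : toE (fun_of f) = f.
Proof. by apply/fspace_eqP; apply: toEP; exact: carrier_fun_of. Qed.

Lemma toE_eq h1 h2 : carrier_def E h1 -> carrier_def E h2 ->
  ae_eq mu I01 h1 h2 -> toE h1 = toE h2.
Proof.
move=> c1 c2 h12; apply/fspace_eqP; apply: same_trans (toEP c1) _.
by apply: same_trans (same_ae c1 c2 h12) _; apply/same_sym; exact: toEP.
Qed.

Lemma toE_lin (a : R[i]) h1 h2 : carrier_def E h1 -> carrier_def E h2 ->
  toE (a *: h1 + h2) = a *: toE h1 + toE h2.
Proof.
move=> c1 c2; apply/fspace_eqP.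
apply: same_trans (toEP (carrier_defD (carrier_defZ a c1) c2)) _.
apply/same_sym; apply: same_trans (fun_ofD _ _) _; apply: sameD; last exact: toEP.
by apply: same_trans (fun_ofZ _ _) _; apply: sameZ; exact: toEP.
Qed.

Lemma toEZ (a : R[i]) h : carrier_def E h -> toE (a *: h) = a *: toE h.
Proof.
move=> ch; apply/fspace_eqP; apply: same_trans (toEP (carrier_defZ a ch)) _.
apply/same_sym; apply: same_trans (fun_ofZ _ _) _; apply: sameZ; exact: toEP.
Qed.

Lemma norm_toE h : carrier_def E h -> `|toE h| = (seminorm E h)%:C.
Proof.
move=> ch; rewrite normE (same_seminorm (carrier_fun_of _) ch)//; exact: toEP.
Qed.

Lemma fun_of_lin (a : R[i]) f g :
  ae_eq mu I01 (fun_of (a *: f + g)) (a *: fun_of f + fun_of g).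
Proof.
apply: (@ae_same _ E); apply: same_trans (fun_ofD _ _) _; apply: sameD; last exact: same_refl.
exact: fun_ofZ.
Qed.

Section lift.
Variables (F : (R -> C) -> (R -> C)) (B : R).
Hypothesis Fc : forall h, carrier_def E h -> carrier_def E (F h).
Hypothesis Fe : forall h1 h2, carrier_def E h1 -> carrier_def E h2 ->
  ae_eq mu I01 h1 h2 -> ae_eq mu I01 (F h1) (F h2).
Hypothesis Fl : forall (a : R[i]) h1 h2, carrier_def E h1 -> carrier_def E h2 ->
  ae_eq mu I01 (F (a *: h1 + h2)) (a *: F h1 + F h2).
Hypothesis Fb : forall h, carrier_def E h -> seminorm E (F h) <= B * seminorm E h.

Lemma lift_linear : linear (fun f => toE (F (fun_of f))).
Proof.
move=> a f g /=; have [cf cg] := (carrier_fun_of f, carrier_fun_of g).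
rewrite -toE_lin; [|exact: Fc..].
have clin := carrier_defD (carrier_defZ a cf) cg.
have FF := @ae_filter_ringOfSetsType _ (measurableTypeR R) R mu.
apply: toE_eq; [exact/Fc/carrier_fun_of|by apply: carrier_defD; [apply: carrier_defZ|]; exact: Fc|].
have := @filterI _ _ FF _ _ (Fe (carrier_fun_of _) clin (fun_of_lin a f g)) (Fl a cf cg).
by apply: (@filterS _ _ FF) => x [h1 h2] xI; rewrite h1// h2.
Qed.

Lemma lift_bounded : exists M : R, forall f : E,
  `|toE (F (fun_of f))| <= M%:C * `|f|.
Proof.
exists B => f; have cf := carrier_fun_of f.
by rewrite norm_toE ?normE -?rmorphM ?lecR; [exact: Fb|exact: Fc].
Qed.

Definition lift_op : bounded_op E := BoundedOp lift_linear lift_bounded.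

End lift.

Section fractional_operator.
Variable a : R.
Hypothesis a0 : 0 < a.

(** [RLint] written with the truncated convolution; on [0, 1] the two agree by [RLintE]. *)
Definition rl (h : R -> C) : R -> C := ((Gamma a)^-1)%:C *: cconv (pw a) h.

Let pa u (_ : 0 < u <= 1) := pw_ge0 a u.

Lemma carrier_rl h : carrier_def E h -> carrier_def E (rl h).
Proof.
by move=> ch; apply: carrier_defZ; exact: (carrier_cconv (measurable_pw a) pa (integral_pw_le a0)).
Qed.

Lemma rl_eq h1 h2 : carrier_def E h1 -> carrier_def E h2 ->
  ae_eq mu I01 h1 h2 -> rl h1 = rl h2.
Proof.
by move=> c1 c2 h12; rewrite /rl (eq_cconv (measurable_pw a) c1 c2 h12).
Qed.

Lemma rl_lin (b : R[i]) h1 h2 : carrier_def E h1 -> carrier_def E h2 ->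
  ae_eq mu I01 (rl (b *: h1 + h2)) (b *: rl h1 + rl h2).
Proof.
move=> c1 c2.
have := ae_same (cconv_linear (measurable_pw a) pa (integral_pw_le a0) b c1 c2).
have FF := @ae_filter_ringOfSetsType _ (measurableTypeR R) R mu.
apply: (@filterS _ _ FF) => x h xI; rewrite /rl !fctE h// !fctE.
by rewrite scalerDr !scalerA mulrC.
Qed.

Lemma rl_bounded h : carrier_def E h ->
  seminorm E (rl h) <= (Gamma a)^-1 * (2 * a^-1) * seminorm E h.
Proof.
move=> ch.
have cc := carrier_cconv (measurable_pw a) pa (integral_pw_le a0) ch.
rewrite seminormZ// -mulrA; have g0 := Gamma_gt0 a0.
rewrite (_ : normc _ = (Gamma a)^-1); last first.
  by rewrite /= expr0n addr0 sqrtr_sqr ger0_norm// invr_ge0 ltW.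
rewrite ler_wpM2l ?invr_ge0 ?(ltW g0)//.
exact: (seminorm_cconv (measurable_pw a) pa (integral_pw_le a0) ch).
Qed.

Lemma rl_ae h1 h2 : carrier_def E h1 -> carrier_def E h2 ->
  ae_eq mu I01 h1 h2 -> ae_eq mu I01 (rl h1) (rl h2).
Proof. by move=> c1 c2 h12; rewrite (rl_eq c1 c2 h12); exact: ae_eq_refl. Qed.

End fractional_operator.

(* The operators are obtained through an opaque existence proof: unification would
   otherwise unfold them down to the integrals. *)
Lemma Nop_exists a : exists N : bounded_op E,
  0 < a -> forall h, carrier_def E h -> N (toE h) = toE (rl a h).
Proof.
have [a0|/negP a0] := boolP (0 < a).
  exists (lift_op (carrier_rl a0) (@rl_ae a) (rl_lin a0) (rl_bounded a0)) => _ h ch.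
  congr toE; apply: rl_eq => //; first exact: carrier_fun_of.
  exact: ae_same (toEP ch).
have idB : exists M : R, forall f : E, `|f| <= M%:C * `|f| by exists 1 => f; rewrite mul1r.
by exists (@BoundedOp _ E idfun (fun _ _ _ => erefl) idB).
Qed.

(** Total in [a]: outside [a > 0] it is an unspecified bounded operator. *)
Definition Nop a : bounded_op E := projT1 (cid (Nop_exists a)).

Lemma Nop_toE a h : 0 < a -> carrier_def E h -> Nop a (toE h) = toE (rl a h).
Proof. by move=> a0; exact: (projT2 (cid (Nop_exists a)) a0). Qed.

Lemma NopE a f : 0 < a -> Nop a f = toE (rl a (fun_of f)).
Proof. by move=> a0; rewrite -{1}(toE_fun f); apply: Nop_toE => //; exact: carrier_fun_of. Qed.

Definition volterra := Nop 1.

Lemma rl1 h : rl 1 h = cconv (pw 1) h.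
Proof. by rewrite /rl Gamma1 invr1 scale1r. Qed.

(** The primitive of an integrable function is continuous. So V sends every class of E to one with a
    continuous representative, which is where pointwise arguments become possible. *)
Lemma continuous_cconv_pw1 h : carrier_def E h -> carrier_def C01 (cconv (pw 1) h).
Proof.
move=> ch; apply/within_continuous_parts.
have H (r : R -> R) : mu.-integrable [set: T] (EFin \o r) -> r = r \_ I01 ->
    {within I01, continuous (conv (pw 1) r)}.
  move=> ir rE; have /integrableP[/measurable_EFinP mr _] := ir.
  have ir1 : mu.-integrable `[0, 1] (EFin \o r).
    by apply: (integrableS _ _ _ ir) => //; exact: measurable_itv.
  have /within_continuousP cr := parameterized_integral_continuous ler01 ir1.
  have rI x : (I01 : set R) x -> conv (pw 1) r x = \int[mu]_(t in `[0, x]) r t.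
    rewrite /I01/= in_itv/= => xI; rewrite {1}rE conv_restrictE//; last exact: measurable_funTS.
    by apply: eq_Rintegral => t _; rewrite subrr powRr0 mul1r.
  apply/within_continuousP => x e xI e0; have [d d0 Hd] := cr x e xI e0.
  by exists d => // y yI xy; rewrite !rI//; exact: Hd.
have rs (r : R -> R) : r \_ I01 = (r \_ I01) \_ I01.
  by apply/funext => x; rewrite !patchE; case: ifP.
by split; apply: H; [exact: integrable_rpart ch|exact: rs|
  exact: integrable_ipart ch|exact: rs].
Qed.

Lemma Vop_toE h : carrier_def E h -> volterra (toE h) = toE (cconv (pw 1) h).
Proof. by move=> ch; rewrite /volterra Nop_toE// rl1. Qed.

Lemma VopE f : volterra f = toE (cconv (pw 1) (fun_of f)).
Proof. by rewrite -[in LHS](toE_fun f) Vop_toE//; exact: carrier_fun_of. Qed.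

(** In L^p the hypothesis says only that the primitive vanishes almost everywhere; its continuity
    makes it vanish on all of [0, 1], after which it can be differentiated. *)
Lemma V_inj f : volterra f = 0 -> f = 0.
Proof.
move=> Vf; apply/fspace_eqP; have cf := carrier_fun_of f.
apply: same_trans (same_sym (fun_of0 E)).
have c1 := continuous_cconv_pw1 cf.
have z0 : {in I01, cconv (pw 1) (fun_of f) =1 (0 : R -> C)}.
  apply: continuous_ae_eq; [exact: c1|exact: (carrier_def0 C01)|].
  apply: (@ae_same _ E); apply: same_trans (fun_of0 E).
  by rewrite -Vf VopE; apply/same_sym/toEP/C01_carrier.
have rs (r : R -> R) : r \_ I01 = (r \_ I01) \_ I01.
  by apply/funext => x; rewrite !patchE; case: ifP.
have hr : ae_eq mu I01 (rpart (fun_of f)) (cst 0).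
  apply: conv_pw1_eq0; [exact: integrable_rpart cf|exact: rs|].
  by move=> x /z0; rewrite /cconv => -[].
have hi : ae_eq mu I01 (ipart (fun_of f)) (cst 0).
  apply: conv_pw1_eq0; [exact: integrable_ipart cf|exact: rs|].
  by move=> x /z0; rewrite /cconv => -[].
apply: same_ae => //; first exact: carrier_def0.
have FF := @ae_filter_ringOfSetsType _ (measurableTypeR R) R mu.
have := @filterI _ _ FF _ _ hr hi.
apply: (@filterS _ _ FF) => x [h1 h2] xI; have := h1 xI; have := h2 xI.
rewrite /rpart /ipart !patchE (mem_set xI)/=.
by case: (fun_of f x) => u v /= -> ->.
Qed.

(** Composed with [pw 1] in either order, [pw a] gives the same kernel, a multiple of [pw (a + 1)].
    This places every N_a in the commutant of V. *)
Lemma Nop_V a f : 0 < a -> Nop a (volterra f) = volterra (Nop a f).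
Proof.
move=> a0.
have cf := carrier_fun_of f.
have pa u (_ : 0 < u <= 1) := pw_ge0 a u.
have ca := carrier_cconv (measurable_pw a) pa (integral_pw_le a0) cf.
have -> : Nop a f = ((Gamma a)^-1)%:C *: toE (cconv (pw a) (fun_of f)).
  by rewrite NopE // /rl toEZ.
have VZ (c : R[i]) g : volterra (c *: g) = c *: volterra g by exact: linearZ.
rewrite VZ Vop_toE// VopE (Nop_toE a0); last exact: C01_carrier (continuous_cconv_pw1 cf).
rewrite /rl (cconv_comp_pw1 a0 cf) (cconv_pw1_comp a0 cf) toEZ//.
apply: carrier_defZ.
have a1 : 0 < a + 1 by lra.
exact: (carrier_cconv (measurable_pw _) (fun u _ => pw_ge0 _ u) (integral_pw_le a1) cf).
Qed.

End operators_on_fspace.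

(** * Multiplication by x and its commutator with V *)

Section multiplication.
Context {R : realType}.
Local Notation mu := (@lebesgue_measure R).
Local Notation T := (measurableTypeR R).
Local Notation C := (R[i]^o).

(** The Beta integral with [b = 0] and [x = 1], whose value [1 / a] is known directly. *)
Lemma GammaS (a : R) : 0 < a -> Gamma (a + 1) = a * Gamma a.
Proof.
move=> a0; have H := integral_beta a0 (lexx 0) (@ler01 R).
have : (\int[mu]_(t in `[0%R, 1%R]) ((1 - t) `^ (a - 1) * t `^ 0)%:E = (a^-1)%:E)%E.
  have -> : a^-1 = (1 - 0) `^ a / a by rewrite subr0 powR1 mul1r.
  by rewrite -integral_powRBr//; apply: eq_integral => t _; rewrite powRr0 mulr1.
rewrite H => -[]; rewrite powR1 mulr1 add0r Gamma1 mulr1 addr0 => h.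
have g0 := Gamma_gt0 a0; have g1 : 0 < Gamma (a + 1) by apply: Gamma_gt0; lra.
apply: (mulIf (lt0r_neq0 (_ : 0 < a^-1))); first by rewrite invr_gt0.
by rewrite -[in LHS]h mulrC divfK ?lt0r_neq0// mulrAC divff ?mul1r ?lt0r_neq0.
Qed.

Lemma integrable_ker_pw1 (f : R -> R) x : mu.-integrable [set: T] (EFin \o f) ->
  mu.-integrable [set: T] (fun t => (ker (pw 1) (x, t) * f t)%:E).
Proof.
move=> fi; have /integrableP[/measurable_EFinP mf _] := fi.
apply: (le_integrable measurableT _ _ fi).
  by apply/measurable_EFinP; apply: measurable_ker_mul => //; exact: measurable_pw.
move=> t _ /=; rewrite lee_fin normrM ler_piMl// /ker/=.
by case: ifP => _; rewrite ?normr0// /pw subrr powRr0 normr1.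
Qed.

(** The kernel [x - t] of V^2 splits into [x] times the kernel of V minus that kernel times [t].
    This is [M, V] = V^2, read pointwise. *)
Lemma conv_pw2 (f : R -> R) x : mu.-integrable [set: T] (EFin \o f) ->
  mu.-integrable [set: T] (EFin \o (fun t => t * f t)) ->
  conv (pw (1 + 1)) f x = x * conv (pw 1) f x - conv (pw 1) (fun t => t * f t) x.
Proof.
move=> fi tfi; have i1 := integrable_ker_pw1 x fi; have i2 := integrable_ker_pw1 x tfi.
rewrite /conv -RintegralZl// -RintegralB//; last first.
  rewrite (_ : _ \o _ = (fun t => x%:E * (ker (pw 1) (x, t) * f t)%:E)%E)//.
  exact: integrableZl.
apply: eq_Rintegral => t _; rewrite /ker/=; case: ifPn => [/andP[/andP[t0 tx] _]|_]; last first.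
  by rewrite !mul0r mulr0 subrr.
by rewrite /pw addrK subrr powRr0 powRr1 ?subr_ge0 ?(ltW tx)//; ring.
Qed.

Definition mulx (h : R -> C) : R -> C := fun x => x%:C * h x.

Lemma rpart_mulx h : rpart (mulx h) = fun t => t * rpart h t.
Proof.
apply/funext => t; rewrite /rpart !patchE; case: ifP => _; last by rewrite mulr0.
by rewrite /mulx; case: (h t) => u v /=; rewrite mul0r subr0.
Qed.

Lemma ipart_mulx h : ipart (mulx h) = fun t => t * ipart h t.
Proof.
apply/funext => t; rewrite /ipart !patchE; case: ifP => _; last by rewrite mulr0.
by rewrite /mulx; case: (h t) => u v /=; rewrite mul0r addr0.
Qed.

Lemma cmod_mulx h x : cmod_fun (mulx h) x <= cmod_fun h x.
Proof.
rewrite !cmod_funE; case: ifPn => //; rewrite in_I01 => /andP[x0 x1].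
rewrite /mulx normcM /= expr0n addr0 sqrtr_sqr ger0_norm// ler_piMl//.
exact: normc_ge0.
Qed.

Lemma carrier_mulx (E : fspace R) h : carrier_def E h -> carrier_def E (mulx h).
Proof.
case: E => [|p p1] ch.
  have /within_continuous_parts[cr ci] := ch.
  have cx : {within (I01 : set R), continuous (id : R -> R)}.
    by apply: continuous_subspaceT => x; exact: cvg_id.
  apply/within_continuous_parts; split.
    rewrite (_ : (fun x => _) = (fun x => x * complex.Re (h x))); last first.
      by apply/funext => x; rewrite /mulx; case: (h x) => u v /=; rewrite mul0r subr0.
    by move=> x; exact: (@continuousM R (subspace I01) _ _ x (cx x) (cr x)).
  rewrite (_ : (fun x => _) = (fun x => x * complex.Im (h x))); last first.
    by apply/funext => x; rewrite /mulx; case: (h x) => u v /=; rewrite mul0r addr0.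
  by move=> x; exact: (@continuousM R (subspace I01) _ _ x (cx x) (ci x)).
have [mr mi fh] := ch.
have mr' : measurable_fun I01 (fun x => complex.Re (mulx h x)).
  rewrite (_ : (fun x => _) = (fun x => x * complex.Re (h x))); last first.
    by apply/funext => x; rewrite /mulx; case: (h x) => u v /=; rewrite mul0r subr0.
  exact: measurable_funM.
have mi' : measurable_fun I01 (fun x => complex.Im (mulx h x)).
  rewrite (_ : (fun x => _) = (fun x => x * complex.Im (h x))); last first.
    by apply/funext => x; rewrite /mulx; case: (h x) => u v /=; rewrite mul0r addr0.
  exact: measurable_funM.
split => //; apply: le_lt_trans fh; apply: le_Lnorm => //.
- exact: measurable_cmod_fun.
- exact: measurable_cmod_fun.
by move=> x; rewrite cmod_fun_ge0 cmod_mulx.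
Qed.

Lemma seminorm_mulx (E : fspace R) h : carrier_def E h ->
  seminorm E (mulx h) <= 1 * seminorm E h.
Proof.
rewrite mul1r; case: E => [|p p1] ch.
  have M0 : 0 <= seminorm C01 h.
    apply: le_trans (normc_ge0 (h 0)) _; apply: ub_le_sup; first exact: C01_bounded.
    by exists 0 => //; exact: I01_0.
  apply: seminorm_le; [exact: carrier_mulx|exact: M0|].
  move=> x xI; have := cmod_mulx h x; rewrite !cmod_funE xI => /le_trans; apply.
  by apply: ub_le_sup; [exact: C01_bounded|exists x => //; exact: set_mem].
have [_ _ fh] := ch; have [_ _ fh'] := carrier_mulx ch.
rewrite /seminorm fine_le ?ge0_fin_numE ?Lnorm_ge0//.
apply: le_Lnorm => //; first exact: measurable_cmod (carrier_mulx ch).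
  exact: measurable_cmod ch.
by move=> x; rewrite cmod_fun_ge0 cmod_mulx.
Qed.

Variable E : fspace R.
Implicit Types f : E.

Lemma mulx_ae (h1 h2 : R -> C) : carrier_def E h1 -> carrier_def E h2 ->
  ae_eq mu I01 h1 h2 -> ae_eq mu I01 (mulx h1) (mulx h2).
Proof.
move=> _ _; have FF := @ae_filter_ringOfSetsType _ (measurableTypeR R) R mu.
by apply: (@filterS _ _ FF) => x h xI; rewrite /mulx h.
Qed.

Lemma mulx_lin (a : R[i]) (h1 h2 : R -> C) : carrier_def E h1 -> carrier_def E h2 ->
  ae_eq mu I01 (mulx (a *: h1 + h2)) (a *: mulx h1 + mulx h2).
Proof.
move=> _ _; apply: aeW => x _; rewrite /mulx !fctE mulrDr; congr (_ + _).
by rewrite /GRing.scale/= mulrCA.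
Qed.

Lemma Mop_exists : exists M : bounded_op E,
  forall h : R -> C, carrier_def E h -> M (toE E h) = toE E (mulx h).
Proof.
exists (lift_op (@carrier_mulx E) mulx_ae mulx_lin (@seminorm_mulx E)) => h ch.
apply: toE_eq; [exact/carrier_mulx/carrier_fun_of|exact: carrier_mulx|].
by apply: mulx_ae => //; [exact: carrier_fun_of|exact: ae_same (toEP ch)].
Qed.

Definition Mop : bounded_op E := projT1 (cid Mop_exists).

Lemma Mop_toE (h : R -> C) : carrier_def E h -> Mop (toE E h) = toE E (mulx h).
Proof. exact: (projT2 (cid Mop_exists)). Qed.

Local Notation V := (volterra E).

Lemma Mop_V f : Mop (V f) = V (Mop f) + V (V f).
Proof.
have cf := carrier_fun_of f; have cm := carrier_mulx cf.
have c1 := C01_carrier E (continuous_cconv_pw1 cf).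
have c2 := C01_carrier E (continuous_cconv_pw1 cm).
have c3 := C01_carrier E (continuous_cconv_pw1 c1).
have EM : Mop f = toE E (mulx (fun_of f)) by rewrite -[in LHS](toE_fun f) Mop_toE.
rewrite EM (VopE f) Mop_toE// !Vop_toE// -[toE E (cconv _ (mulx _))]scale1r -toE_lin//.
congr toE; apply/funext => x; rewrite !fctE scale1r.
rewrite (cconv_pw1_comp ltr01 cf) invr1 fctE scale1r.
rewrite /mulx/= /cconv -/(mulx (fun_of f)) rpart_mulx ipart_mulx.
rewrite !conv_pw2.
- by apply/eqP; rewrite eq_complex/=; apply/andP; split; apply/eqP; ring.
- exact: integrable_ipart cf.
- by rewrite -ipart_mulx; exact: integrable_ipart cm.
- exact: integrable_rpart cf.
- by rewrite -rpart_mulx; exact: integrable_rpart cm.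
Qed.

End multiplication.

(** * The commutant of the Volterra operator *)

Section operator_algebra.
Context {R : realType} {U : normedModType R[i]}.
Implicit Types S T : bounded_op U.

Lemma op_comp_linear S T : linear (S \o T).
Proof. by move=> a f g; rewrite /= !linearP. Qed.

Lemma opP S (c : R[i]) f g : S (c *: f + g) = c *: S f + S g.
Proof. exact: bop_linear. Qed.

Lemma op0 S : S 0 = 0. Proof. exact: linear0. Qed.

Lemma opZ S (c : R[i]) f : S (c *: f) = c *: S f. Proof. exact: linearZ. Qed.

Lemma opD S f g : S (f + g) = S f + S g. Proof. exact: linearD. Qed.

Lemma opB S f g : S (f - g) = S f - S g. Proof. exact: linearB. Qed.

Lemma op_bound S : exists2 M : R, 0 <= M & forall f : U, `|S f| <= M%:C * `|f|.
Proof.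
have [M HM] := bop_bounded S; exists `|M|; first exact: normr_ge0.
move=> f; apply: le_trans (HM f) _; apply: ler_wpM2r; first exact: normr_ge0.
by rewrite lecR ler_norm.
Qed.

Lemma op_comp_bounded S T : exists M : R, forall f : U, `|(S \o T) f| <= M%:C * `|f|.
Proof.
have [M M0 HM] := op_bound S; have [N N0 HN] := op_bound T.
exists (M * N) => f /=; apply: le_trans (HM _) _; rewrite rmorphM -mulrA.
by apply: ler_wpM2l; rewrite ?lecR.
Qed.

Definition op_comp S T : bounded_op U := BoundedOp (op_comp_linear S T) (op_comp_bounded S T).

Lemma op_lin_linear (c : R[i]) S T : linear (fun f => c *: S f + T f).
Proof.
move=> a f g /=; rewrite (bop_linear S) (bop_linear T) !scalerDr !scalerA [c * a]mulrC.
by rewrite addrACA.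
Qed.

Lemma op_lin_bounded (c : R[i]) S T : exists M : R, forall f : U,
  `|c *: S f + T f| <= M%:C * `|f|.
Proof.
have [M M0 HM] := op_bound S; have [N N0 HN] := op_bound T.
exists (normc c * M + N) => f; apply: le_trans (ler_normD _ _) _.
rewrite rmorphD mulrDl; apply: lerD; last exact: HN.
by rewrite normrZ rmorphM -mulrA; apply: ler_wpM2l.
Qed.

Definition op_lin c S T : bounded_op U := BoundedOp (op_lin_linear c S T) (op_lin_bounded c S T).

Lemma op_id_linear : linear (@id U). Proof. by []. Qed.

Lemma op_id_bounded : exists M : R, forall f : U, `|id f| <= M%:C * `|f|.
Proof. by exists 1 => f; rewrite mul1r. Qed.

Definition op_id : bounded_op U := BoundedOp op_id_linear op_id_bounded.

Definition op_pow T n := iter n (op_comp T) op_id.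

Lemma op_powE T n f : op_pow T n f = iter n T f.
Proof. by elim: n => //= n ->. Qed.

End operator_algebra.

(** * Polynomials and the orbit of 1 under V *)

Section polynomials.
Context {R : realType}.
Local Notation mu := (@lebesgue_measure R).
Local Notation T := (measurableTypeR R).
Local Notation C := (R[i]^o).
Variable E : fspace R.
Implicit Types (f g : E) (p q : {poly R}).
Local Notation V := (volterra E).

Definition creal (h : R -> R) : R -> C := fun x => (h x)%:C.

Lemma carrier_creal (h : R -> R) : {within I01, continuous h} -> carrier_def C01 (creal h).
Proof.
move=> ch; apply/within_continuous_parts; split => //.
by apply: continuous_subspaceT => x; exact: cvg_cst.
Qed.

Lemma continuous_poly p : {within (I01 : set R), continuous (fun x => p.[x])}.
Proof. by apply: continuous_subspaceT; exact: continuous_horner. Qed.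

Definition polyE p : E := toE E (creal (fun x => p.[x])).

Lemma carrier_poly p : carrier_def E (creal (fun x => p.[x])).
Proof. exact/C01_carrier/carrier_creal/continuous_poly. Qed.

Lemma P_lin (c : R) p q : polyE (c *: p + q) = c%:C *: polyE p + polyE q.
Proof.
rewrite /polyE -toE_lin; [|exact: carrier_poly..].
congr toE; apply/funext => x; rewrite /creal fctE/= !hornerE.
by rewrite rmorphD rmorphM.
Qed.

Lemma P0 : polyE 0 = 0.
Proof.
have := P_lin 1 0 0; rewrite scaler0 addr0 scale1r => h.
by apply: (addrI (polyE 0)); rewrite addr0 -h.
Qed.

Lemma V_PXn k : V (polyE 'X^k) = ((k.+1%:R)^-1)%:C *: polyE 'X^(k.+1).
Proof.
have k0 : (0 : R) <= k%:R by [].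
have k1 : (0 : R) < k%:R + 1 by rewrite ltr_wpDl.
rewrite /polyE Vop_toE; last exact: carrier_poly.
rewrite -toEZ; last exact: carrier_poly.
apply: toE_eq.
- exact/C01_carrier/continuous_cconv_pw1/carrier_poly.
- by apply: carrier_defZ; exact: carrier_poly.
apply: aeW => x /mem_set; rewrite in_I01 => xI.
have rE : rpart (creal (fun x => ('X^k).[x])) = (fun t : R => t `^ k%:R) \_ I01.
  apply/funext => t; rewrite /rpart !patchE; case: ifPn => //; rewrite in_I01 => /andP[t0 _].
  by rewrite /creal/= hornerXn powR_mulrn.
have iE : ipart (creal (fun x => ('X^k).[x])) = fun=> 0.
  by apply/funext => t; rewrite /ipart patchE; case: ifP.
rewrite /cconv rE iE conv_powR// Gamma1 mul1r fctE.
rewrite (_ : conv _ (fun=> 0) x = 0); last first.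
  by rewrite /conv; under eq_Rintegral do rewrite mulr0; rewrite Rintegral_cst// mul0r.
rewrite [1 + k%:R]addrC (GammaS k1) -natr1 -[k%:R + 1]/(_ + _).
have xk : x `^ (k%:R + 1) = x ^+ k.+1 by rewrite natr1 powR_mulrn//; case/andP: xI.
have g0 := Gamma_gt0 k1.
transitivity (((k%:R + 1)^-1 * x ^+ k.+1)%:C); last by rewrite rmorphM /creal/= hornerXn.
congr (_ +i* 0); rewrite xk; congr (_ * _).
by field; rewrite !lt0r_neq0.
Qed.

(** The orbit of 1 under V spans the polynomials, so an operator commuting with V is controlled by
    its value on 1. *)
Lemma P_PXn k : polyE 'X^k = (k`!%:R)%:C *: iter k V (polyE 1).
Proof.
elim: k => [|k IH]; first by rewrite expr0 fact0 scale1r.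
have VZ (c : R[i]) g : V (c *: g) = c *: V g by exact: linearZ.
rewrite iterS factS natrM rmorphM/= -scalerA -VZ -IH V_PXn scalerA -rmorphM/=.
by rewrite divff ?pnatr_eq0// scale1r.
Qed.

Lemma P_ind (Q : E -> Prop) : Q 0 -> (forall (c : R[i]) f g, Q f -> Q g -> Q (c *: f + g)) ->
  (forall k, Q (polyE 'X^k)) -> forall p, Q (polyE p).
Proof.
move=> Q0 QD QX p; rewrite -[p]coefK poly_def.
elim: (size p) => [|n IH]; first by rewrite big_ord0 P0.
by rewrite big_ord_recr/= addrC P_lin; apply: QD.
Qed.

Lemma approx_poly (h : R -> C) (e : R) : carrier_def C01 h -> 0 < e ->
  exists p q, forall x, x \in I01 -> normc (h x - (p.[x] +i* q.[x])) <= e.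
Proof.
move=> /within_continuous_parts[cr ci] e0; have e2 : 0 < e / 2 by lra.
have [p Hp] := weierstrass cr e2; have [q Hq] := weierstrass ci e2.
exists p, q => x xI; have xI' : x \in `[0, 1] by rewrite in_itv/= -in_I01.
apply: le_trans (normc_le_parts _) _.
by have := Hp x xI'; have := Hq x xI'; case: (h x) => u v /=; lra.
Qed.

Lemma toE_poly p q : toE E (fun x => p.[x] +i* q.[x]) = 'i%C *: polyE q + polyE p.
Proof.
rewrite /polyE -toE_lin; [|exact: carrier_poly..].
congr toE; apply/funext => x; rewrite /creal fctE/=.
by apply/eqP; rewrite eq_complex/=; apply/andP; split; apply/eqP; ring.
Qed.

Lemma carrier_poly2 p q : carrier_def C01 (fun x => p.[x] +i* q.[x] : C).
Proof. by apply/within_continuous_parts; split; exact: continuous_poly. Qed.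

Lemma toE_close (h k : R -> C) (e : R) : carrier_def C01 h -> carrier_def C01 k ->
  0 <= e -> (forall x, x \in I01 -> normc (h x - k x) <= e) ->
  `|toE E h - toE E k| <= e%:C.
Proof.
move=> ch ck e0 hk.
have -> : toE E h - toE E k = toE E (-1 *: k + h).
  by rewrite toE_lin; [rewrite scaleN1r addrC|exact: C01_carrier..].
have c1 : carrier_def C01 (-1 *: k + h) by exact: (@carrier_defD R C01 _ _ (@carrier_defZ R C01 (-1) k ck) ch).
rewrite norm_toE ?lecR; last exact: C01_carrier.
apply: seminorm_le; [exact: C01_carrier|exact: e0|] => x xI.
by rewrite !fctE scaleN1r addrC; exact: hk.
Qed.

Lemma norm_small0 (f : E) (M : R) : 0 <= M -> (forall e : R, 0 < e -> `|f| <= (M * e)%:C) -> f = 0.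
Proof.
move=> M0 H; apply/eqP; rewrite -normr_eq0 normE.
set r := seminorm _ _ in H *.
have r0 : 0 <= r by have := normr_ge0 f; rewrite normE -[0]/(0%:C) lecR.
have [->//|rn0] := eqVneq r 0.
have rp : 0 < r by rewrite lt_neqAle eq_sym rn0.
have := H (r / (2 * (M + 1))); rewrite normE lecR divr_gt0//; last by lra.
move=> /(_ isT); rewrite -/r mulrCA -[X in X <= _]mulr1 ler_pM2l// ler_pdivlMr; lra.
Qed.

(** Weierstrass, applied to the real and the imaginary part: on C[0, 1] the norm of E is at most the
    supremum norm, for which W is therefore continuous. *)
Lemma op_vanish (W : bounded_op E) : (forall p, W (polyE p) = 0) ->
  forall h, carrier_def C01 h -> W (toE E h) = 0.
Proof.
move=> WP h ch; have [M M0 HM] := op_bound W.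
apply: (norm_small0 M0) => e e0.
have [p [q Hpq]] := approx_poly ch e0.
have W0 : W (toE E (fun x => p.[x] +i* q.[x])) = 0.
  by rewrite toE_poly opP !WP scaler0 addr0.
have -> : W (toE E h) = W (toE E h - toE E (fun x => p.[x] +i* q.[x])).
  by rewrite opB W0 subr0.
apply: le_trans (HM _) _; rewrite rmorphM; apply: ler_wpM2l; first by rewrite lecR.
by apply: toE_close; [exact: ch|exact: carrier_poly2|exact: ltW|exact: Hpq].
Qed.

Lemma iter_V_comm (Z : bounded_op E) n f : (forall f, Z (V f) = V (Z f)) ->
  Z (iter n V f) = iter n V (Z f).
Proof. by move=> ZV; elim: n => //= n IH; rewrite ZV IH. Qed.

Lemma iter_V_inj n f : iter n V f = 0 -> f = 0.
Proof. by elim: n => //= n IH /V_inj. Qed.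

(** From Z V^m 1 = 0 and commutation, Z V^m kills all V^k 1, hence all polynomials, hence all
    continuous functions. A further V brings an arbitrary [f] among these, so V^(m + 1) Z f = 0, and
    V is injective. *)
Lemma commutant_eq0 (Z : bounded_op E) m : (forall f, Z (V f) = V (Z f)) ->
  Z (iter m V (polyE 1)) = 0 -> forall f, Z f = 0.
Proof.
move=> ZV Z0 f; apply: (@iter_V_inj m.+1).
rewrite -(iter_V_comm _ _ ZV) iterSr VopE.
have -> : Z (iter m V (toE E (cconv (pw 1) (fun_of f)))) =
    op_comp Z (op_pow V m) (toE E (cconv (pw 1) (fun_of f))).
  by rewrite /= op_powE.
apply: op_vanish; last by apply: continuous_cconv_pw1; exact: carrier_fun_of.
apply: (@P_ind (fun g => op_comp Z (op_pow V m) g = 0)).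
- exact: op0.
- by move=> c u v u0 v0; rewrite opP u0 v0 scaler0 addr0.
move=> k; rewrite P_PXn opZ/= op_powE -iterD addnC iterD (iter_V_comm _ _ ZV) Z0.
have -> : iter k V 0 = 0 by elim: k => [|k IH]; [done|rewrite iterS IH; exact: op0].
by rewrite scaler0.
Qed.

End polynomials.

(** * Commutation of convolutions with bounded kernels *)

Section commuting_convolutions.
Context {R : realType}.
Local Notation mu := (@lebesgue_measure R).
Local Notation T := (measurableTypeR R).
Implicit Types (phi psi f : R -> R).

(** Nonnegativity is the form in which the kernel estimates are stated; a bounded continuous real
    function is brought into this class by adding a constant. *)
Definition bprofile (c : R) phi :=
  measurable_fun [set: R] phi /\ forall u, 0 < u <= 1 -> 0 <= phi u <= c.

Lemma bprofile_integral c phi : bprofile c phi ->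
  (\int[mu]_(u in `]0%R, 1%R]) (phi u)%:E <= c%:E)%E.
Proof.
move=> [mphi H]; apply: (@le_trans _ _ (\int[mu]_(u in `]0%R, 1%R]) c%:E)%E).
  apply: ge0_le_integral => //.
  - by move=> u; rewrite /= in_itv/= => /H/andP[h _]; rewrite lee_fin.
  - by apply: measurable_funTS; exact/measurable_EFinP.
  - by move=> u; rewrite /= in_itv/= => /H/andP[_ h]; rewrite lee_fin.
rewrite integral_cst/=; last exact: measurable_itv.
by rewrite lebesgue_measure_itv/= lte_fin ltr01 sube0 mule1.
Qed.

Lemma bprofile_ge0 c phi : bprofile c phi -> forall u, 0 < u <= 1 -> 0 <= phi u.
Proof. by move=> [_ H] u /H/andP[]. Qed.

Lemma ker_le c phi z : bprofile c phi -> 0 <= ker phi z <= c.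
Proof.
move=> [_ H]; have c0 : 0 <= c.
  have i1 : (0 : R) < (1 : R) <= (1 : R) by apply/andP; split; [exact: ltr01|exact: lexx].
  by have /andP[h1 h2] := H 1 i1; exact: le_trans h1 h2.
rewrite /ker; case: ifPn => [/andP[/andP[z0 zz] z1]|_]; last by rewrite lexx.
by apply: H; rewrite subr_gt0 zz/=; lra.
Qed.

(* The reflection [s -> y + t - s] of [t, y] exchanges the two factors. *)
Lemma ker_comp_reflect phi psi y t s :
  ker phi (y, y + t - s) * ker psi (y + t - s, t) = ker psi (y, s) * ker phi (s, t).
Proof.
rewrite /ker/= (_ : y - (y + t - s) = s - t); last by ring.
rewrite (_ : y + t - s - t = y - s); last by ring.
have -> : (y + t - s < y) = (t < s) by apply/idP/idP => ?; lra.
have -> : (t < y + t - s) = (s < y) by apply/idP/idP => ?; lra.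
have [t0|t0] := leP 0 t; last by rewrite !mulr0.
have [ts|ts] := ltP t s; last by rewrite !andbF !mul0r mulr0.
have [sy|sy] := ltP s y; last by rewrite !andbF !mul0r mulr0.
have [y1|y1] := leP y 1; last by rewrite !andbF !mul0r.
by rewrite !ifT; [exact: mulrC|lra..].
Qed.

(** By the reflection of [[t, y]] both composed kernels have the same entry at [(y, t)]. This entry
    is at most [c d], so [conv_conv] expresses both sides by the same [chi]. *)
Lemma conv_convC c d phi psi f y : bprofile c phi -> bprofile d psi ->
  mu.-integrable setT (EFin \o f) ->
  conv phi (conv psi f) y = conv psi (conv phi f) y.
Proof.
move=> Hp Hq fi; have [mp _] := Hp; have [mq _] := Hq.
pose X := fun a b t => (\int[mu]_s (ker a (y, s) * ker b (s, t))%:E)%E.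
have mker a b t : measurable_fun [set: R] a -> measurable_fun [set: R] b ->
    measurable_fun [set: T] (fun s => (ker a (y, s) * ker b (s, t))%:E).
  move=> ma mb; apply/measurable_EFinP; apply: measurable_funM.
    by apply: measurableT_comp => //; exact: measurable_ker.
  by apply: measurableT_comp => //; exact: measurable_ker.
have XC t : X phi psi t = X psi phi t.
  rewrite /X -(integral_reflect (y + t)); last exact: mker.
  by apply: eq_integral => s _; rewrite ker_comp_reflect.
have Xle a b ca cb t : bprofile ca a -> bprofile cb b -> (0 <= X a b t <= (ca * cb)%:E)%E.
  move=> Ha Hb; have [ma _] := Ha; have [mb _] := Hb; apply/andP; split.
    by apply: integral_ge0 => s _; rewrite lee_fin; apply: mulr_ge0;
      [have /andP[] := ker_le (y, s) Ha|have /andP[] := ker_le (s, t) Hb].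
  have ca0 : 0 <= ca by have /andP[] := ker_le (y, t) Ha; exact: le_trans.
  apply: (@le_trans _ _ (\int[mu]_s (ca%:E * (ker b (s, t))%:E))%E).
    apply: ge0_le_integral => //.
    - by move=> s _; rewrite lee_fin; apply: mulr_ge0;
        [have /andP[] := ker_le (y, s) Ha|have /andP[] := ker_le (s, t) Hb].
    - exact: mker.
    - apply/measurable_EFinP; apply: measurable_funM => //.
      by apply: measurableT_comp => //; exact: measurable_ker.
    - move=> s _; rewrite lee_fin; apply: ler_wpM2r.
        by have /andP[] := ker_le (s, t) Hb.
      by have /andP[] := ker_le (y, s) Ha.
  rewrite ge0_integralZl_EFin//; last first.
  - by apply/measurable_EFinP; apply: measurableT_comp => //; exact: measurable_ker.
  - by move=> s _; rewrite lee_fin; have /andP[] := ker_le (s, t) Hb.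
  rewrite EFinM; apply: lee_wpmul2l; first by rewrite lee_fin.
  exact: (integral_ker_le1 mb (bprofile_ge0 Hb) (bprofile_integral Hb)).
pose chi t := fine (X phi psi t).
have chiE t : X phi psi t = (chi t)%:E.
  have /andP[h0 h1] := Xle _ _ _ _ t Hp Hq.
  by rewrite /chi fineK// ge0_fin_numE//; apply: le_lt_trans h1 (ltry _).
have chiC t : chi t <= c * d.
  by have /andP[_] := Xle _ _ _ _ t Hp Hq; rewrite chiE lee_fin.
rewrite (conv_conv mp (bprofile_ge0 Hp) mq (bprofile_ge0 Hq) (bprofile_integral Hq) fi chiE chiC).
by rewrite (conv_conv mq (bprofile_ge0 Hq) mp (bprofile_ge0 Hp) (bprofile_integral Hp) fi
  (fun t => eq_trans (esym (XC t)) (chiE t)) chiC).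
Qed.

Lemma cconv_convC (E : fspace R) c d phi psi (h : R -> R[i]^o) : bprofile c phi -> bprofile d psi ->
  carrier_def E h -> cconv phi (cconv psi h) = cconv psi (cconv phi h).
Proof.
move=> Hp Hq ch; apply/funext => x.
have hr := conv_convC x Hp Hq (integrable_rpart ch).
have hi := conv_convC x Hp Hq (integrable_ipart ch).
by rewrite {1 3}/cconv !rpart_cconv !ipart_cconv hr hi.
Qed.

End commuting_convolutions.

(** * Convolution operators on E and the commutant *)

Section convolution_operators.
Context {R : realType}.
Local Notation mu := (@lebesgue_measure R).
Local Notation T := (measurableTypeR R).
Local Notation C := (R[i]^o).
Variable E : fspace R.
Implicit Types (f g : E) (h s : R -> C).
Local Notation V := (volterra E).
Local Notation P := (polyE E).

Lemma op_linE c (S W : bounded_op E) f : op_lin c S W f = c *: S f + W f.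
Proof. by []. Qed.

Lemma op_compE (S W : bounded_op E) f : op_comp S W f = S (W f).
Proof. by []. Qed.

Section kop.
Variables (phi : R -> R) (c : R).
Hypothesis Hp : bprofile c phi.

Let Fc h : carrier_def E h -> carrier_def E (cconv phi h).
Proof. exact: (carrier_cconv Hp.1 (bprofile_ge0 Hp) (bprofile_integral Hp)). Qed.

Let Fe h1 h2 : carrier_def E h1 -> carrier_def E h2 ->
  ae_eq mu I01 h1 h2 -> ae_eq mu I01 (cconv phi h1) (cconv phi h2).
Proof. by move=> c1 c2 h12; rewrite (eq_cconv Hp.1 c1 c2 h12); exact: ae_eq_refl. Qed.

Let Fl (a : R[i]) h1 h2 : carrier_def E h1 -> carrier_def E h2 ->
  ae_eq mu I01 (cconv phi (a *: h1 + h2)) (a *: cconv phi h1 + cconv phi h2).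
Proof.
by move=> c1 c2; apply: (@ae_same _ E);
  exact: (cconv_linear Hp.1 (bprofile_ge0 Hp) (bprofile_integral Hp)).
Qed.

Let Fb h : carrier_def E h -> seminorm E (cconv phi h) <= 2 * c * seminorm E h.
Proof. exact: (seminorm_cconv Hp.1 (bprofile_ge0 Hp) (bprofile_integral Hp)). Qed.

Definition Kop : bounded_op E := lift_op Fc Fe Fl Fb.

Lemma Kop_toE h : carrier_def E h -> Kop (toE E h) = toE E (cconv phi h).
Proof.
move=> ch; rewrite /Kop/=; congr toE; apply: (eq_cconv Hp.1); [exact: carrier_fun_of|exact: ch|].
exact: ae_same (toEP ch).
Qed.

End kop.

Lemma bprofile_pw1 : bprofile 1 (pw (1 : R)).
Proof.
by split=> [|u _]; [exact: measurable_pw|rewrite /pw subrr powRr0 ler01 lexx].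
Qed.

Lemma VKop f : V f = Kop bprofile_pw1 f.
Proof. exact: VopE. Qed.

Lemma Kop_comm c d phi psi (Hp : bprofile c phi) (Hq : bprofile d psi) f :
  Kop Hp (Kop Hq f) = Kop Hq (Kop Hp f).
Proof.
have cf := carrier_fun_of f.
rewrite -(toE_fun f) (Kop_toE Hq cf) (Kop_toE Hp cf).
rewrite (Kop_toE Hp (carrier_cconv Hq.1 (bprofile_ge0 Hq) (bprofile_integral Hq) cf)).
rewrite (Kop_toE Hq (carrier_cconv Hp.1 (bprofile_ge0 Hp) (bprofile_integral Hp) cf)).
by rewrite (cconv_convC Hp Hq cf).
Qed.

(** Reflecting [[0, x]] shows that convolution by [h] sends 1 to the primitive of [h]. This is how a
    convolution with a prescribed value on 1 is obtained. *)
Lemma conv_one (h : R -> R) x : {within I01, continuous h} ->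
  conv (h \_ I01) ((fun=> 1 : R) \_ I01) x = conv (pw 1) (h \_ I01) x.
Proof.
move=> ch; have [xI|xI] := boolP (x \in I01); last by rewrite !conv_out.
have mh : measurable_fun (I01 : set R) h.
  by apply: subspace_continuous_measurable_fun => //; exact: measurable_itv.
have mh' : measurable_fun [set: R] (h \_ I01).
  by apply/(measurable_restrictT _ _).1; first exact: measurable_itv.
have xI' : x \in `[0, 1] by rewrite in_itv/= -in_I01.
have x01 : 0 <= x <= 1 by rewrite -in_I01.
rewrite conv_reflectE; [|exact: mh'| | |exact: xI'].
- rewrite (conv_restrictE 1 x01 mh) /Rintegral; congr fine.
  rewrite -integral_itv_obnd_cbnd; last first.
    apply/measurable_EFinP.
    rewrite (_ : (fun t => _) = h); last first.
      by apply/funext => t; rewrite subrr powRr0 mul1r.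
    by apply: (measurable_funS _ _ mh); [exact: measurable_itv|];
      move=> t; rewrite /I01/= !in_itv/=; lra.
  rewrite [RHS]integral_mkcond; apply: eq_integral => u _.
  rewrite !patchE !mem_setE !in_itv/=.
  case: (leP u 0) => u0; first by rewrite !andFb mul0r.
  rewrite (_ : (0 <= x - u <= 1) = (u <= x)); last by apply/idP/idP; lra.
  case: (leP u x) => ux/=; last by rewrite mulr0.
  by rewrite !ifT ?subrr ?powRr0 ?mul1r ?mulr1//; lra.
- apply/within_continuousP => z e zI e0; exists 1 => // y yI _.
  by rewrite !patchE (mem_set zI) (mem_set yI) subrr normr0.
- by move=> z zI; rewrite patchE in_I01 ifF//; apply/negbTE; move: zI; rewrite in_itv.
Qed.

Let cst1 : creal (fun x => (1%:P : {poly R}).[x]) = creal (fun=> 1).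
Proof. by apply/funext => x; rewrite /creal hornerC. Qed.

Lemma Kop_P1 c (h : R -> R) (Hp : bprofile c (h \_ I01)) : {within I01, continuous h} ->
  Kop Hp (P 1) = V (toE E (creal h)).
Proof.
move=> ch.
have c1 : carrier_def E (creal (fun=> 1)) by rewrite -cst1; exact: carrier_poly.
have ch' : carrier_def E (creal h) by exact/C01_carrier/carrier_creal.
rewrite /P -[1]/(1%:P) cst1 (Kop_toE Hp c1) (Vop_toE ch'); congr toE.
apply/funext => x; congr (_ +i* _); first exact: conv_one.
have i0 k : ipart (creal k : R -> C) = fun=> 0.
  by apply/funext => t; rewrite /ipart patchE; case: ifP.
by rewrite !i0 /conv; congr fine; apply: eq_integral => t _; rewrite !mulr0.
Qed.

(* The span of the [Kop] consists of convolutions, which commute with one another;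
   the second half expresses membership in the bicommutant of the [Kop]. *)
Definition conv_like (K : bounded_op E) :=
  (forall c phi (Hp : bprofile c phi) f, K (Kop Hp f) = Kop Hp (K f)) /\
  forall W : bounded_op E,
    (forall c phi (Hp : bprofile c phi) f, W (Kop Hp f) = Kop Hp (W f)) ->
    forall f, W (K f) = K (W f).

Lemma conv_like_Kop c phi (Hp : bprofile c phi) : conv_like (Kop Hp).
Proof. by split=> [d psi Hq f|W HW f]; [exact: Kop_comm|exact: HW]. Qed.

Lemma conv_like_V : conv_like V.
Proof.
split=> [d psi Hq f|W HW f]; first by rewrite !VKop; exact: Kop_comm.
by rewrite !VKop; exact: HW.
Qed.

Lemma conv_like_lin (a : R[i]) K L : conv_like K -> conv_like L -> conv_like (op_lin a K L).
Proof.
move=> [K1 K2] [L1 L2]; split=> [d psi Hq f|W HW f].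
  by rewrite !op_linE K1 L1 opP.
by rewrite !op_linE opP K2// L2.
Qed.

(** The added constant [M] moves the values of [h] into [[0, 2 M]], where [bprofile] applies. *)
Lemma conv_like_real (h : R -> R) (M : R) : {within I01, continuous h} ->
  (forall x, x \in I01 -> `|h x| <= M) ->
  exists2 K : bounded_op E, conv_like K & K (P 1) = V (toE E (creal (fun x => h x + M))).
Proof.
move=> ch hM.
have cM : {within I01, continuous (fun x => h x + M)}.
  by move=> x; apply: cvgD; [exact: ch|exact: cvg_cst].
have bp : bprofile (2 * M) ((fun x => h x + M) \_ I01).
  split=> [|u u01].
    apply/(measurable_restrictT _ _).1; first exact: measurable_itv.
    by apply: subspace_continuous_measurable_fun; [exact: measurable_itv|exact: cM].
  have uI : u \in I01 by rewrite in_I01; lra.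
  by have := hM _ uI; rewrite patchE uI ler_norml; lra.
by exists (Kop bp); [exact: conv_like_Kop|exact: Kop_P1].
Qed.

Lemma opP2 (S : bounded_op E) (a b : R[i]) f g k :
  a *: S f + (b *: S g + S k) = S (a *: f + (b *: g + k)).
Proof. by rewrite !opP. Qed.

Lemma conv_op_exists s : carrier_def C01 s -> exists2 K : bounded_op E,
  conv_like K & K (P 1) = V (toE E s).
Proof.
move=> cs; have [M M0 HM] := C01_le cs.
have /within_continuous_parts[cr ci] := cs.
have HR : forall x, x \in I01 -> `|complex.Re (s x)| <= M.
  by move=> x xI; have := HM x; rewrite cmod_funE xI; exact/le_trans/normc_ge_ReN.
have HI : forall x, x \in I01 -> `|complex.Im (s x)| <= M.
  by move=> x xI; have := HM x; rewrite cmod_funE xI; exact/le_trans/normc_ge_ImN.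
have [A Ac A1] := conv_like_real cr HR; have [B Bc B1] := conv_like_real ci HI.
(* The shifts of the real and the imaginary part add the constant [M +i* M] to [s]. Since V is the
   convolution by 1, subtracting that multiple of V undoes them. *)
exists (op_lin (- (M +i* M)) V (op_lin 'i%C B A)).
  by apply: conv_like_lin; [exact: conv_like_V|exact: conv_like_lin].
transitivity (- (M +i* M) *: V (P 1) + ('i%C *: B (P 1) + A (P 1))); first by [].
rewrite A1 B1; set sb := toE _ _; set sa := toE _ _.
rewrite (opP2 V) /sb /sa.
have cc (h : R -> R) : {within I01, continuous h} -> carrier_def E (creal h).
  by move=> ch; exact/C01_carrier/carrier_creal.
have cM (h : R -> R) : {within I01, continuous h} -> carrier_def E (creal (fun x => h x + M)).
  by move=> ch; apply: cc => x; apply: cvgD; [exact: ch|exact: cvg_cst].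
have c1 : carrier_def E (creal (fun x => (1 : {poly R}).[x])) by exact: carrier_poly.
have ca := cM _ cr; have cb := cM _ ci.
have cl := carrier_defD (carrier_defZ 'i%C cb) ca.
rewrite /P -(toE_lin _ cb ca) -(toE_lin _ c1 cl); congr (V (toE _ _)).
apply/funext => x; rewrite !fctE /creal hornerC; case: (s x) => u v.
by apply/eqP; rewrite eq_complex/=; apply/andP; split; apply/eqP; ring.
Qed.

Lemma conv_like_comm K L : conv_like K -> conv_like L -> forall f, K (L f) = L (K f).
Proof. by move=> [K1 _] [_ L2]; exact: L2. Qed.

(** With K the convolution by the continuous representative of V Z 1, both K and Z V^2 send 1 to V^2
    Z 1. Their difference commutes with V, so [commutant_eq0] makes it zero. *)
Lemma commutant_conv (Z : bounded_op E) : (forall f, Z (V f) = V (Z f)) ->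
  exists2 K : bounded_op E, conv_like K & forall f, K f = Z (V (V f)).
Proof.
move=> ZV; have cz := carrier_fun_of (Z (P 1)).
have [K Kc K1] := conv_op_exists (continuous_cconv_pw1 cz).
exists K => // f; apply/esym/eqP; rewrite -subr_eq0; apply/eqP.
pose D := op_lin (-1) K (op_comp Z (op_comp V V)).
have DE g : D g = Z (V (V g)) - K g by rewrite /D op_linE scaleN1r addrC.
rewrite -DE; move: D DE => D DE; apply: (@commutant_eq0 _ _ _ 0).
    move=> g.
    rewrite (DE (V g)).
    rewrite (DE g).
    rewrite (opB V).
    rewrite (conv_like_comm Kc conv_like_V).
    rewrite (ZV (V (V g))).
    rewrite (ZV (V g)).
    done.
by rewrite [iter _ _ _]/= DE K1 !ZV -VopE subrr.
Qed.

Lemma commutant_comm (S W : bounded_op E) : (forall f, S (V f) = V (S f)) ->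
  (forall f, W (V f) = V (W f)) -> forall f, S (W f) = W (S f).
Proof.
move=> SV WV f.
have [K Kc KE] := commutant_conv SV; have [L Lc LE] := commutant_conv WV.
(* S V^2 and W V^2 are convolutions and commute with each other; moving all factors V to the front
   turns this into V^4 (S W - W S) = 0. *)
apply/eqP; rewrite -subr_eq0; apply/eqP; apply: (@iter_V_inj _ _ 4) => /=.
rewrite !(opB V); have := conv_like_comm Kc Lc f.
by rewrite !KE !LE !SV !WV !SV => ->; rewrite subrr.
Qed.

End convolution_operators.

(** * Roots of powers of the Volterra operator *)

Section euler_equation.
Context {R : realType}.
Local Notation mu := (@lebesgue_measure R).
Local Notation T := (measurableTypeR R).

(** Differentiability of [r] is not given, but the equation itself writes [H y = y ^ (1 - s) r y] as
    [s y ^ (- s)] times the primitive of [r]. The derivative of this product is zero by the equation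
    again, so [H] has at [x] the same value as at 1. *)
Lemma euler_equation (r : R -> R) (s : R) : {within I01, continuous r} ->
  (forall x, 0 <= x <= 1 -> x * r x = s * \int[mu]_(t in `[0, x]) r t) ->
  forall x, 0 < x <= 1 -> r x = r 1 * x `^ (s - 1).
Proof.
move=> cr rE x /andP[x0]; rewrite le_eqVlt => /predU1P[->|x1]; first by rewrite powR1 mulr1.
pose G y := \int[mu]_(t in `[0, y]) r t.
pose H y := y `^ (1 - s) * r y.
have ir (y : R) : y <= 1 -> mu.-integrable `[0, y] (EFin \o r).
  move=> y1; apply: continuous_compact_integrable; first exact: segment_compact.
  apply: continuous_subspaceW cr; move=> z; rewrite /I01/= !in_itv/= => /andP[-> /le_trans]; exact.
have dH y : y \in `]x, 1[ -> is_derive y 1 H 0.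
  rewrite in_itv/= => /andP[xy y1]; have y0 : 0 < y by exact: lt_trans xy.
  have cy : {for y, continuous r}.
    have [c _ _] := (continuous_within_itvP r (@ltr01 R)).1 cr.
    by apply: c; rewrite in_itv/= y0.
  have [|dG GE] := continuous_FTC1 y1 (ir 1 (lexx 1)) _ cy.
    by first [exact: y0|rewrite bnd_simp].
  have dG' : is_derive y 1 G (r y) := DeriveDef dG (eq_trans (esym (derive1E _ _)) GE).
  apply: (@near_eq_is_derive _ _ _ (fun z => s * (z `^ (- s) * G z))).
    have yoo : y \in `]0, 1[ by rewrite in_itv/= y0.
    apply: filterS (near_in_itvoo yoo) => z; rewrite in_itv/= => /andP[z0 z1].
    rewrite mulrCA /G -rE ?(ltW z0) ?(ltW z1)// mulrA /H; congr (_ * _).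
    by rewrite -[X in _ * X]powRr1 ?(ltW z0)// -powRD ?(gt_eqF z0) ?implybT// addrC.
  have dp := is_derive1_powR (- s) y0.
  have := is_deriveZ s (is_deriveM dp dG').
  have sG : s * G y = y * r y by rewrite rE// (ltW y0) (ltW y1).
  have yp : y * y `^ (- s - 1) = y `^ (- s).
    rewrite -[X in X * _]powRr1 ?(ltW y0)// -powRD ?(gt_eqF y0) ?implybT//.
    by congr (_ `^ _); ring.
  have e0 : s *: (y `^ (- s) *: r y + G y *: (- s * y `^ (- s - 1))) = 0.
    rewrite -yp /GRing.scale/=.
    transitivity (s * y `^ (- s - 1) * (y * r y - s * G y)); first by ring.
    by rewrite sG subrr mulr0.
  by rewrite e0.
have cH : {within `[x, 1], continuous H}.
  have c1 : {within `[x, 1], continuous (fun y : R => y `^ (1 - s))}.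
    apply: continuous_in_subspaceT => y /set_mem; rewrite /= in_itv/= => /andP[xy _].
    by apply: continuous_powR_gt0; exact: lt_le_trans xy.
  have c2 : {within `[x, 1], continuous r}.
    apply: continuous_subspaceW cr; move=> z; rewrite /I01/= !in_itv/= => /andP[xz ->].
    by rewrite andbT; exact: le_trans (ltW x0) xz.
  by move=> y; exact: (cvgM (c1 y) (c2 y)).
have [c _] := MVT x1 dH cH.
rewrite mul0r /H powR1 mul1r => /eqP; rewrite subr_eq0 => /eqP ->.
rewrite mulrAC -powRD ?(gt_eqF x0) ?implybT//.
by rewrite (_ : 1 - s + (s - 1) = 0) ?powRr0 ?mul1r//; ring.
Qed.
End euler_equation.

(** * Leibniz' rule for commutators *)

Section commutators.
Context {R : realType} {U : normedModType R[i]}.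
Implicit Types A D M : bounded_op U.

(** Leibniz' rule for the derivation [M, .]: the [k + 1] terms are equal because D commutes with
    A. *)
Lemma commutator_iter M A D : (forall f, M (A f) = A (M f) + D f) ->
  (forall f, A (D f) = D (A f)) -> forall k f,
  M (iter k.+1 A f) = iter k.+1 A (M f) + k.+1%:R *: iter k A (D f).
Proof.
move=> MA AD; elim=> [|k IH] f; first by rewrite /= MA scale1r.
have itD j g : iter j A (D g) = D (iter j A g) by elim: j => //= j ->.
rewrite iterS MA IH opD opZ -!iterS -addrA -itD; congr (_ + _).
by rewrite -[X in _ + X]scale1r -scalerDl natr1.
Qed.

Lemma iter_op_lin A (c : R[i]) k f : iter k A (c *: f) = c *: iter k A f.
Proof. by elim: k => //= k ->; rewrite opZ. Qed.

Lemma iter_opB A k f g : iter k A (f - g) = iter k A f - iter k A g.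
Proof. by elim: k => //= k ->; rewrite opB. Qed.

End commutators.

(** * The derivation applied to a root of a power of V *)

Section roots.
Context {R : realType}.
Local Notation C := (R[i]^o).
Variable E : fspace R.
Implicit Types (f g : E) (A : bounded_op E).
Local Notation V := (volterra E).
Local Notation M := (Mop E).
Local Notation P := (polyE E).

Lemma root_derivation A k l : (forall f, A (V f) = V (A f)) ->
  (forall f, iter k.+1 A f = iter l.+1 V f) ->
  forall f, k.+1%:R *: (M (A f) - A (M f)) = (l.+1%:R : R[i]) *: A (V f).
Proof.
move=> AV AkV f.
pose D := op_lin (-1) (op_comp A M) (op_comp M A).
have DE g : D g = M (A g) - A (M g) by rewrite /D op_linE scaleN1r addrC.
move: D DE => D DE.
have MA g : M (A g) = A (M g) + D g by rewrite DE addrC subrK.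
have DV g : D (V g) = V (D g).
  by rewrite (DE (V g)) (DE g) AV !Mop_V (opD A) !AV (opB V) opprD addrACA subrr addr0.
have AD := commutant_comm AV DV.
have h1 := commutator_iter MA AD k f.
have h2 := commutator_iter (D := op_comp V V) (@Mop_V R E) (fun _ => erefl) l f.
rewrite !AkV h2 in h1; move/addrI: h1 => h1.
rewrite -DE; apply/eqP; rewrite -subr_eq0; apply/eqP.
(* The factor A^k left by Leibniz' rule is removed by completing it to A^(k + 1) = V^(l + 1), which
   is injective. *)
apply: (@iter_V_inj _ _ l.+1); rewrite -AkV iterS iter_opB !iter_op_lin -h1 op_compE.
have -> : iter k A (A (V f)) = iter l V (V (V f)) by rewrite -iterSr AkV iterSr.
by rewrite subrr op0.
Qed.

Lemma mulx_P1 : M (P 1) = V (P 1).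
Proof.
have := V_PXn E 0; rewrite expr0 invr1 scale1r expr1 => ->.
have -> : M (P 1) = toE E (mulx (creal (fun x => (1 : {poly R}).[x]))).
  by apply: Mop_toE; exact: carrier_poly.
by congr toE; apply/funext => x; rewrite /mulx /creal hornerC hornerX mulr1.
Qed.

(** The quotient comes from [M, A] = q A V, and the 2 from M V 1 = V M 1 + V^2 1 = 2 V^2 1. *)
Lemma root_equation A k l : (forall f, A (V f) = V (A f)) ->
  (forall f, iter k.+1 A f = iter l.+1 V f) ->
  M (A (V (P 1))) = ((2 + l.+1%:R / k.+1%:R)%:C : R[i]) *: V (A (V (P 1))).
Proof.
move=> AV AkV; have h := root_derivation AV AkV (V (P 1)).
have k0 : (k.+1%:R : R[i]) != 0 by rewrite pnatr_eq0.
apply: (scalerI k0); rewrite scalerA.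
move/eqP: h; rewrite scalerBr subr_eq => /eqP ->.
rewrite Mop_V mulx_P1 (AV (V (P 1))) (opD A) !AV scalerDr addrA -!scalerDl.
congr (_ *: _); rewrite rmorphD/= rmorphM fmorphV/= !rmorph_nat.
by field.
Qed.

End roots.

(** * Powers of x, the semigroup law of N, and uniqueness of roots *)

Section powers.
Context {R : realType}.
Local Notation mu := (@lebesgue_measure R).
Local Notation C := (R[i]^o).
Implicit Types f g : R -> C.

Lemma eq_carrierC f g : {in I01, f =1 g} -> carrier_def C01 f -> carrier_def C01 g.
Proof.
move=> fg /within_continuousC cf; apply/within_continuousC => x e xI e0.
have [d d0 Hd] := cf x e xI e0; exists d => // y yI xy.
by rewrite -!fg; [exact: Hd|exact: mem_set..].
Qed.

Definition cpow (b : R) : R -> C := creal (fun x => x `^ b).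

Lemma rl_cpow (a b : R) : 0 < a -> 0 <= b ->
  {in I01, rl a (cpow b) =1 (Gamma (b + 1) / Gamma (a + b + 1))%:C *: cpow (a + b)}.
Proof.
move=> a0 b0 x; rewrite in_I01 => xI.
have rE : rpart (cpow b) = (fun t : R => t `^ b) \_ I01 by [].
have iE : ipart (cpow b) = fun=> 0 by apply/funext => t; rewrite /ipart patchE; case: ifP.
rewrite /rl !fctE /cconv rE iE conv_powR//.
rewrite (_ : conv _ (fun=> 0) x = 0); last first.
  by rewrite /conv; under eq_Rintegral do rewrite mulr0; rewrite Rintegral_cst// mul0r.
have g0 := Gamma_gt0 a0; rewrite /cpow /creal.
transitivity (((Gamma a)^-1 * (Gamma a * Gamma (b + 1) / Gamma (a + b + 1) * x `^ (a + b)))%:C).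
  by rewrite [RHS]rmorphM.
rewrite /GRing.scale/= -[RHS]rmorphM; congr (_%:C).
by rewrite !mulrA mulVf ?mul1r// gt_eqF.
Qed.

Lemma cpow0 : cpow 0 = creal (fun x => (1 : {poly R}).[x]).
Proof. by apply/funext => x; rewrite /cpow /creal powRr0 hornerC. Qed.

(** Continuity of [x ^ b], at 0 in particular, is inherited from fractional integrals: for [b > 0]
    the function is a multiple of the integral of order [b] of 1. *)
Lemma carrier_cpow b : 0 <= b -> carrier_def C01 (cpow b).
Proof.
have c0 : carrier_def C01 (cpow 0) by rewrite cpow0; exact: carrier_poly.
rewrite le_eqVlt => /predU1P[<-//|b0].
have g1 : 0 < Gamma (b + 1) by apply: Gamma_gt0; lra.
apply: (@eq_carrierC ((Gamma (b + 1))%:C *: rl b (cpow 0))); last first.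
  by apply: carrier_defZ; exact: carrier_rl.
move=> x xI; rewrite fctE rl_cpow// fctE scalerA addr0 add0r Gamma1 -rmorphM.
by rewrite mul1r divff ?gt_eqF// scale1r.
Qed.

Variable E : fspace R.

Lemma Nop_cpow a b : 0 < a -> 0 <= b -> Nop E a (toE E (cpow b)) =
  ((Gamma (b + 1) / Gamma (a + b + 1))%:C : R[i]) *: toE E (cpow (a + b)).
Proof.
move=> a0 b0; have cb := C01_carrier E (carrier_cpow b0).
have ab0 : 0 <= a + b by apply: addr_ge0 => //; exact: ltW.
have cab := C01_carrier E (carrier_cpow ab0).
rewrite Nop_toE// -toEZ//; apply: toE_eq.
- exact: carrier_rl.
- exact: carrier_defZ.
- by apply: aeW => x /mem_set; exact: rl_cpow.
Qed.

Lemma P1_cpow : polyE E 1 = toE E (cpow 0).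
Proof. by rewrite cpow0. Qed.

(** N_a N_b - N_(a + b) commutes with V, and it kills 1 by the Beta integral; so [commutant_eq0]
    applies with [m = 0]. *)
Lemma Nop_add a b (u : E) : 0 < a -> 0 < b -> Nop E a (Nop E b u) = Nop E (a + b) u.
Proof.
move=> a0 b0; have ab0 : 0 < a + b by rewrite addr_gt0.
pose D := op_lin (-1) (Nop E (a + b)) (op_comp (Nop E a) (Nop E b)).
have DE (g : E) : D g = Nop E a (Nop E b g) - Nop E (a + b) g by rewrite /D op_linE scaleN1r addrC.
move: D DE => D DE; apply/eqP; rewrite -subr_eq0 -DE; apply/eqP.
apply: (@commutant_eq0 _ _ _ 0).
  by move=> g; rewrite (DE (volterra E g)) (DE g) !Nop_V// (opB (volterra E)).
rewrite [iter _ _ _]/= DE P1_cpow !Nop_cpow// opZ Nop_cpow ?addr0//; last exact: ltW.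
rewrite scalerA -rmorphM add0r.
have gb : 0 < Gamma (b + 1) by apply: Gamma_gt0; lra.
by rewrite mulrA divfK ?gt_eqF// subrr.
Qed.

Lemma toE_inj f g : carrier_def C01 f -> carrier_def C01 g -> toE E f = toE E g ->
  {in I01, f =1 g}.
Proof.
move=> cf cg fg; apply: continuous_ae_eq; [exact: cf|exact: cg|apply: (@ae_same _ E)].
have := toEP (C01_carrier E cg); rewrite -fg; apply: same_trans.
by apply/same_sym/toEP/C01_carrier.
Qed.

Lemma toE_cpow_neq0 b : 0 <= b -> toE E (cpow b) != 0.
Proof.
move=> b0; apply/eqP => E0; have cb := carrier_cpow b0.
have := @toE_inj (cpow b) (0%:C *: cpow b) cb (carrier_defZ _ cb).
rewrite toEZ; last exact: C01_carrier.
rewrite E0 scaler0 => /(_ erefl 1); rewrite in_I01 lexx ler01 => /(_ isT).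
rewrite !fctE scale0r /cpow /creal powR1 => -[/eqP].
by rewrite oner_eq0.
Qed.

Lemma ae_toE f g : carrier_def C01 f -> carrier_def C01 g ->
  (forall x, 0 < x <= 1 -> f x = g x) -> toE E f = toE E g.
Proof.
move=> cf cg fg; apply: toE_eq; [exact: C01_carrier|exact: C01_carrier|].
have FF := @ae_filter_ringOfSetsType _ (measurableTypeR R) R mu.
have : {ae mu, forall x, x != 0}.
  exists [set 0]; split; [exact: measurable_set1|exact: lebesgue_measure_set1|].
  by move=> x /= /negP; rewrite negbK => /eqP.
apply: (@filterS _ _ FF) => x x0 /mem_set; rewrite in_I01 => /andP[x0' x1].
by apply: fg; rewrite lt_neqAle eq_sym x0 x0'.
Qed.

Lemma complex_euler f (s : R) : carrier_def C01 f ->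
  {in I01, mulx f =1 s%:C *: cconv (pw 1) f} ->
  forall x, 0 < x <= 1 -> f x = f 1 * (x `^ (s - 1))%:C.
Proof.
move=> cf fE x x01; have /within_continuous_parts[cr ci] := cf.
have [mr mi] := measurable_parts cf.
have pE (h : R -> R) y : \int[mu]_(t in `[0, y]) ((y - t) `^ (1 - 1) * h t) = \int[mu]_(t in `[0, y]) h t.
  by apply: eq_Rintegral => t _; rewrite subrr powRr0 mul1r.
have hr : forall y, 0 <= y <= 1 -> y * complex.Re (f y) = s * \int[mu]_(t in `[0, y]) complex.Re (f t).
  move=> y yI; have := fE y; rewrite in_I01 yI => /(_ isT) /(congr1 (@complex.Re R)).
  rewrite /mulx fctE /cconv (conv_restrictE 1 yI mr) pE.
  by case: (f y) => u v /=; rewrite !mul0r !subr0.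
have hi : forall y, 0 <= y <= 1 -> y * complex.Im (f y) = s * \int[mu]_(t in `[0, y]) complex.Im (f t).
  move=> y yI; have := fE y; rewrite in_I01 yI => /(_ isT) /(congr1 (@complex.Im R)).
  rewrite /mulx fctE /cconv (conv_restrictE 1 yI mi) pE.
  by case: (f y) => u v /=; rewrite !mul0r !addr0.
apply/eqP; rewrite eq_complex (euler_equation cr hr x01) (euler_equation ci hi x01).
by case: (f 1) => u v /=; rewrite !mulr0 subr0 add0r !eqxx.
Qed.

Lemma root_eq_Nop (A : bounded_op E) k l : (forall u, A (volterra E u) = volterra E (A u)) ->
  (forall u, iter k.+1 A u = iter l.+1 (volterra E) u) ->
  exists w : R[i], forall u, A u = w *: Nop E (l.+1%:R / k.+1%:R) u.
Proof.
move=> AV AkV; set q : R := l.+1%:R / k.+1%:R.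
have q0 : 0 < q by rewrite divr_gt0.
have q1 : 0 <= q + 1 by apply: addr_ge0 => //; exact: ltW.
(* The continuous representative of V A 1 = A V 1. *)
pose F := cconv (pw 1) (fun_of (A (polyE E 1))).
have cF : carrier_def C01 F by apply: continuous_cconv_pw1; exact: carrier_fun_of.
have EF := C01_carrier E cF.
have AF : A (volterra E (polyE E 1)) = toE E F by rewrite AV VopE.
have eqF : {in I01, mulx F =1 (2 + q)%:C *: cconv (pw 1) F}.
  apply: toE_inj; first exact: (@carrier_mulx R C01).
    by apply: carrier_defZ; exact: continuous_cconv_pw1 EF.
  rewrite -(Mop_toE EF) toEZ ?Vop_toE -?(Vop_toE EF); last first.
    by apply: C01_carrier; exact: continuous_cconv_pw1 EF.
  by rewrite -AF; exact: root_equation.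
have Fx : toE E F = F 1 *: toE E (cpow (q + 1)).
  rewrite -toEZ; last exact/C01_carrier/carrier_cpow.
  apply: ae_toE; [exact: cF|exact/carrier_defZ/carrier_cpow|].
  move=> x x01; rewrite (complex_euler cF eqF x01) fctE /cpow /creal.
  by congr (_ * (_ `^ _)%:C); ring.
have NV : Nop E q (volterra E (polyE E 1)) = ((Gamma (q + 1 + 1))^-1)%:C *: toE E (cpow (q + 1)).
  rewrite /volterra P1_cpow (Nop_cpow ltr01 (lexx 0)) opZ addr0.
  rewrite (Nop_cpow q0 ler01) scalerA -rmorphM add0r Gamma1; congr (_%:C *: _).
  have g2 : 0 < Gamma (1 + 1 : R) by apply: Gamma_gt0; lra.
  by rewrite mulrA divfK ?gt_eqF// mul1r.
have gq : 0 < Gamma (q + 1 + 1) by apply: Gamma_gt0; lra.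
(* [F] is [F 1] times [x ^ (q + 1)], and N_q V 1 is the same power divided by [Gamma (q + 2)]; [w]
   is the ratio of the two. *)
exists (F 1 * (Gamma (q + 1 + 1))%:C) => u; set w := F 1 * _.
pose D := op_lin (- w) (Nop E q) A.
have DE (g : E) : D g = A g - w *: Nop E q g by rewrite /D op_linE scaleNr addrC.
move: D DE => D DE; apply/eqP; rewrite -subr_eq0 -DE; apply/eqP.
apply: (@commutant_eq0 _ _ _ 1).
  by move=> g; rewrite (DE (volterra E g)) (DE g) AV (Nop_V _ q0) (opB (volterra E)) opZ.
rewrite [iter _ _ _]/= DE NV AF Fx scalerA -[w * _]mulrA -rmorphM.
by rewrite divff ?gt_eqF// mulr1 subrr.
Qed.

Lemma iter_Nop k a (u : E) : 0 < a -> iter k.+1 (Nop E a) u = Nop E (k.+1%:R * a) u.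
Proof.
move=> a0; elim: k => [|k IH]; first by rewrite mul1r.
rewrite iterS IH Nop_add//; last by rewrite mulr_gt0.
by congr (Nop E _ _); rewrite -(natr1 k.+1) mulrDl mul1r addrC.
Qed.

Lemma iter_V l (u : E) : iter l.+1 (volterra E) u = Nop E (l.+1%:R) u.
Proof. by rewrite iter_Nop// mulr1. Qed.

End powers.

(** * Continuity in the order *)

Section norm_continuity.
Context {R : realType}.
Variable E : fspace R.
Implicit Types (f : E) (a b : R).
Local Notation N := (Nop E).

Let K a f : E := toE E (cconv (pw a) (fun_of f)).

Let carrier_K a (h : R -> R[i]^o) : 0 < a -> carrier_def E h -> carrier_def E (cconv (pw a) h).
Proof.
by move=> a0; exact: (carrier_cconv (measurable_pw a) (fun u _ => pw_ge0 a u) (integral_pw_le a0)).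
Qed.

Let NopK a f : 0 < a -> N a f = ((Gamma a)^-1)%:C *: K a f.
Proof.
by move=> a0; rewrite NopE// /rl toEZ//; apply: carrier_K => //; exact: carrier_fun_of.
Qed.

Let norm_K a f : 0 < a -> `|K a f| <= (2 * a^-1)%:C * `|f|.
Proof.
move=> a0; have cf := carrier_fun_of f.
rewrite norm_toE; last exact: carrier_K.
rewrite normE -rmorphM lecR.
exact: (seminorm_cconv (measurable_pw a) (fun u _ => pw_ge0 a u) (integral_pw_le a0) cf).
Qed.

Let norm_KB a b f : 0 < a -> 0 < b -> `|K b f - K a f| <= (2 * `|a^-1 - b^-1|)%:C * `|f|.
Proof.
suff H (c d : R) : 0 < c -> 0 < d -> c <= d -> `|K c f - K d f| <= (2 * `|c^-1 - d^-1|)%:C * `|f|.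
  move=> a0 b0; have [ab|/ltW ba] := leP a b.
    by rewrite distrC; exact: H.
  by rewrite [in `|a^-1 - _|]distrC; exact: H.
move=> c0 d0 cd; have cf := carrier_fun_of f.
have dc : 0 <= c^-1 - d^-1 by rewrite subr_ge0 lef_pV2.
have ckc := carrier_K c0 cf; have ckd := carrier_K d0 cf.
have pB0 u := @pwB_ge0 _ c d u cd.
have cB := carrier_cconv (measurable_pwB c d) pB0 (integral_pwB_le c0 d0) cf.
have -> : K c f - K d f = toE E (cconv (pwB c d) (fun_of f)).
  rewrite -scaleN1r addrC /K -toE_lin//; apply: toE_eq => //.
    exact: carrier_defD (carrier_defZ (-1) ckd) ckc.
  have FF := @ae_filter_ringOfSetsType _ (measurableTypeR R) R (@lebesgue_measure R).
  apply: (@filterS _ _ FF) (cconv_pwB c0 d0 cf) => x h xI.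
  by rewrite (h xI) !fctE scaleN1r addrC.
rewrite norm_toE// normE -rmorphM lecR ger0_norm//.
exact: (seminorm_cconv (measurable_pwB c d) pB0 (integral_pwB_le c0 d0) cf).
Qed.

(** A bound for the operator norm of N_b - N_a: the first summand accounts for the change of the
    kernel, the second for the change of the Gamma factor. *)
Definition gap a b : R :=
  (Gamma b)^-1 * (2 * `|a^-1 - b^-1|) + `|(Gamma b)^-1 - (Gamma a)^-1| * (2 * a^-1).

Let normcR (x : R) : `|x%:C| = `|x|%:C.
Proof. by apply/eqP; rewrite eq_complex/= expr0n/= addr0 sqrtr_sqr !eqxx. Qed.

Lemma Nop_dist a b f : 0 < a -> 0 < b -> `|N b f - N a f| <= (gap a b)%:C * `|f|.
Proof.
move=> a0 b0; rewrite !NopK//.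
have -> : ((Gamma b)^-1)%:C *: K b f - ((Gamma a)^-1)%:C *: K a f =
    ((Gamma b)^-1)%:C *: (K b f - K a f) + ((Gamma b)^-1 - (Gamma a)^-1)%:C *: K a f.
  by rewrite scalerBr rmorphB scalerBl addrA subrK.
apply: le_trans (ler_normD _ _) _; rewrite !normrZ !normcR rmorphD mulrDl !rmorphM/= -!mulrA.
have gb : 0 <= (Gamma b)^-1 by rewrite invr_ge0 ltW// Gamma_gt0.
rewrite (ger0_norm gb); apply: lerD; apply: ler_wpM2l; rewrite ?lecR//.
- by have := norm_KB f a0 b0; rewrite rmorphM -mulrA.
- by have := norm_K f a0; rewrite rmorphM -mulrA.
Qed.

Lemma norm_Nop a f : 0 < a -> `|N a f| <= ((Gamma a)^-1 * (2 * a^-1))%:C * `|f|.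
Proof.
move=> a0; have gb : 0 <= (Gamma a)^-1 by rewrite invr_ge0 ltW// Gamma_gt0.
rewrite NopK// normrZ normcR (ger0_norm gb) rmorphM -mulrA.
by apply: ler_wpM2l; [rewrite lecR|exact: norm_K].
Qed.

Lemma cvg_gap a : 0 < a -> gap a b @[b --> a] --> 0.
Proof.
move=> a0; have ga := Gamma_gt0 a0.
have an0 : a != 0 by rewrite gt_eqF.
have cG : (Gamma b)^-1 @[b --> a] --> (Gamma a)^-1.
  by apply: cvgV; [rewrite gt_eqF|exact: continuous_Gamma].
have ci : b^-1 @[b --> a] --> a^-1 by apply: cvgV => //; exact: cvg_id.
rewrite -[X in _ --> X](_ : gap a a = _); last by rewrite /gap !subrr normr0 !mulr0 mul0r addr0.
apply: cvgD; apply: cvgM => //.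
- by apply: cvgM; [exact: cvg_cst|apply: cvg_norm; apply: cvgB; [exact: cvg_cst|]].
- by apply: cvg_norm; exact: (cvgB cG (cvg_cst _)).
- exact: cvg_cst.
Qed.

Lemma opdist_le (S W : bounded_op E) (c : R) : 0 <= c ->
  (forall f, `|S f - W f| <= c%:C * `|f|) -> opdist S W <= c.
Proof.
move=> c0 H; apply: ge_sup; first by exists (complex.Re `|S 0 - W 0|), 0 => //=; rewrite normr0 ler01.
move=> _ [f f1 <-]; have : `|S f - W f| <= c%:C.
  by apply: le_trans (H f) _; rewrite -[X in _ <= X]mulr1; apply: ler_wpM2l; [rewrite lecR|exact: f1].
by rewrite normE lecR.
Qed.

End norm_continuity.

(** * Passing to the limit with the metric of axiom (iii) *)

Section closedness.
Context {R : realType}.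
Variable E : fspace R.
Variable J : R -> bounded_op E.
Variable d : bounded_op E -> bounded_op E -> R.
Hypothesis d_metric : is_metric d.
Hypothesis d_weaker : weaker_metric d (@opdist R E).
Hypothesis J_cont : forall a : R, 0 < a -> d (J a) (J b) @[b --> a] --> 0.
Local Notation N := (Nop E).

(** A ball of [d] is open for [d], hence for the operator norm: this turns the inclusion of
    topologies into an estimate at [S]. *)
Lemma weaker_ball (S : bounded_op E) (r : R) : 0 < r ->
  exists2 e : R, 0 < e & forall W, opdist S W < e -> d S W < r.
Proof.
move=> r0; have ob : metric_open d (fun W => d S W < r).
  move=> W SW; exists (r - d S W); first by rewrite subr_gt0.
  by move=> X WX; apply: le_lt_trans (Defs.metric_triangle d_metric S W X) _; rewrite -ltrBrDl.
by apply: (d_weaker ob); rewrite (Defs.metric_eq0 d_metric S S).2.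
Qed.

(** For [b] near [a] and [z] near [w], [J b] is close to [J a] for [d] by the continuity axiom. It
    equals [z N_b], which is close to [w N_a] in norm, hence for [d]. So [d (J a) (w N_a)] is below
    every positive [r]. *)
Lemma J_closed a (w : R[i]) : 0 < a ->
  (forall e : R, 0 < e -> exists (b : R) (z : R[i]), [/\ 0 < b, `|a - b| < e, normc (z - w) < e &
     forall f, J b f = z *: N b f]) ->
  forall f, J a f = w *: N a f.
Proof.
move=> a0 H.
pose S := op_lin (w - 1) (N a) (N a).
have SE f : S f = w *: N a f by rewrite /S op_linE scalerBl scale1r subrK.
move: S SE => S SE.
suff -> : J a = S by exact: SE.
apply/(Defs.metric_eq0 d_metric)/eqP; rewrite eq_le (Defs.metric_ge0 d_metric) andbT.
apply/ler_addgt0Pr => r r0; rewrite add0r.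
have r2 : 0 < r / 2 by rewrite divr_gt0.
have [e e0 He] := weaker_ball S r2.
have wn : 0 <= normc w by exact: normc_ge0.
pose B : R := (Gamma a)^-1 * (2 * a^-1).
have B0 : 0 <= B by rewrite mulr_ge0 ?invr_ge0 ?(ltW (Gamma_gt0 a0))// mulr_ge0 ?invr_ge0 ?ltW.
have /cvgrPdist_lt/(_ _ r2) c1 := J_cont a0.
have e1 : 0 < e / 2 / (normc w + 1) by rewrite divr_gt0 ?divr_gt0//; lra.
have /cvgrPdist_lt/(_ _ e1) c2 := cvg_gap a0.
have [e' e'0 He'] : exists2 e' : R, 0 < e' & forall b, `|a - b| < e' ->
    d (J a) (J b) < r / 2 /\ `|gap a b| < e / 2 / (normc w + 1).
  have := filterI c1 c2; rewrite -nbhs_ballE => -[e' /= e'0 h]; exists e' => // b ab.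
  have [h1 h2] := h b ab; rewrite !sub0r !normrN in h1 h2; split => //.
  exact: le_lt_trans (ler_norm _) h1.
have e40 : 0 < e / 4 / (B + 1) by rewrite !divr_gt0//; lra.
(* The [1] keeps [|z|] below [|w| + 1]. With the other two bounds the summands z (N_b - N_a) and (z
   - w) N_a have norms at most [e / 2] and [e / 4], together less than [e]. *)
pose m := Num.min e' (Num.min 1 (e / 4 / (B + 1))).
have m0 : 0 < m by rewrite !lt_min e'0 ltr01 e40.
have [b [z [b0 + + Jb]]] := H m m0.
rewrite !lt_min => /andP[/He'[dab gab] _] /and3P[_ zw1 zw2].
have zn : normc z <= normc w + 1.
  by have := le_normcD (z - w) w; rewrite subrK; lra.
apply: le_trans (Defs.metric_triangle d_metric _ (J b) _) _.
rewrite [r]splitr; apply: lerD; first exact: ltW.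
rewrite (Defs.metric_sym d_metric); apply/ltW/He; apply: (@le_lt_trans _ _ (e / 2 + e / 4)); last by lra.
apply: opdist_le => [|f]; first by lra.
rewrite SE Jb distrC.
have -> : z *: N b f - w *: N a f = z *: (N b f - N a f) + (z - w) *: N a f.
  by rewrite scalerBr scalerBl addrA subrK.
apply: le_trans (ler_normD _ _) _; rewrite !normrZ rmorphD mulrDl; apply: lerD.
  apply: (@le_trans _ _ ((normc z)%:C * ((gap a b)%:C * `|f|))).
    by apply: ler_wpM2l; [rewrite lecR normc_ge0|exact: Nop_dist].
  rewrite mulrA -rmorphM; apply: ler_wpM2r; [exact: normr_ge0|rewrite lecR].
  have g1 : gap a b <= e / 2 / (normc w + 1) by exact: le_trans (ler_norm _) (ltW gab).
  apply: (@le_trans _ _ ((normc w + 1) * (e / 2 / (normc w + 1)))).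
    apply: (@le_trans _ _ (normc z * (e / 2 / (normc w + 1)))).
      by apply: ler_wpM2l => //; exact: normc_ge0.
    by apply: ler_wpM2r => //; exact: ltW.
  by rewrite mulrC divfK// gt_eqF//; lra.
apply: (@le_trans _ _ ((normc (z - w))%:C * (B%:C * `|f|))).
  by apply: ler_wpM2l; [rewrite lecR normc_ge0|exact: norm_Nop].
rewrite mulrA -rmorphM; apply: ler_wpM2r; [exact: normr_ge0|rewrite lecR].
apply: (@le_trans _ _ (e / 4 / (B + 1) * (B + 1))).
  by apply: ler_pM; [exact: normc_ge0|exact: B0|exact: ltW|lra].
by rewrite divfK// gt_eqF//; lra.
Qed.

End closedness.

(** * Cluster points of bounded families of scalars *)

Section cluster.
Context {R : realType}.

Lemma le_normc_parts_lt (z w : R[i]) (e : R) :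
  `|complex.Re z - complex.Re w| < e / 2 -> `|complex.Im z - complex.Im w| < e / 2 ->
  normc (z - w) < e.
Proof.
move=> h1 h2; apply: le_lt_trans (normc_le_parts _) _; rewrite [e]splitr.
by case: z w h1 h2 => ? ? [? ?] /= h1 h2; exact: ltrD.
Qed.

Lemma increasing_seq_ge (f : nat -> nat) : increasing_seq f -> forall n, (n <= f n)%N.
Proof.
move=> fi; elim=> [//|n IH]; apply: leq_ltn_trans IH _.
by have := fi n.+1 n; rewrite !leEnat ltnn ltnNge => ->.
Qed.

Lemma bounded_fun_le1 (u : nat -> R) : (forall n, `|u n| <= 1) -> bounded_fun u.
Proof. by move=> u1; exists 1; split=> // M M1 n _ /=; exact: le_trans (u1 n) (ltW M1). Qed.

(** Bolzano-Weierstrass for the real parts, then along the subsequence for the imaginary parts. [S]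
    is a relation so that the statement serves both for the existence of the coefficient at [a] and
    for its continuity there. *)
Lemma cluster_point (a : R) (S : R -> R[i] -> Prop) :
  (forall e : R, 0 < e -> exists b z, [/\ `|a - b| < e, normc z <= 1 & S b z]) ->
  exists w, forall e : R, 0 < e -> exists b z, [/\ `|a - b| < e, normc (z - w) < e & S b z].
Proof.
move=> H.
have /choice[u Hu] : forall n, exists p : R * R[i],
    [/\ `|a - p.1| < n.+1%:R^-1, normc p.2 <= 1 & S p.1 p.2].
  have n0 n : (0 : R) < n.+1%:R^-1 by rewrite invr_gt0.
  by move=> n; have [b [z h]] := H _ (n0 n); exists (b, z).
have [|f fi cf] := @bolzano_weierstrass R (fun n => complex.Re (u n).2).
  by apply: bounded_fun_le1 => n; have [_ h _] := Hu n; exact: le_trans (normc_ge_ReN _) h.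
have [|g gi cg] := @bolzano_weierstrass R (fun n => complex.Im (u (f n)).2).
  by apply: bounded_fun_le1 => n; have [_ h _] := Hu (f n); exact: le_trans (normc_ge_ImN _) h.
pose v1 := limn ((fun n => complex.Re (u n).2) \o f).
pose v2 := limn ((fun n => complex.Im (u (f n)).2) \o g).
exists (v1 +i* v2) => e e0; have e2 : 0 < e / 2 by rewrite divr_gt0.
have /cvgrPdist_lt/(_ _ e2)[N1 _ h1] : ((fun n => complex.Re (u n).2) \o f) x @[x --> \oo] --> v1 by exact: cf.
have /cvgrPdist_lt/(_ _ e2)[N2 _ h2] : ((fun n => complex.Im (u (f n)).2) \o g) x @[x --> \oo] --> v2 by exact: cg.
pose N3 := Num.truncn e^-1.
pose k := maxn N1 (maxn N2 N3); pose m := f (g k).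
have kg : (k <= g k)%N by exact: increasing_seq_ge.
have gf : (g k <= m)%N by exact: increasing_seq_ge.
have [ua _ us] := Hu m.
exists (u m).1, (u m).2; split=> //.
- apply: lt_le_trans ua _; rewrite invf_ple ?posrE//.
  have := real_truncnS_gt (num_real e^-1) => /ltW /le_trans; apply.
  by rewrite ler_nat ltnS; apply: leq_trans (leq_trans _ kg) gf; rewrite !leq_max leqnn !orbT.
- apply: le_normc_parts_lt => /=; rewrite distrC.
    by apply: h1 => /=; apply: leq_trans kg; rewrite leq_maxl.
  by apply: h2 => /=; rewrite !leq_max leqnn orbT.
Qed.

End cluster.

(** * The coefficient of J a with respect to N a *)

Section semigroup.
Context {R : realType}.
Local Notation mu := (@lebesgue_measure R).
Variable E : fspace R.
Variable J : R -> bounded_op E.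
Hypothesis J_one : forall f : E, {ae mu, forall x, x \in I01 ->
  fun_of (J 1 f) x = cintegral `[0, x] (fun_of f)}.
Hypothesis J_add : forall a b : R, 0 < a -> 0 < b -> J a \o J b =1 J (a + b).
Variable d : bounded_op E -> bounded_op E -> R.
Hypothesis d_metric : is_metric d.
Hypothesis d_weaker : weaker_metric d (@opdist R E).
Hypothesis J_cont : forall a : R, 0 < a -> d (J a) (J b) @[b --> a] --> 0.
Local Notation N := (Nop E).
Local Notation V := (volterra E).

Lemma cintegral_cconv f x : carrier_def E f -> x \in I01 ->
  cintegral `[0, x] f = cconv (pw 1) f x.
Proof.
move=> /measurable_parts[mr mi]; rewrite in_I01 => xI.
rewrite /cintegral /cconv !conv_restrictE//.
by congr (_ +i* _); apply: eq_Rintegral => t _; rewrite subrr powRr0 mul1r.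
Qed.

Lemma J1 f : J 1 f = V f.
Proof.
rewrite VopE -[LHS]toE_fun; have cf := carrier_fun_of f.
apply: toE_eq; [exact: carrier_fun_of|exact: (C01_carrier E (continuous_cconv_pw1 cf))|].
have FF := @ae_filter_ringOfSetsType _ (measurableTypeR R) R mu.
apply: (@filterS _ _ FF) (J_one f) => x h /mem_set xI.
by rewrite (h xI) cintegral_cconv.
Qed.

Lemma J_V a f : 0 < a -> J a (V f) = V (J a f).
Proof.
by move=> a0; rewrite -!J1; have := J_add a0 ltr01 f; have := J_add ltr01 a0 f => /= -> ->; rewrite addrC.
Qed.

Lemma iter_J k a f : 0 < a -> iter k.+1 (J a) f = J (k.+1%:R * a) f.
Proof.
move=> a0; elim: k => [|k IH]; first by rewrite mul1r.
rewrite iterS IH; have k0 : 0 < k.+1%:R * a by rewrite mulr_gt0.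
have := J_add a0 k0 f => /= ->.
by rewrite -(natr1 k.+1) mulrDl mul1r addrC.
Qed.

Definition represents a (z : R[i]) := forall f, J a f = z *: N a f.

Lemma Nop_P1_neq0 a : 0 < a -> N a (polyE E 1) != 0.
Proof.
move=> a0; rewrite P1_cpow Nop_cpow// addr0 add0r Gamma1 scaler_eq0 negb_or.
rewrite toE_cpow_neq0 ?(ltW a0)// andbT eq_complex/= eqxx andbT.
by rewrite mulf_neq0 ?oner_eq0// invr_eq0 gt_eqF// Gamma_gt0// addr_gt0.
Qed.

Lemma represents_uniq a z w : 0 < a -> represents a z -> represents a w -> z = w.
Proof.
move=> a0 za wa; apply/eqP; rewrite -subr_eq0.
have : (z - w) *: N a (polyE E 1) = 0 by rewrite scalerBl -za -wa subrr.
by move/eqP; rewrite scaler_eq0 (negbTE (Nop_P1_neq0 a0)) orbF.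
Qed.

Lemma represents_rat k l : exists2 w, represents (l.+1%:R / k.+1%:R) w & normc w = 1.
Proof.
set q : R := l.+1%:R / k.+1%:R; have q0 : 0 < q by rewrite divr_gt0.
have Jq f : iter k.+1 (J q) f = iter l.+1 V f.
  rewrite iter_J// /q mulrC divfK ?pnatr_eq0// -[in LHS](mulr1 l.+1%:R) -iter_J//.
  by elim: l.+1 => //= n ->; rewrite J1.
have [w Hw] := root_eq_Nop (fun f => J_V f q0) Jq.
exists w => //.
have itw n f : iter n (J q) f = w ^+ n *: iter n (N q) f.
  by elim: n => [|n IH]; rewrite ?scale1r//= IH Hw opZ scalerA exprS.
(* The powers of order [k + 1] of [J q] and of [N q] are both V^(l + 1), which does not kill 1. *)
have w1 : w ^+ k.+1 = 1.
  have l0 : (0 : R) < l.+1%:R by [].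
  have := itw k.+1 (polyE E 1); rewrite Jq iter_Nop// iter_V /q [_ * (_ / _)]mulrC divfK ?pnatr_eq0//.
  move=> /eqP; rewrite eq_sym -subr_eq0 -[X in _ - X]scale1r -scalerBl scaler_eq0.
  by rewrite (negbTE (Nop_P1_neq0 l0)) orbF subr_eq0 => /eqP.
have nw : normc w ^+ k.+1 = 1.
  have -> : normc w ^+ k.+1 = normc (w ^+ k.+1).
    elim: k.+1 => [|n IH]; first by rewrite !expr0 normc1.
    by rewrite !exprS normcM IH.
  by rewrite w1 normc1.
by apply/eqP; rewrite -(@pexpr_eq1 _ _ k.+1)// ?nw// normc_ge0.
Qed.

Lemma rat_near a (e : R) : 0 < a -> 0 < e -> exists k l, `|a - l.+1%:R / k.+1%:R| < e.
Proof.
move=> a0 e0; pose k := Num.truncn e^-1; exists k, (Num.truncn (a * k.+1%:R)).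
set l := Num.truncn _; have k0 : (0 : R) < k.+1%:R by [].
have /truncn_itv/andP[l1 l2] : 0 <= a * k.+1%:R by rewrite mulr_ge0 ?ltW.
have ke : k.+1%:R^-1 < e.
  by rewrite invf_plt ?posrE//; have := real_truncnS_gt (num_real e^-1).
rewrite distrC ger0_norm; last by rewrite subr_ge0 ler_pdivlMr// ltW.
apply: le_lt_trans ke; rewrite lerBlDr ler_pdivrMr// mulrDl mulVf ?gt_eqF//.
by rewrite -natr1 addrC lerD2l.
Qed.

Lemma represents_limit a w (S : R -> R[i] -> Prop) : 0 < a ->
  (forall b z, S b z -> [/\ 0 < b, normc z = 1 & represents b z]) ->
  (forall e : R, 0 < e -> exists b z, [/\ `|a - b| < e, normc (z - w) < e & S b z]) ->
  represents a w /\ normc w = 1.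
Proof.
move=> a0 HS H; split.
  apply: (J_closed d_metric d_weaker J_cont a0) => e /H[b [z [ab zw /HS[b0 _ bz]]]].
  by exists b, z.
apply/eqP; rewrite -subr_eq0 -normr_eq0; apply/eqP/le_anti; rewrite normr_ge0 andbT.
apply/ler_addgt0Pr => e /H[b [z [_ zw /HS[_ z1 _]]]]; rewrite add0r.
apply: le_trans (ltW zw); rewrite ler_norml.
have h1 := le_normcD (w - z) z; have h2 := le_normcD (z - w) w.
rewrite !subrK z1 in h1 h2.
have nE : normc (w - z) = normc (z - w) by rewrite -normcN opprB.
by rewrite nE in h1; lra.
Qed.

Lemma represents_exists a : 0 < a -> exists2 w, represents a w & normc w = 1.
Proof.
move=> a0.
pose S b z := [/\ 0 < b, normc z = 1 & represents b z].
have [|w Hw] := @cluster_point R a S.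
  move=> e e0; have [k [l h]] := rat_near a0 e0; have [w w1 w2] := represents_rat k l.
  by exists (l.+1%:R / k.+1%:R), w; split; [exact: h|rewrite w2|split=> //; rewrite divr_gt0].
by have [||h1 h2] := @represents_limit a w S a0; [by []|exact: Hw|exists w].
Qed.

(** Were continuity to fail, coefficients at distance at least [e] from [w] would exist arbitrarily
    near [a]. They lie on the unit circle, so they cluster at some [w']; this represents [J a] as
    well, and uniqueness gives [w' = w]. *)
Lemma represents_cont a w : 0 < a -> represents a w -> forall e : R, 0 < e ->
  exists2 del : R, 0 < del & forall b z, 0 < b -> `|a - b| < del ->
    represents b z -> normc (z - w) < e.
Proof.
move=> a0 aw e e0; apply: contrapT => H.
pose S b z := [/\ 0 < b, normc z = 1, represents b z & e <= normc (z - w)].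
have [|w' Hw'] := @cluster_point R a S.
  move=> r r0; apply: contrapT => H'; apply: H; exists r => // b z b0 ab bz.
  rewrite ltNge; apply/negP => ezw; apply: H'; exists b, z.
  have [z' bz' z'1] := represents_exists b0; have zz' := represents_uniq b0 bz bz'.
  by subst z'; split=> //; rewrite z'1.
have [|//|h _] := @represents_limit a w' S a0; first by move=> b z [].
have ww' := represents_uniq a0 aw h; subst w'.
by have [b [z [_ zw [_ _ _ ezw]]]] := Hw' e e0; lra.
Qed.

End semigroup.

(** * Characters of the half-line *)

Section characters.
Context {R : realType}.
Implicit Types (s t a b : R).

Definition cis t : R[i] := cos t +i* sin t.

Lemma cisD s t : cis (s + t) = cis s * cis t.
Proof.
by rewrite /cis cosD sinD; apply/eqP; rewrite eq_complex/=; apply/andP; split; apply/eqP; ring.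
Qed.

Lemma cis0 : cis 0 = 1. Proof. by rewrite /cis cos0 sin0. Qed.

Lemma cisMn t n : cis (t *+ n) = cis t ^+ n.
Proof. by elim: n => [|n IH]; rewrite ?mulr0n ?cis0// mulrS cisD IH exprS. Qed.

Lemma cis_2piMz (z : int) : cis (pi *+ 2 * z%:~R) = 1.
Proof.
have c1 : cis (pi *+ 2) = 1 by rewrite /cis cos2pi sin2pi.
have cn n : cis (pi *+ 2 * n%:R) = 1 by rewrite mulr_natr cisMn c1 expr1n.
case: z => n; first exact: cn.
have : cis (pi *+ 2 * (Negz n)%:~R) * cis (pi *+ 2 * n.+1%:R) = 1.
  by rewrite -cisD -mulrDr NegzE rmorphN/= addNr mulr0 cis0.
by rewrite cn mulr1.
Qed.

(** Modulo [2 pi] the angle is some [u] in [[0, 2 pi[]. If [u > 0], then [sin (u / 2) > 0], and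
    [cos u = 1 - 2 sin (u / 2) ^ 2] is less than 1. *)
Lemma cis_eq1 t : cis t = 1 -> exists z : int, t = pi *+ 2 * z%:~R.
Proof.
move=> t1; have p0 : 0 < (pi : R) *+ 2 by rewrite mulrn_wgt0// pi_gt0.
pose z := Num.floor (t / (pi *+ 2)); exists z.
pose u := t - pi *+ 2 * z%:~R.
have u1 : cis u = 1.
  have : cis u * cis (pi *+ 2 * z%:~R) = 1 by rewrite -cisD subrK.
  by rewrite cis_2piMz mulr1.
have /andP[z1 z2] := floor_itv (t / (pi *+ 2)).
have u0 : 0 <= u by rewrite subr_ge0 mulrC -ler_pdivlMr.
have u2 : u < pi *+ 2.
  move: z2; rewrite ltr_pdivrMr// -/z rmorphD mulrDl mul1r => z2.
  by rewrite /u ltrBlDr addrC mulrC.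
suff ue : u = 0 by apply/eqP; rewrite -subr_eq0; apply/eqP.
apply/eqP; rewrite eq_le u0 andbT leNgt; apply/negP => up.
have sh : 0 < sin (u / 2) by apply: sin_gt0_pi; rewrite divr_gt0//= ltr_pdivrMr// mulr_natr.
have := cos_mulr2n (u / 2); have := sin2cos2 (u / 2).
rewrite -[u / 2 *+ 2]mulr_natr divfK ?pnatr_eq0//; have -> : cos u = 1 by case: u1.
have := exprn_gt0 2 sh; set x2 := sin _ ^+ 2; set y2 := cos _ ^+ 2; lra.
Qed.

Lemma cis_near c a (e : R) : 0 < e -> exists2 del : R, 0 < del &
  forall b, `|a - b| < del -> normc (cis (c * b) - cis (c * a)) < e.
Proof.
move=> e0; have e2 : 0 < e / 2 by rewrite divr_gt0.
have cl : (fun t => c * t) t @[t --> a] --> c * a by exact: mulrl_continuous.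
have /cvgrPdist_lt/(_ _ e2) h1 : cos (c * t) @[t --> a] --> cos (c * a).
  by apply: (continuous_cvg _ _ cl); exact: continuous_cos.
have /cvgrPdist_lt/(_ _ e2) h2 : sin (c * t) @[t --> a] --> sin (c * a).
  by apply: (continuous_cvg _ _ cl); exact: continuous_sin.
have := filterI h1 h2; rewrite -nbhs_ballE => -[del del0 h]; exists del => // b ab.
have [h3 h4] := h b ab.
by apply: le_normc_parts_lt => /=; rewrite distrC.
Qed.

(** In the right half-plane the arcsine of the imaginary part is an argument: the sign of the cosine
    is then the right one. *)
Lemma cis_arg (z : R[i]) : normc z = 1 -> 0 < complex.Re z ->
  exists2 th, - (pi / 2) <= th <= pi / 2 & z = cis th.
Proof.
case: z => x y /= xy x0.
have xy1 : x ^+ 2 + y ^+ 2 = 1.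
  by rewrite -[LHS]sqr_sqrtr ?xy ?expr1n// addr_ge0// sqr_ge0.
have y1 : -1 <= y <= 1.
  by rewrite -ler_norml -(@ler_pXn2r _ 2)// ?nnegrE// expr1n real_normK ?num_real//; have := sqr_ge0 x; lra.
exists (asin y); first by rewrite asin_geNpi2 ?asin_lepi2.
rewrite /cis asinK ?in_itv// cos_asin//; congr (_ +i* _).
by rewrite -xy1 addrK sqrtr_sqr gtr0_norm.
Qed.

Lemma multiple_near a h : 0 < a -> 0 < h -> exists l, `|a - l.+1%:R * h| <= h.
Proof.
move=> a0 h0; exists (Num.truncn (a / h)).
have /truncn_itv/andP[l1 l2] : 0 <= a / h by rewrite divr_ge0 ?ltW.
rewrite distrC ger0_norm; last by rewrite subr_ge0 -ler_pdivrMr// ltW.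
by rewrite -natr1 mulrDl mul1r lerBlDr addrC lerD2l -ler_pdivlMr.
Qed.

Lemma dyadic_small del (e : R) : 0 < del -> 0 < e -> exists k, del / 2 ^+ k < e.
Proof.
move=> d0 e0; pose k := (Num.truncn (del / e)).+1; exists k.
have h : del / e < 2 ^+ k.
  apply: lt_trans (real_truncnS_gt (num_real _)) _.
  by rewrite -natrX ltr_nat ltn_expl.
by rewrite ltr_pdivrMr ?exprn_gt0// mulrC -ltr_pdivrMr.
Qed.

Section character.
Variable om : R -> R[i].
Hypothesis omD : forall a b, 0 < a -> 0 < b -> om (a + b) = om a * om b.
Hypothesis om1 : om 1 = 1.
Hypothesis om_norm : forall a, 0 < a -> normc (om a) = 1.
Hypothesis om_cont : forall a, 0 < a -> forall e : R, 0 < e -> exists2 del : R, 0 < del &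
  forall b, 0 < b -> `|a - b| < del -> normc (om b - om a) < e.

(** [om] carries no information at 0, but [om (1 + t) = om t], so continuity at 1 brings [om t]
    within distance 1 of 1 for small positive [t]. *)
Let om_pos_near0 : exists2 del : R, 0 < del & forall t, 0 < t <= del -> 0 < complex.Re (om t).
Proof.
have [del d0 Hd] := om_cont ltr01 ltr01; exists (del / 2); first by rewrite divr_gt0.
move=> t /andP[t0 td]; have t1 : 0 < 1 + t by rewrite addr_gt0.
have := Hd _ t1; rewrite opprD addNKr normrN gtr0_norm// => /(_ ltac:(lra)).
rewrite omD// om1 mul1r => h; have := le_lt_trans (normc_ge_ReN _) h.
by case: (om t) => u v /=; rewrite ltr_norml; lra.
Qed.

Let omMn a l : 0 < a -> om (l.+1%:R * a) = om a ^+ l.+1.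
Proof.
move=> a0; elim: l => [|l IH]; first by rewrite mul1r expr1.
have la : 0 < l.+1%:R * a by rewrite mulr_gt0.
by rewrite -(natr1 l.+1) mulrDl mul1r (omD la a0) IH -exprSr.
Qed.

(** Halving the argument: [om (del / 2 ^ (k + 1))] and [cis (th / 2 ^ (k + 1))] are square roots of
    the same number. Both have positive real part, so they are equal and not opposite. *)
Let om_dyadic : exists2 del : R, 0 < del & exists th, forall k,
  om (del / 2 ^+ k) = cis (th / 2 ^+ k).
Proof.
have [del d0 Hd] := om_pos_near0; exists del => //.
have [||th thb Eth] := @cis_arg (om del); [exact: om_norm|by apply: Hd; rewrite d0 lexx|].
exists th; elim=> [|k IH]; first by rewrite !expr0 !divr1.
have k0 : (0 : R) < 2 ^+ k.+1 by rewrite exprn_gt0.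
have dk : 0 < del / 2 ^+ k.+1 by rewrite divr_gt0.
have half (u : R) : u / 2 ^+ k = u / 2 ^+ k.+1 + u / 2 ^+ k.+1.
  by rewrite exprS invfM; field; rewrite expf_neq0.
have k2 : (2 : R) <= 2 ^+ k.+1 by rewrite exprS ler_peMr// exprn_ege1// ler1n.
have : om (del / 2 ^+ k.+1) ^+ 2 = cis (th / 2 ^+ k.+1) ^+ 2.
  by rewrite !expr2 -omD// -cisD -!half.
move=> /eqP; rewrite eqf_sqr => /orP[/eqP//|/eqP E].
have h1 : 0 < complex.Re (om (del / 2 ^+ k.+1)).
  by apply: Hd; rewrite dk ler_pdivrMr// ler_peMr ?(ltW d0)//; lra.
have h2 : 0 < cos (th / 2 ^+ k.+1).
  have pp := pi_gt0 R; apply: cos_gt0_pihalf.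
  rewrite ltr_pdivlMr// ltr_pdivrMr// mulNr; case/andP: thb => b1 b2.
  have h : (pi : R) / 2 * 2 <= pi / 2 * 2 ^+ k.+1 by apply: ler_wpM2l => //; lra.
  by apply/andP; split; lra.
by exfalso; rewrite E /= in h1; lra.
Qed.

(** Multiples of the dyadic fractions of [del] come arbitrarily near every [a > 0], so by continuity
    [om a = cis (c a)] with [c = th / del]. The value at 1 forces [c] to be an integral multiple of
    [2 pi]. *)
Lemma character_cis : exists z : int, forall a, 0 < a -> om a = cis (pi *+ 2 * z%:~R * a).
Proof.
have [del d0 [th H]] := om_dyadic.
have key a : 0 < a -> om a = cis (th / del * a).
  move=> a0; apply/eqP; rewrite -subr_eq0; apply/eqP/eq0_normc/le_anti.
  rewrite normc_ge0 andbT; apply/ler_addgt0Pr => e e0; rewrite add0r.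
  have e2 : 0 < e / 2 by rewrite divr_gt0.
  have [d1 d10 H1] := om_cont a0 e2; have [d2 d20 H2] := cis_near (th / del) a e2.
  have m0 : 0 < Num.min d1 d2 by rewrite lt_min d10.
  have [k Hk] := dyadic_small d0 m0.
  have h0 : 0 < del / 2 ^+ k by rewrite divr_gt0 ?exprn_gt0.
  have [l Hl] := multiple_near a0 h0; set b := l.+1%:R * (del / 2 ^+ k) in Hl.
  have b0 : 0 < b by rewrite mulr_gt0.
  have /andP[ab1 ab2] : (`|a - b| < d1) && (`|a - b| < d2).
    by rewrite -lt_min; exact: le_lt_trans Hl Hk.
  have ob : om b = cis (th / del * b).
    rewrite /b omMn// H -cisMn -mulr_natl; congr cis.
    by field; rewrite expf_neq0//= gt_eqF.
  have h1 := H1 b b0 ab1; have h2 := H2 b ab2; rewrite -ob in h2.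
  have := le_normcD (om a - om b) (om b - cis (th / del * a)); rewrite addrA subrK => h3.
  have : normc (om a - om b) = normc (om b - om a) by rewrite -normcN opprB.
  by lra.
have [z Hz] : exists z : int, th / del = pi *+ 2 * z%:~R.
  by apply: cis_eq1; rewrite -om1 key// mulr1.
by exists z => a a0; rewrite key// Hz.
Qed.

End character.
End characters.

Lemma cexp_cis {R : realType} (n : int) (a : R) :
  cexp (2 * n%:~R * pi%:C * 'i%C * a%:C) = cis (pi *+ 2 * n%:~R * a).
Proof.
have -> : 2 * n%:~R * pi%:C * 'i%C * a%:C = 0 +i* (pi *+ 2 * n%:~R * a) :> R[i].
  have -> : (n%:~R : R[i]) = (n%:~R)%:C by rewrite rmorph_int.
  by apply/eqP; rewrite eq_complex/=; apply/andP; split; apply/eqP; ring.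
by rewrite /cexp /= expR0 mul1r.
Qed.

Lemma eq_same {R : realType} (E : fspace R) (f g : R -> R[i]^o) :
  {in I01, f =1 g} -> same E f g.
Proof. by case: E => [//|p p1] fg; apply: aeW => x /mem_set; exact: fg. Qed.

Theorem theorem4p1 (R : realType) (E : fspace R) (J : R -> bounded_op E)
    (J_one : forall f : E, {ae @lebesgue_measure R, forall x, x \in I01 ->
       fun_of (J 1 f) x = cintegral `[0, x] (fun_of f)})
    (J_add : forall a b : R, 0 < a -> 0 < b -> J a \o J b =1 J (a + b))
    (J_cont : exists d : bounded_op E -> bounded_op E -> R,
       [/\ is_metric d, weaker_metric d (@opdist R E) &
           forall a : R, 0 < a -> d (J a) (J b) @[b --> a] --> 0]) :
  exists n : int, forall (a : R) (f : E), 0 < a ->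
    same E (fun_of (J a f))
      (fun x => cexp (2 * n%:~R * pi%:C * 'i%C * a%:C) * RLint a (fun_of f) x).
Proof.
have [d [dm dw dc]] := J_cont.
have /choice[om Hom] : forall a : R, exists w, 0 < a -> represents J a w /\ normc w = 1.
  move=> a; have [a0|a0] := boolP (0 < a); last by exists 0 => h; case/negP: a0.
  by have [w w1 w2] := represents_exists J_one J_add dm dw dc a0; exists w.
have omD a b : 0 < a -> 0 < b -> om (a + b) = om a * om b.
  move=> a0 b0; have ab0 : 0 < a + b by rewrite addr_gt0.
  apply: (represents_uniq ab0 (Hom _ ab0).1) => f.
  have := J_add a b a0 b0 f => /= <-.
  by rewrite (Hom _ b0).1 opZ (Hom _ a0).1 scalerA mulrC Nop_add.
have om1 : om 1 = 1.
  apply: (represents_uniq ltr01 (Hom _ ltr01).1) => f.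
  by rewrite scale1r (J1 J_one).
have [n Hn] := character_cis omD om1 (fun a a0 => (Hom a a0).2)
  (fun a a0 e e0 => let: ex_intro2 del d0 h := represents_cont J_one J_add dm dw dc a0 (Hom a a0).1 e0 in
     ex_intro2 _ _ del d0 (fun b b0 ab => h b (om b) b0 ab (Hom b b0).1)).
exists n => a f a0; have cf := carrier_fun_of f.
have crl := carrier_rl a0 cf.
rewrite (Hom _ a0).1 NopE// -toEZ//.
apply: same_trans (toEP (carrier_defZ (om a) crl)) _.
(* The representative given by [rl] satisfies the formula at every point of [0, 1], so both meanings
   of [same] follow at once. *)
apply: eq_same => x xI.
by rewrite cexp_cis -Hn// (RLintE _ cf xI) /rl !fctE.
Qed.
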